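(* Let $0<\gamma<n$, let $m\in\mathbb{N}$ (a positive integer), $0<\delta<\min\{(n-\gamma)/m,1\}$ and $b\in\Lambda(\delta)$. Let $1\leq p<n/(\gamma+m\delta)$ and let $q$ be such that $1/q=1/p-(\gamma+m\delta)/n$. Let $u,v$ be weights on $\mathbb{R}^n$ satisfying either (i) $u\in A_1$ and $v^{q/p}\in A_1$, or (ii) $uv^{-q/p'}\in A_1$ and $v^q\in A_\infty(uv^{-q/p'})$. Then there is a constant $C$ such that \[ \left(uv^{q/p}\left(\left\{x\in\mathbb{R}^n:\frac{|I_{\gamma,b}^m(fv)(x)|}{v(x)}>t\right\}\right)\right)^{1/q}\leq\frac{C}{t}\,\|b\|_{\Lambda(\delta)}^m\left(\int_{\mathbb{R}^n}|f(x)|^p\,u(x)^{p/q}\,v(x)\,dx\right)^{1/p} \] for every $t>0$ and every bounded function $f$ with compact support.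
   Context: A weight $w$ is a locally integrable function on $\mathbb{R}^n$ with $0<w(x)<\infty$ for a.e. $x$. For a nonnegative function $w$ and a measurable set $E$, $w(E)=\int_E w(x)\,dx$. $p'$ is the conjugate exponent of $p$, with $p'=\infty$ if $p=1$ (so $q/p'=0$ when $p=1$). Cubes $Q\subset\mathbb{R}^n$ have sides parallel to the coordinate axes; infima of weights over cubes are essential infima. $w\in A_1$ means there is $C>0$ with $\frac{1}{|Q|}\int_Q w\leq C\inf_Q w$ for every cube $Q$. For a weight $\mu$: $w\in A_r(\mu)$, $1<r<\infty$, means there is $C>0$ such that $\left(\frac{1}{\mu(Q)}\int_Q w\,\mu\,dx\right)\left(\frac{1}{\mu(Q)}\int_Q w^{-\frac{1}{r-1}}\mu\,dx\right)^{r-1}\leq C$ for every cube $Q$; $w\in A_1(\mu)$ means $\frac{1}{\mu(Q)}\int_Q w\,\mu\,dx\leq C\inf_Q w$ for every cube $Q$; $A_\infty(\mu)=\bigcup_{1\le r<\infty}A_r(\mu)$. $\Lambda(\delta)$ is the class of (real-valued) $b\in L^1_{\mathrm{loc}}$ for which there is $C>0$ with $|b(x)-b(y)|\leq C|x-y|^\delta$ for all $x,y\in\mathbb{R}^n$; the smallest such $C$ is $\|b\|_{\Lambda(\delta)}$. The fractional integral operator is $I_\gamma f(x)=\int_{\mathbb{R}^n}\frac{f(y)}{|x-y|^{n-\gamma}}\,dy$. Its commutators with symbol $b$ are defined inductively by $I_{\gamma,b}^0=I_\gamma$ and $I_{\gamma,b}^m=[b,I_{\gamma,b}^{m-1}]$,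 where $[b,S]f=b\,Sf-S(bf)$; equivalently $I_{\gamma,b}^mf(x)=\int_{\mathbb{R}^n}(b(x)-b(y))^m\frac{f(y)}{|x-y|^{n-\gamma}}\,dy$ for a.e. $x$. *)

(* Defs.v *)
From HB Require Import structures.
From mathcomp Require Import all_boot all_order all_algebra.
From mathcomp Require Import all_classical all_reals all_analysis.
From mathcomp Require Import ess_sup_inf.

Set Implicit Arguments.
Unset Strict Implicit.
Unset Printing Implicit Defensive.

Import Order.TTheory GRing.Theory Num.Theory.
Import numFieldNormedType.Exports.

Local Open Scope classical_set_scope.
Local Open Scope ring_scope.

(* ['rV[R]_n] carries no measurable structure in the library.  As for tuples,
   its Borel sigma-algebra is generated by the coordinate projections. *)
Definition coord_cylinders (R : realType) (n : nat) : set (set 'rV[R]_n) :=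
  [set S | exists i (A : set (measurableTypeR R)),
     measurable A /\ S = [set x : 'rV[R]_n | A (x ord0 i)]].

Notation borel_rV R n := (g_sigma_algebraType (@coord_cylinders R n)).

Definition cons_rV (R : realType) (n : nat)
    (p : measurableTypeR R * borel_rV R n) : borel_rV R n.+1 :=
  row_mx (const_mx p.1 : 'rV[R]_1) (p.2 : 'rV[R]_n).

Definition uncons_rV (R : realType) (n : nat) (x : borel_rV R n.+1) :
    measurableTypeR R * borel_rV R n :=
  ((x : 'rV[R]_(1 + n)) ord0 (lshift n ord0), rsubmx (x : 'rV[R]_(1 + n))).

Lemma cons_rVK R n : cancel (@cons_rV R n) (@uncons_rV R n).
Proof.
case=> a x; rewrite /uncons_rV /cons_rV; congr pair.
  by rewrite (row_mxEl (const_mx a : 'rV[R]_1)) mxE.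
exact: row_mxKr.
Qed.

Lemma measurable_coord (R : realType) (n : nat) (i : 'I_n) :
  measurable_fun setT
    (fun x : borel_rV R n => (x : 'rV[R]_n) ord0 i : measurableTypeR R).
Proof.
by move=> _ A mA; rewrite setTI; apply: sub_sigma_algebra; exists i, A.
Qed.

Lemma measurable_to_rV d (T : measurableType d) (R : realType) (n : nat)
    (f : T -> borel_rV R n) :
  (forall i, measurable_fun setT
     (fun t => (f t : 'rV[R]_n) ord0 i : measurableTypeR R)) ->
  measurable_fun setT f.
Proof.
move=> mf; apply: measurability => //.
by move=> _ [_ [i [A [mA ->]]] <-]; exact: mf.
Qed.

Lemma measurable_cons_rV (R : realType) (n : nat) :
  measurable_fun setT (@cons_rV R n).
Proof.
apply: measurable_to_rV => i.
rewrite -(splitK (i : 'I_(1 + n))); case: (fintype.split (i : 'I_(1 + n))) => j /=.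
  rewrite (_ : (fun _ => _) = fst); first exact: measurable_fst.
  by apply/funext => p; rewrite (row_mxEl (const_mx p.1 : 'rV[R]_1)) mxE.
rewrite (_ : (fun _ => _) =
    (fun x : borel_rV R n => (x : 'rV[R]_n) ord0 j : measurableTypeR R) \o snd).
  by apply: measurableT_comp; [exact: measurable_coord|exact: measurable_snd].
by apply/funext => p; exact: (row_mxEr (const_mx p.1 : 'rV[R]_1)).
Qed.

Lemma measurable_uncons_rV (R : realType) (n : nat) :
  measurable_fun setT (@uncons_rV R n).
Proof.
apply/measurable_fun_pairP; split; first exact: measurable_coord.
apply: measurable_to_rV => i; rewrite (_ : (fun _ => _) =
    (fun x : borel_rV R n.+1 => (x : 'rV[R]_n.+1) ord0 (rshift 1 i))).
  exact: measurable_coord.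
by apply/funext => x; rewrite /= mxE.
Qed.

(* Lebesgue measure in dimension [n.+1] is the product of the one-dimensional
   Lebesgue measure with [mu], transported along [(a, x) |-> (a, x_0, x_1, etc)]. *)
Section lebesgue_succ.
Context (R : realType) (n : nat).
Variable mu : {sigma_finite_measure set (borel_rV R n) -> \bar R}.

Definition lebesgue_succ : set (borel_rV R n.+1) -> \bar R :=
  pushforward (@lebesgue_measure R \x mu)%E (@cons_rV R n).

Let lebesgue_succ0 : lebesgue_succ set0 = 0%E.
Proof. exact: (measure0 (@lebesgue_measure R \x mu)%E). Qed.

Let lebesgue_succ_ge0 A : (0 <= lebesgue_succ A)%E.
Proof. exact: (measure_ge0 (@lebesgue_measure R \x mu)%E). Qed.

Let lebesgue_succ_sigma_additive : semi_sigma_additive lebesgue_succ.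
Proof.
move=> F mF tF mUF; rewrite /lebesgue_succ /pushforward preimage_bigcup.
have mcons A : measurable A -> measurable (@cons_rV R n @^-1` A).
  by move=> mA; rewrite -[X in measurable X]setTI; exact: measurable_cons_rV.
apply: measure_semi_sigma_additive => [k||]; first exact: mcons.
  apply/trivIsetP => i j _ _ ij; rewrite -preimage_setI.
  by move/trivIsetP : tF => /(_ _ _ _ _ ij) ->//; rewrite preimage_set0.
by rewrite -preimage_bigcup; exact: mcons.
Qed.

HB.instance Definition _ := isMeasure.Build _ _ _ lebesgue_succ
  lebesgue_succ0 lebesgue_succ_ge0 lebesgue_succ_sigma_additive.

Let lebesgue_succ_sigma_finite : sigma_finite setT lebesgue_succ.
Proof.
have /sigma_finiteP[F [TF ndF Foo]] := sigma_finiteT (@lebesgue_measure R).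
have /sigma_finiteP[G [TG ndG Goo]] := sigma_finiteT mu.
exists (fun k => @uncons_rV R n @^-1` (F k `*` G k)).
  rewrite -preimage_bigcup (_ : \bigcup_k _ = setT) ?preimage_setT//.
  rewrite predeqE => -[x y]; split=> // _.
  have [[i _ Fix] [j _ Gjy]] : (\bigcup_k F k) x /\ (\bigcup_k G k) y.
    by rewrite -TF -TG.
  exists (maxn i j) => //; split.
  - by move: (x) Fix; exact/subsetPset/ndF/leq_maxl.
  - by move: (y) Gjy; exact/subsetPset/ndG/leq_maxr.
move=> k; have [mF F_oo] := Foo k; have [mG G_oo] := Goo k; split.
  rewrite -[X in measurable X]setTI; apply: measurable_uncons_rV => //.
  exact: measurableX.
rewrite /lebesgue_succ /pushforward -comp_preimage.
rewrite (_ : _ \o _ = id) ?preimage_id.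
  by rewrite product_measure1E// lte_mul_pinfty// ge0_fin_numE.
by apply/funext => p; exact: cons_rVK.
Qed.

HB.instance Definition _ := Measure_isSigmaFinite.Build _ _ _ lebesgue_succ
  lebesgue_succ_sigma_finite.

End lebesgue_succ.

Fixpoint borel_lebesgue (R : realType) (n : nat) :
    {sigma_finite_measure set (borel_rV R n) -> \bar R} :=
  match n with
  | 0 => @dirac _ (borel_rV R 0) (0 : 'rV[R]_0) R
  | n'.+1 => lebesgue_succ (borel_lebesgue R n')
  end.

(* Lebesgue measurable sets are the Caratheodory measurable ones, so that
   measurability below is not restricted to Borel functions. *)
Notation lebesgue_rV_type R n :=
  (caratheodory_type (borel_lebesgue R n)^*%mu).

Definition lebesgue_rV (R : realType) (n : nat) :
    set (lebesgue_rV_type R n) -> \bar R :=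
  @completed_measure_extension _ _ _ (borel_lebesgue R n).

HB.instance Definition _ (R : realType) (n : nat) :=
  Measure.on (@lebesgue_rV R n).
HB.instance Definition _ (R : realType) (n : nat) :=
  @Measure_isSigmaFinite.Build _ _ _ (@lebesgue_rV R n)
    (completed_measure_extension_sigma_finite
      (sigma_finiteT (borel_lebesgue R n))).

(* The norm instance of the library on ['rV[R]_n] is the sup norm. *)
Definition enorm (R : realType) (n : nat) (x : 'rV[R]_n) : R :=
  Num.sqrt (\sum_(i < n) x ord0 i ^+ 2).

Section weights.
Context (R : realType) (n : nat).
Local Notation mu := (@lebesgue_rV R n).
Implicit Types (f w m : 'rV[R]_n -> R) (A Q : set 'rV[R]_n).

Definition lebesgue_measurable_fun f :=
  measurable_fun [set: lebesgue_rV_type R n] f.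

Definition locally_integrable_rV f :=
  lebesgue_measurable_fun f /\
  forall K : set 'rV[R]_n, compact K ->
    (\int[mu]_(x in K) `|f x|%:E < +oo)%E.

(* Weights are real-valued representatives of their a.e. class; finiteness is
   thus built in. *)
Definition weight w :=
  locally_integrable_rV w /\ {ae mu, forall x, 0 < w x}.

Definition weighted w A : \bar R := (\int[mu]_(x in A) (w x)%:E)%E.

Definition cube (a : 'rV[R]_n) (l : R) : set 'rV[R]_n :=
  [set x | forall i, a ord0 i <= x ord0 i <= a ord0 i + l].

Definition is_cube Q := exists a l, 0 < l /\ Q = cube a l.

(* Off [Q] the function is replaced by [+oo], which leaves the essential
   infimum over [Q]. *)
Definition ess_inf_on Q w : \bar R :=
  ess_inf mu (patch (cst +oo%E) Q (EFin \o w)).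

Definition A1 w := exists2 C : R, 0 < C & forall Q, is_cube Q ->
  ((mu Q)^-1 * weighted w Q <= C%:E * ess_inf_on Q w)%E.

Definition A1_mu m w := exists2 C : R, 0 < C & forall Q, is_cube Q ->
  ((weighted m Q)^-1 * weighted (fun x => w x * m x)%R Q
     <= C%:E * ess_inf_on Q w)%E.

Definition Ar_mu (r : R) m w := exists2 C : R, 0 < C & forall Q, is_cube Q ->
  ((weighted m Q)^-1 * weighted (fun x => w x * m x)%R Q *
   ((weighted m Q)^-1 *
     weighted (fun x => (w x `^ (- (r - 1)^-1)) * m x)%R Q) `^ (r - 1)
     <= C%:E)%E.

Definition Ainfty_mu m w := A1_mu m w \/ exists2 r : R, 1 < r & Ar_mu r m w.

End weights.

Section lipschitz.
Context (R : realType) (n : nat).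
Implicit Types (b : 'rV[R]_n -> R) (d C : R).

Definition holder_bound d b C :=
  forall x y, `|b x - b y| <= C * enorm (x - y) `^ d.

Definition Lambda d b :=
  locally_integrable_rV b /\ exists2 C, 0 < C & holder_bound d b C.

Definition Lambda_norm d b : R := inf [set C | 0 < C /\ holder_bound d b C].

End lipschitz.

Section fractional_integral.
Context (R : realType) (n : nat).
Implicit Types (b f : 'rV[R]_n -> R).

(* At [y = x] the integrand is [f x / 0 = 0] when [g < n]. *)
Definition fractional_integral (g : R) f : 'rV[R]_n -> R :=
  fun x => \int[@lebesgue_rV R n]_y (f y / enorm (x - y) `^ (n%:R - g)).

Definition commutator b (S : ('rV[R]_n -> R) -> 'rV[R]_n -> R) f :
    'rV[R]_n -> R :=
  fun x => b x * S f x - S (fun y => b y * f y) x.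

Definition fractional_commutator (g : R) b (k : nat) :
    ('rV[R]_n -> R) -> 'rV[R]_n -> R :=
  iter k (commutator b) (fractional_integral g).

End fractional_integral.

(* Main.v *)
Require Import Defs.
From mathcomp Require Import all_boot all_order all_algebra.
From mathcomp Require Import all_classical all_reals all_analysis.
From mathcomp Require Import measurable_realfun ess_sup_inf lra ring zify.

(** The commutator is dominated by a fractional integral.  Let
    alpha = gamma + m delta, let D(x, y) be the n-th power of the sup distance
    of x and y, and write p' for the conjugate exponent of p.  As b is Hoelder
    continuous, |b x - b y|^m |x - y|^(gamma - n) is at most
    ||b||^m D(x, y)^(-(1/q + 1/p')), since n - alpha = n (1/q + 1/p').  For
    almost every x the integral of |f v| against |x - .|^(gamma - n) converges
    ([potential_ae_fin]), the iterated commutator is a single integral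
    ([kernel_commutatorE]), and it is at most ||b||^m times the integral of
    g D(x, .)^(-(1/q + 1/p')) with g = |f| v.

    Both hypotheses on the weights are instances of one situation with three
    weights: U = u, V = v^(q/p), S = v in case (i), and U = u v^(-q/p'),
    V = v^q, S = 1 in case (ii).  In both cases u v^(q/p) = U V,
    v = V^(1/q) S^(1/p') and |f|^p u^(p/q) v = g^p U^(p/q) S^(1-p).  Let
    psi(z) be z^th for z < 1 and z^(-ka) for z >= 1.  What is used of the
    weights is that, for all th, ka > 0, almost every y and every t > 0,

      the integral over x of psi(V(x) D(x, y) / t) U(x) / D(x, y)
      is at most C U(y)                                   ([testing V U]),

    together with the same property for the pair (U, S) when p > 1.

    Given these two properties ([weak_type]), split the fractional integral at
    a point x of the level set along U(y) D(x, y) = tau / V(x).  By Hoelder's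
    inequality and the testing property of (U, S) the part where
    U(y) D(x, y) is larger is at most t v(x) / 2 for a suitable constant tau.
    Hence the other part is at least t v(x) / 2; its p-th power is estimated by
    Hoelder's inequality and the testing property of (U, S) again, this time
    keeping an integral over y.  Integrate against U V and exchange the
    integrals: the inner one is a testing integral of the pair (V, U) at y, at
    scale tau / U(y).

    The testing property is proved by summing over dyadic rings around y
    ([ring_sum]).  Let x(r) be V(B(y, r)) / t if V is in A_1, and
    (V U)(B(y, r)) / (t U(y)) if V is in A_r(U).  It gains a fixed factor when
    r doubles.  If x(r) is small, Chebyshev's inequality shows that V r^n is
    small with respect to t on most of the ball B(y, r), and if x(r) is large,
    the A_1 or A_r condition shows that V r^n is large; most is meant for the
    measure U.  Thus psi is at most a power of min(x(r), 1/x(r)) on most of the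
    ring, and the rings add up to a geometric series around the radius where
    x(r) crosses 1.  When V is in A_1, Chebyshev's inequality is about the
    Lebesgue measure, and passing to U requires that U, being in A_1, satisfies
    the A_infinity inequality ([Ainfty_ball_of_A1]), which is obtained by a
    stopping time argument on dyadic cubes.

    The ring sums and the weak type bound use only a measurable distance for
    which the balls of radius r have measure (2 r)^n.  They are proved on an
    abstract measurable space and applied to R^n with the sup distance, whose
    balls are the cubes. *)

Set Implicit Arguments.
Unset Strict Implicit.
Unset Printing Implicit Defensive.

Import Order.TTheory GRing.Theory Num.Theory.
Import numFieldNormedType.Exports.

Local Open Scope classical_set_scope.
Local Open Scope ring_scope.

(** * Boxes, cubes and the sup distance *)

Section basics.
Context (R : realType).

Lemma borel_measurable_rV (n : nat) (A : set (borel_rV R n)) :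
  measurable A -> measurable (A : set (lebesgue_rV_type R n)).
Proof. exact: caratheodory_measurable_mu_ext. Qed.

Lemma lebesgue_rVE (n : nat) (A : set (borel_rV R n)) : measurable A ->
  @lebesgue_rV R n A = borel_lebesgue R n A.
Proof. by move=> mA; rewrite /lebesgue_rV /completed_measure_extension measurable_mu_extE. Qed.

Definition box (n : nat) (I : 'I_n -> set R) : set 'rV[R]_n :=
  [set x | forall i, I i (x ord0 i)].

Lemma measurable_box_borel (n : nat) (I : 'I_n -> set R) :
  (forall i, measurable (I i : set (measurableTypeR R))) ->
  measurable (box I : set (borel_rV R n)).
Proof.
move=> mI; rewrite (_ : box I = \bigcap_(i in [set: 'I_n]) [set x | I i (x ord0 i)]).
  apply: fin_bigcap_measurable => // i _.
  by apply: sub_sigma_algebra; exists i, (I i).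
by apply/seteqP; split => [x Ix i _|x Ix i]; exact: Ix.
Qed.

Lemma lebesgue_box_borel (n : nat) (I : 'I_n -> set R) :
  (forall i, measurable (I i : set (measurableTypeR R))) ->
  borel_lebesgue R n (box I) = (\prod_(i < n) lebesgue_measure (I i))%E.
Proof.
elim: n I => [|n IH] I mI.
  rewrite big_ord0 /= diracE mem_set//; by case.
have mt := measurable_box_borel (fun i => mI (lift ord0 i)).
rewrite big_ord_recl /= /lebesgue_succ /pushforward.
rewrite (_ : _ @^-1` _ = I ord0 `*` box (fun i => I (lift ord0 i))).
  by rewrite product_measure1E ?IH.
have lE (i : 'I_n) : lift ord0 i = rshift 1 i by apply/val_inj.
have oE : ord0 = @lshift 1 n ord0 :> 'I_n.+1 by apply/val_inj.
have c0 a x : (cons_rV (a, x) : 'rV[R]_n.+1) ord0 ord0 = a.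
  by rewrite /cons_rV oE (row_mxEl (const_mx _ : 'rV[R]_1)) mxE.
have cS a x i : (cons_rV (a, x) : 'rV[R]_n.+1) ord0 (lift ord0 i) = (x : 'rV[R]_n) ord0 i.
  by rewrite /cons_rV lE (row_mxEr (const_mx _ : 'rV[R]_1)).
apply/seteqP; split => -[a x] /=.
  by move=> Ix; split; [have := Ix ord0; rewrite c0|move=> i; have := Ix (lift ord0 i); rewrite cS].
case=> /= Ia Ix i.
by case: (unliftP ord0 i) => [j ->|->]; rewrite ?cS ?c0//; exact: Ix.
Qed.

Lemma measurable_box (n : nat) (I : 'I_n -> set R) :
  (forall i, measurable (I i : set (measurableTypeR R))) ->
  measurable (box I : set (lebesgue_rV_type R n)).
Proof. by move=> mI; apply: borel_measurable_rV; exact: measurable_box_borel. Qed.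

Lemma lebesgue_box (n : nat) (I : 'I_n -> set R) :
  (forall i, measurable (I i : set (measurableTypeR R))) ->
  @lebesgue_rV R n (box I) = (\prod_(i < n) lebesgue_measure (I i))%E.
Proof. by move=> mI; rewrite lebesgue_rVE ?lebesgue_box_borel//; exact: measurable_box_borel. Qed.

Lemma measurable_coord_leb (n : nat) (i : 'I_n) :
  measurable_fun setT (fun x : lebesgue_rV_type R n => (x : 'rV[R]_n) ord0 i).
Proof.
move=> _ A mA; rewrite setTI; apply: borel_measurable_rV.
by apply: sub_sigma_algebra; exists i, A.
Qed.

Lemma cubeE n (a : 'rV[R]_n) l : cube a l = box (fun i => `[a ord0 i, a ord0 i + l]%classic).
Proof. by apply/seteqP; split => x /= h i; have := h i; rewrite /= in_itv. Qed.

Lemma measurable_cube n (a : 'rV[R]_n) l :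
  measurable (cube a l : set (lebesgue_rV_type R n)).
Proof. by rewrite cubeE; apply: measurable_box => i; exact: measurable_itv. Qed.

Lemma prod_cst_EFin n (l : R) : (\prod_(i < n) l%:E)%E = (l ^+ n)%:E.
Proof.
elim: n => [|n IH]; first by rewrite big_ord0 expr0.
by rewrite big_ord_recl IH -EFinM exprS.
Qed.

Lemma lebesgue_cube n (a : 'rV[R]_n) l : 0 < l ->
  @lebesgue_rV R n (cube a l) = (l ^+ n)%:E.
Proof.
move=> l0; rewrite cubeE lebesgue_box => [|i]; last exact: measurable_itv.
rewrite -prod_cst_EFin; apply: eq_bigr => i _.
by rewrite lebesgue_measure_itv/= lte_fin ltrDl l0 -EFinB addrAC subrr add0r.
Qed.

Definition supdist n (x y : 'rV[R]_n) : R :=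
  \big[Num.max/0]_(i < n) `|x ord0 i - y ord0 i|.

Lemma supdist_ge0 n (x y : 'rV[R]_n) : 0 <= supdist x y.
Proof. by rewrite /supdist; elim/big_ind: _ => // a b a0 b0; rewrite le_max a0. Qed.

Lemma supdist_leP n (x y : 'rV[R]_n) r : 0 <= r ->
  reflect (forall i, `|x ord0 i - y ord0 i| <= r) (supdist x y <= r).
Proof.
move=> r0; apply: (iffP idP) => [h i|h].
  by apply: le_trans h; rewrite /supdist; exact: le_bigmax.
by apply/bigmax_leP; split.
Qed.

Lemma supdistC n (x y : 'rV[R]_n) : supdist x y = supdist y x.
Proof. by apply: eq_bigr => i _; rewrite distrC. Qed.

Lemma supdist_eq0 n (x y : 'rV[R]_n) : supdist x y = 0 -> x = y.
Proof.
move=> h; have /(supdist_leP _ _ (lexx 0)) h0 : supdist x y <= 0 by rewrite h.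
apply/rowP => i; have := h0 i; rewrite normr_le0 subr_eq0 => /eqP.
by [].
Qed.

Lemma supdist_le_enorm n (x y : 'rV[R]_n) : supdist x y <= enorm (x - y).
Proof.
apply/supdist_leP; first by rewrite sqrtr_ge0.
move=> i; rewrite -sqrtr_sqr /enorm ler_wsqrtr// (bigD1 i)//= !mxE.
by rewrite lerDl sumr_ge0// => j _; rewrite sqr_ge0.
Qed.

Lemma measurable_supdist d (T : measurableType d) n (f g : T -> 'rV[R]_n) :
  measurable_fun setT (f : T -> borel_rV R n) ->
  measurable_fun setT (g : T -> borel_rV R n) ->
  measurable_fun setT (fun t => supdist (f t) (g t)).
Proof.
move=> mf mg; rewrite /supdist.
suff h (s : seq 'I_n) : measurable_fun setT
    (fun t => \big[Num.max/0]_(i <- s) `|f t ord0 i - g t ord0 i|) by exact: h.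
elim: s => [|i s IH].
  by under eq_fun do rewrite big_nil; exact: measurable_cst.
under eq_fun do rewrite big_cons.
apply: measurable_maxr => //; apply: measurableT_comp => //.
apply: measurable_funB.
  by apply: (measurableT_comp (measurable_coord i) mf).
by apply: (measurableT_comp (measurable_coord i) mg).
Qed.

Lemma measurable_idb n : measurable_fun setT (id : lebesgue_rV_type R n -> borel_rV R n).
Proof. by move=> _ A mA; rewrite setTI; exact: borel_measurable_rV. Qed.

Lemma cubeball n (y : 'rV[R]_n) r : 0 <= r ->
  [set x | supdist x y <= r] = cube (y - const_mx r) (2 * r).
Proof.
move=> r0; apply/seteqP; split => x /=.
  move/(supdist_leP _ _ r0) => h i; have := h i; rewrite !mxE ler_norml => /andP[]; lra.
move=> h; apply/supdist_leP => // i; have := h i; rewrite !mxE ler_norml; lra.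
Qed.

End basics.

(** * Weighted measures *)

Lemma le_of_eq d (T : porderType d) (x y : T) : x = y -> (x <= y)%O.
Proof. by move=> ->. Qed.

Section tools.
Context (R : realType).

Lemma powR_halfM (x : R) : 0 < x -> x `^ 2^-1 * x `^ 2^-1 = x.
Proof.
move=> x0; rewrite -powRD; last by rewrite (gt_eqF x0) implybT.
by rewrite (_ : 2^-1 + 2^-1 = 1) ?powRr1 ?(ltW x0)//; lra.
Qed.

Lemma measurable_invr : measurable_fun [set: R] (@GRing.inv R).
Proof.
rewrite (_ : GRing.inv = fun x => x * (x ^+ 2) `^ (-1)); last first.
  apply/funext => x; rewrite powR_inv1 ?sqr_ge0//.
  have [->|x0] := eqVneq x 0; first by rewrite invr0 mul0r.
  by rewrite expr2 invfM mulrA mulfV// mul1r.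
apply: measurable_funM => //.
exact: (measurableT_comp (measurable_powR (-1)) (@exprn_measurable R setT 2%N)).
Qed.

Lemma measurable_funV d (T : measurableType d) (f : T -> R) :
  measurable_fun setT f -> measurable_fun setT (fun x => (f x)^-1).
Proof. by move=> mf; exact: (measurableT_comp measurable_invr mf). Qed.

Lemma measurable_funpow d (T : measurableType d) (f : T -> R) (a : R) :
  measurable_fun setT f -> measurable_fun setT (fun x => f x `^ a).
Proof. by move=> mf; exact: (measurableT_comp (measurable_powR _) mf). Qed.

Lemma nneseries_geometric (c a : R) : 0 <= c -> 0 <= a < 1 ->
  (\sum_(i <oo) (c * a ^+ i)%:E = (c / (1 - a))%:E)%E.
Proof.
move=> c0 /andP[a0 a1]; apply/cvg_lim => //.
rewrite (_ : (fun _ => _) = EFin \o series (geometric c a)); last first.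
  by apply/funext => k; rewrite /= sumEFin.
by apply: cvg_EFin; [exact: nearW|apply: cvg_geometric_series; rewrite ger0_norm].
Qed.

(** Countable subadditivity, for a cover of the set where the integrand is positive:
    the dyadic rings around a point miss the point itself. *)
Lemma integral_cover_le d (T : measurableType d) (mu : {measure set T -> \bar R})
    (F : T -> R) (E : (set T)^nat) (b : R^nat) :
  measurable_fun setT F -> (forall x, 0 <= F x) -> (forall i, measurable (E i)) ->
  (forall x, 0 < F x -> exists i, E i x) ->
  (forall i, \int[mu]_(x in E i) (F x)%:E <= (b i)%:E)%E ->
  (\int[mu]_x (F x)%:E <= \sum_(i <oo) (b i)%:E)%E.
Proof.
move=> mF F0 mE FE bE.
have mG i : measurable_fun setT (((fun x => (F x)%:E) \_ (E i))%E).
  by apply/(measurable_restrictT _ (mE i)); apply: measurable_funTS; exact/measurable_EFinP.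
have G0 i x : (0 <= ((fun x => (F x)%:E) \_ (E i)) x)%E.
  by rewrite patchE; case: ifP => // _; rewrite lee_fin.
apply: (@le_trans _ _ (\sum_(i <oo) \int[mu]_x ((fun x => (F x)%:E) \_ (E i)) x)%E); last first.
  apply: lee_nneseries => i _; first by rewrite integral_ge0.
  by rewrite -integral_mkcond.
rewrite -integral_nneseries//; apply: ge0_le_integral => //.
- by move=> x _; rewrite lee_fin.
- exact/measurable_EFinP.
- by apply: ge0_emeasurable_sum => // i _; exact: mG.
move=> x _; have := F0 x; rewrite le_eqVlt => /predU1P[<-|/FE[i Ei]].
  by rewrite nneseries_ge0.
rewrite (@nneseriesD1 _ _ i)//= patchE mem_set// leeDl//.
by rewrite nneseries_ge0.
Qed.

(** The measure w(A) with density w, for a real valued density. *)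
Definition wint d (T : measurableType d) (mu : {measure set T -> \bar R})
  (w : T -> R) (A : set T) : \bar R := (\int[mu]_(x in A) (w x)%:E)%E.

Section wint.
Context d (T : measurableType d) (mu : {measure set T -> \bar R}).
Implicit Types (w f g : T -> R) (A B : set T).

Lemma wint_ge0 w A : (forall x, A x -> 0 <= w x) -> (0 <= wint mu w A)%E.
Proof. by move=> w0; apply: integral_ge0 => x Ax; rewrite lee_fin w0. Qed.

Lemma le_wint f g A : measurable A ->
  measurable_fun setT f -> measurable_fun setT g ->
  (forall x, A x -> 0 <= f x <= g x) -> (wint mu f A <= wint mu g A)%E.
Proof.
move=> mA mf mg fg; apply: ge0_le_integral => //.
- by move=> x /fg /andP[]; rewrite lee_fin.
- by apply: measurable_funTS; exact/measurable_EFinP.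
- by apply: measurable_funTS; exact/measurable_EFinP.
- by move=> x /fg /andP[_]; rewrite lee_fin.
Qed.

Lemma wint_subset w A B : measurable_fun setT w -> (forall x, 0 <= w x) ->
  measurable A -> measurable B -> A `<=` B -> (wint mu w A <= wint mu w B)%E.
Proof.
move=> mw w0 mA mB AB; apply: ge0_subset_integral => //.
  by apply: measurable_funTS; exact/measurable_EFinP.
by move=> x _; rewrite lee_fin.
Qed.

Lemma wintZ w A c : measurable A -> measurable_fun setT w ->
  (forall x, 0 <= w x) -> 0 <= c ->
  wint mu (fun x => c * w x) A = (c%:E * wint mu w A)%E.
Proof.
move=> mA mw w0 c0; rewrite /wint; under eq_integral do rewrite EFinM.
rewrite ge0_integralZl_EFin//; first by move=> x _; rewrite lee_fin.
by apply: measurable_funTS; exact/measurable_EFinP.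
Qed.

Lemma wintD f g A : measurable A -> measurable_fun setT f -> measurable_fun setT g ->
  (forall x, 0 <= f x) -> (forall x, 0 <= g x) ->
  wint mu (fun x => f x + g x) A = (wint mu f A + wint mu g A)%E.
Proof.
move=> mA mf mg f0 g0; rewrite /wint; under eq_integral do rewrite EFinD.
rewrite ge0_integralD//.
- by move=> x _; rewrite lee_fin.
- by apply: measurable_funTS; exact/measurable_EFinP.
- by move=> x _; rewrite lee_fin.
- by apply: measurable_funTS; exact/measurable_EFinP.
Qed.

Lemma wint_indic w A B : wint mu (fun x => \1_B x * w x) A = wint mu w (A `&` B).
Proof.
rewrite /wint integral_mkcondr; apply: eq_integral => x _.
by rewrite patchE indicE; case: ifP => _; rewrite ?mul1r ?mul0r.
Qed.

Lemma wint_splitI w A B : measurable_fun setT w -> (forall x, 0 <= w x) ->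
  measurable A -> measurable B ->
  wint mu w A = (wint mu w (A `&` B) + wint mu w (A `\` B))%E.
Proof.
move=> mw w0 mA mB; rewrite /wint -ge0_integral_setU//.
- by rewrite setUIDK.
- exact: measurableI.
- exact: measurableD.
- by rewrite setUIDK; apply: measurable_funTS; exact/measurable_EFinP.
- by move=> x _; rewrite lee_fin.
- by rewrite disj_set2E setDE setIACA setICr setI0.
Qed.

End wint.

Lemma measurable_lt_set d (S : measurableType d) (f g : S -> R) :
  measurable_fun setT f -> measurable_fun setT g -> measurable [set x | f x < g x].
Proof.
move=> mf mg; rewrite -[X in measurable X]setTI.
exact: (measurable_fun_ltr mf mg measurableT (Y := [set true])).
Qed.

Lemma measurable_le_set d (S : measurableType d) (f g : S -> R) :
  measurable_fun setT f -> measurable_fun setT g -> measurable [set x | f x <= g x].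
Proof.
move=> mf mg; rewrite -[X in measurable X]setTI.
exact: (measurable_fun_ler mf mg measurableT (Y := [set true])).
Qed.

End tools.

(** * Integrals over one ring *)

Section rings.
Context (R : realType) (n : nat) d (T : measurableType d).
Variable mu : {measure set T -> \bar R}.

(** A profile that decays at 0 and at infinity, so that its sums along a
    geometrically growing sequence are bounded. *)
Definition psi (th ka z : R) : R := if z < 1 then z `^ th else z `^ (- ka).

Lemma psi_ge0 th ka z : 0 <= psi th ka z.
Proof. by rewrite /psi; case: ifP => _; exact: powR_ge0. Qed.

Lemma powR_le1 (z a : R) : 0 <= a -> 0 <= z <= 1 -> z `^ a <= 1.
Proof.
move=> a0 /andP[z0 z1].
by have := @ge0_ler_powR R a a0 z 1; rewrite powR1; apply; rewrite ?nnegrE.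
Qed.

Lemma powR_ge1 (z a : R) : 0 <= a -> 1 <= z -> 1 <= z `^ a.
Proof.
move=> a0 z1.
by have := @ge0_ler_powR R a a0 1 z; rewrite powR1; apply; rewrite ?nnegrE// (le_trans _ z1).
Qed.

Lemma psi_le1 th ka z : 0 < th -> 0 < ka -> 0 <= z -> psi th ka z <= 1.
Proof.
move=> th0 ka0 z0; rewrite /psi; case: ltP => z1.
  by rewrite powR_le1 ?(ltW th0)// z0 ltW.
by rewrite powRN invf_le1 ?powR_gt0 ?(lt_le_trans _ z1)// powR_ge1// ltW.
Qed.

Lemma psi_small th ka z s : 0 < th -> 0 <= z -> z <= s -> s <= 1 ->
  psi th ka z <= s `^ th.
Proof.
move=> th0 z0 zs s1; rewrite /psi; case: ltP => z1.
  by apply: ge0_ler_powR; rewrite ?nnegrE ?(ltW th0)// (le_trans z0).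
have -> : z = 1 by apply/eqP; rewrite eq_le z1 (le_trans zs).
have -> : s = 1 by apply/eqP; rewrite eq_le s1 (le_trans z1).
by rewrite !powR1.
Qed.

Lemma psi_large th ka z s : 0 < th -> 0 < ka -> 0 < s -> s <= z ->
  psi th ka z <= s `^ (- ka).
Proof.
move=> th0 ka0 s0 sz; have z0 := lt_le_trans s0 sz.
have [z1|z1] := ltP z 1.
  apply: (le_trans (psi_le1 th0 ka0 (ltW z0))).
  rewrite powRN invf_ge1 ?powR_gt0//.
  by rewrite powR_le1 ?(ltW ka0)// (ltW s0) (le_trans sz (ltW z1)).
rewrite /psi ltNge z1/= !powRN lef_pV2 ?posrE ?powR_gt0//.
by apply: ge0_ler_powR; rewrite ?nnegrE ?(ltW ka0) ?(ltW s0)// ltW.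
Qed.

Lemma measurable_psi th ka : measurable_fun [set: R] (psi th ka).
Proof.
by apply: measurable_fun_ifT; [exact: measurable_fun_ltr|exact: measurable_powR|exact: measurable_powR].
Qed.

Variable dist : T -> T -> R.
Hypothesis mdist : measurable_fun setT (fun z : T * T => dist z.1 z.2).
Hypothesis dist_ge0 : forall x y, 0 <= dist x y.

Definition sball (y : T) (r : R) : set T := [set x | dist x y <= r].
Definition annulus (y : T) (r : R) : set T := [set x | r / 2 < dist x y <= r].
(** Up to a factor 2 ^ n, the measure of the ball centred at y with x on its
    boundary. *)
Definition vdist (x y : T) : R := dist x y ^+ n.

Lemma measurable_distl (y : T) : measurable_fun setT (fun x : T => dist x y).
Proof. exact: (measurableT_comp mdist (pair2_measurable y)). Qed.

Lemma measurable_vdistl (y : T) : measurable_fun setT (fun x : T => vdist x y).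
Proof. exact: measurable_funX (measurable_distl y). Qed.

Lemma measurable_sball y r : measurable (sball y r).
Proof. by apply: measurable_le_set => //; exact: measurable_distl. Qed.

Lemma sball_double y r : 0 < r -> sball y r `<=` sball y (2 * r).
Proof.
move=> r0 x; rewrite /sball/= => /le_trans; apply.
by rewrite ler_peMl ?(ltW r0)// ler1n.
Qed.

Lemma measurable_annulus y r : measurable (annulus y r).
Proof.
rewrite (_ : annulus y r = [set x | r / 2 < dist x y] `&` sball y r).
  apply: measurableI; last exact: measurable_sball.
  by apply: measurable_lt_set => //; exact: measurable_distl.
apply/seteqP; split => x /=; first by move=> /andP[].
by move=> [h1 h2]; apply/andP; split.
Qed.

Section annulus_bound.
Variables (V U : T -> R) (y : T) (t th ka : R).
Hypotheses (mV : measurable_fun setT V) (mU : measurable_fun setT U).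
Hypotheses (V0 : forall x, 0 < V x) (U0 : forall x, 0 < U x).
Hypotheses (t0 : 0 < t) (th0 : 0 < th) (ka0 : 0 < ka).

Let F x := psi th ka (V x * vdist x y / t) * U x * (vdist x y)^-1.

Lemma vdist_ge0 x z : 0 <= vdist x z.
Proof. by rewrite exprn_ge0. Qed.

Lemma measurable_ringF : measurable_fun setT F.
Proof.
apply: measurable_funM; last exact/measurable_funV/measurable_vdistl.
apply: measurable_funM => //.
apply: (measurableT_comp (measurable_psi _ _)).
apply: measurable_funM => //.
by apply: measurable_funM => //; exact: measurable_vdistl.
Qed.

Lemma ringF_ge0 x : 0 <= F x.
Proof.
by rewrite /F mulr_ge0 ?invr_ge0 ?vdist_ge0// mulr_ge0 ?psi_ge0// ltW.
Qed.

(** On the ring vdist x y is comparable to r ^ n.  The exceptional set B is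
    handled by psi <= 1 and its small U-measure. *)
Lemma annulus_bound r (a b C0 : R) (B : set T) : 0 < r -> 0 <= a ->
  measurable B ->
  (wint mu U (sball y r) <= (C0 * r ^+ n)%:E)%E ->
  (wint mu U (sball y r `&` B) <= (C0 * b * r ^+ n)%:E)%E ->
  (forall x, annulus y r x -> ~ B x -> psi th ka (V x * vdist x y / t) <= a) ->
  (wint mu F (annulus y r) <= (2 ^+ n * C0 * (a + b))%:E)%E.
Proof.
move=> r0 a0 mB hU hB hpsi.
have U0' x : 0 <= U x by exact: ltW.
pose c := 2 ^+ n * r ^- n.
have c0 : 0 < c by rewrite /c mulr_gt0 ?invr_gt0 ?exprn_gt0.
pose G x := c * (a * U x) + c * (\1_B x * U x).
have mB1 : measurable_fun setT (fun x : T => \1_B x * U x).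
  by apply: measurable_funM => //; exact: measurable_indic.
have mG : measurable_fun setT G.
  by apply: measurable_funD; apply: measurable_funM => //; apply: measurable_funM.
have B0 x : 0 <= \1_B x * U x by rewrite mulr_ge0.
have FG x : annulus y r x -> 0 <= F x <= G x.
  move=> xr; have /andP[x1 x2] := xr; rewrite ringF_ge0/= /F /G -mulrDr -mulrDl mulrC.
  have s0 : 0 < dist x y by apply: lt_trans x1; rewrite divr_gt0.
  apply: ler_pM => //; rewrite ?invr_ge0 ?vdist_ge0 ?mulr_ge0 ?psi_ge0//.
    rewrite /c /vdist -exprVn -exprVn -exprMn lerXn2r ?nnegrE ?invr_ge0 ?mulr_ge0 ?invr_ge0 ?(ltW s0)// ?(ltW r0)//.
    rewrite -[2]invrK -invfM lef_pV2 ?posrE// ?mulr_gt0 ?invr_gt0//.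
    by rewrite mulrC ltW.
  rewrite ler_wpM2r// indicE; case: (pselect (B x)) => Bx.
    rewrite mem_set// (le_trans (psi_le1 _ _ _))// ?lerDr//.
    by rewrite divr_ge0 ?(ltW t0)// mulr_ge0 ?vdist_ge0// ltW.
  by rewrite memNset//= addr0 hpsi.
apply: (@le_trans _ _ (wint mu G (sball y r))).
  apply: (@le_trans _ _ (wint mu G (annulus y r))).
    by apply: le_wint => //; [exact: measurable_annulus|exact: measurable_ringF].
  apply: wint_subset => //.
  - by move=> x; rewrite /G addr_ge0// mulr_ge0 ?(ltW c0) ?B0// mulr_ge0.
  - exact: measurable_annulus.
  - exact: measurable_sball.
  - by move=> x /= /andP[].
have ms := measurable_sball y r.
rewrite /G wintD//; last 4 first.
- by do 2 apply: measurable_funM => //.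
- by apply: measurable_funM.
- by move=> x; rewrite mulr_ge0 ?(ltW c0)// mulr_ge0.
- by move=> x; rewrite mulr_ge0 ?(ltW c0) ?B0.
rewrite wintZ//; last 3 first.
- by apply: measurable_funM.
- by move=> x; rewrite mulr_ge0 ?U0'.
- exact: ltW.
rewrite wintZ// wintZ// ?(ltW c0)// wint_indic.
have -> : (2 ^+ n * C0 * (a + b) = c * (a * (C0 * r ^+ n)) + c * (C0 * b * r ^+ n))%R.
  have rn0 : r ^+ n != 0 by rewrite expf_neq0// gt_eqF.
  by rewrite /c; field.
rewrite EFinD !(EFinM c) !(EFinM a).
by apply: leeD; apply: lee_wpmul2l; rewrite ?lee_fin ?(ltW c0)//; apply: lee_wpmul2l.
Qed.

End annulus_bound.
End rings.

(** * Sums over dyadic rings *)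

Lemma bernoulli_le (R : realFieldType) (a : R) k : 1 <= a -> 1 + k%:R * (a - 1) <= a ^+ k.
Proof.
move=> a1; elim: k => [|k IH]; first by rewrite mul0r addr0 expr0.
rewrite exprS -natr1.
have a0 : 0 <= a by lra.
apply: le_trans (ler_wpM2l a0 IH).
have : 0 <= k%:R * ((a - 1) * (a - 1)) by rewrite mulr_ge0// mulr_ge0// subr_ge0.
by move: (k%:R : R) => z; nra.
Qed.

Lemma expr_unbounded (R : realType) (a c : R) : 1 < a -> exists k, c < a ^+ k.
Proof.
move=> a1; have a10 : 0 < a - 1 by lra.
exists (Num.truncn (`|c| / (a - 1))).+1; apply: lt_le_trans (bernoulli_le _ (ltW a1)).
apply: (le_lt_trans (ler_norm c)).
have := truncnS_gt (`|c| / (a - 1)); rewrite ltr_pdivrMr// => h.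
by apply: lt_trans h _; rewrite ltrDr.
Qed.

Lemma powRVx (R : realType) (x a : R) : 0 <= x -> x^-1 `^ a = x `^ (- a).
Proof. by move=> x0; rewrite -powR_inv1// -powRrM mulN1r. Qed.

Section growth.
Context (R : realType).
Variables (x : R -> R) (A : R).
Hypotheses (A1 : 1 < A) (x0 : forall r, 0 < r -> 0 < x r).
Hypothesis xA : forall r, 0 < r -> A * x r <= x (2 * r).

Lemma growth_up r k : 0 < r -> A ^+ k * x r <= x (2 ^+ k * r).
Proof.
move=> r0; elim: k => [|k IH]; first by rewrite !expr0 !mul1r.
rewrite !exprS -!mulrA; apply: le_trans (xA _); last by rewrite mulr_gt0 ?exprn_gt0.
by rewrite ler_wpM2l// ltW// (lt_trans _ A1).
Qed.

(** The radius where x crosses 1 is the centre of the geometric series of the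
    rings. *)
Lemma growth_pivot : exists2 r, 0 < r & x r <= 1 <= x (2 * r).
Proof.
have [x1|x1] := leP (x 1) 1.
  have [k hk] := expr_unbounded (x 1)^-1 A1.
  have ek : exists k, 1 < x (2 ^+ k).
    exists k; apply: lt_le_trans (le_trans (growth_up k ltr01) _); last by rewrite mulr1.
    by rewrite -ltr_pdivrMr ?x0// div1r.
  case: (ex_minnP ek) => -[|j] hj hm; first by move: hj; rewrite expr0 ltNge x1.
  exists (2 ^+ j); first by rewrite exprn_gt0.
  rewrite -exprS (ltW hj) andbT leNgt; apply/negP => /hm.
  by rewrite ltnn.
have [k hk] := expr_unbounded (x 1) A1.
have A0 j : 0 < A ^+ j by rewrite exprn_gt0// (lt_trans _ A1).
have ek : exists k, x (2 ^- k) <= 1.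
  exists k; have := @growth_up (2 ^- k) k.
  rewrite invr_gt0 exprn_gt0// => /(_ isT); rewrite mulfV ?expf_neq0// => h.
  by rewrite -(ler_pM2l (A0 k)) mulr1 (le_trans h)// ltW.
case: (ex_minnP ek) => -[|j] hj hm; first by move: hj; rewrite expr0 invr1 leNgt x1.
exists (2 ^- j.+1); first by rewrite invr_gt0 exprn_gt0.
rewrite hj/= exprS invfM mulrA mulfV// mul1r leNgt; apply/negP => /ltW /hm.
by rewrite ltnn.
Qed.

End growth.

Section ring_sum.
Context (R : realType) (n : nat) d (T : measurableType d).
Variable mu : {measure set T -> \bar R}.
Variable dist : T -> T -> R.
Hypothesis mdist : measurable_fun setT (fun z : T * T => dist z.1 z.2).
Hypothesis dist_ge0 : forall x y, 0 <= dist x y.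
Hypothesis n0 : (0 < n)%N.

Lemma wint_setU_le (w : T -> R) (A B : set T) : measurable_fun setT w -> (forall x, 0 <= w x) ->
  measurable A -> measurable B -> (wint mu w (A `|` B) <= wint mu w A + wint mu w B)%E.
Proof.
move=> mw w0 mA mB; have mAB : measurable (A `|` B) by exact: measurableU.
rewrite (wint_splitI _ mw w0 mAB mA) setUK; apply: leeD2l.
apply: wint_subset => //; first exact: measurableD.
by move=> z [[]].
Qed.

Definition ring_exp (th ka e : R) := Num.min (Num.min (th / 2) (ka / 2)) e.

(** The constant depends on the exponents and on the growth factor A only: it
    has to be uniform in the centre y and in t. *)
Definition ring_const (th ka e A : R) :=
  2 * (2 ^+ n * (1 + (2 ^- n) `^ (- ka))) * (1 - A `^ (- ring_exp th ka e))^-1.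

Lemma ring_const_gt0 th ka e A : 0 < th -> 0 < ka -> 0 < e -> 1 < A ->
  0 < ring_const th ka e A.
Proof.
move=> th0 ka0 e0 A1; have e'0 : 0 < ring_exp th ka e.
  by rewrite /ring_exp !lt_min !divr_gt0.
apply: mulr_gt0.
  by rewrite mulr_gt0// mulr_gt0 ?exprn_gt0// ltr_pwDl// powR_ge0.
rewrite invr_gt0 subr_gt0 powRN invf_lt1 ?powR_gt0 ?(lt_trans _ A1)//.
have := @gt0_ltr_powR R _ e'0 1 A; rewrite powR1; apply; rewrite ?nnegrE//.
by rewrite ltW// (lt_trans _ A1).
Qed.

Section ring.
Variables (V U : T -> R) (y : T) (t th ka e A C0 : R) (x : R -> R).
Hypotheses (mV : measurable_fun setT V) (mU : measurable_fun setT U).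
Hypotheses (V0 : forall x, 0 < V x) (U0 : forall x, 0 < U x).
Hypotheses (t0 : 0 < t) (th0 : 0 < th) (ka0 : 0 < ka) (e0 : 0 < e) (C00 : 0 <= C0).
Hypotheses (A1 : 1 < A) (x0 : forall r, 0 < r -> 0 < x r).
Hypothesis xA : forall r, 0 < r -> A * x r <= x (2 * r).
Hypothesis hU : forall r, 0 < r -> (wint mu U (sball dist y r) <= (C0 * r ^+ n)%:E)%E.
Hypothesis hs : forall r, 0 < r -> x r <= 1 ->
  (wint mu U (sball dist y r `&` [set z : T | (t * x r `^ 2^-1 < V z * r ^+ n)%R])
    <= (C0 * x r `^ e * r ^+ n)%:E)%E.
Hypothesis hl : forall r, 0 < r -> 1 <= x r ->
  (wint mu U (sball dist y r `&` [set z : T | (V z * r ^+ n < t * x r `^ 2^-1)%R])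
    <= (C0 * x r `^ (- e) * r ^+ n)%:E)%E.

Let F (z : T) := psi th ka (V z * vdist n dist z y / t) * U z * (vdist n dist z y)^-1.
Let e' := ring_exp th ka e.
Let K1 := 2 ^+ n * (1 + (2 ^- n) `^ (- ka)).

(** Outside the set of [hs], respectively [hl], V * vdist / t is at most
    (x r) ^ (1/2), respectively at least 2 ^- n (x r) ^ (1/2); this makes psi at
    most a power of s. *)
Lemma annulus_est r s : 0 < r -> 0 < s <= 1 -> (x r <= s \/ s^-1 <= x r) ->
  (wint mu F (annulus dist y r) <= (K1 * C0 * s `^ e')%:E)%E.
Proof.
move=> r0 /andP[s0 s1] hx; have xr0 := x0 r0.
have rn0 : 0 < r ^+ n by rewrite exprn_gt0.
have s01 : 0 < s <= 1 by rewrite s0 s1.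
have e'th : e' <= th / 2 by rewrite /e' /ring_exp !ge_min lexx.
have e'ka : e' <= ka / 2 by rewrite /e' /ring_exp !ge_min lexx orbT.
have e'e : e' <= e by rewrite /e' /ring_exp !ge_min lexx !orbT.
have c1 : 1 <= (2 ^- n : R) `^ (- ka).
  rewrite powRN invf_ge1 ?powR_gt0 ?invr_gt0 ?exprn_gt0// powR_le1 ?(ltW ka0)//.
  by rewrite invr_ge0 exprn_ge0//= invf_le1 ?exprn_gt0// exprn_ege1// ler1n.
have mVr : measurable_fun setT (fun z : T => V z * r ^+ n) by exact: measurable_funM.
have main (a b : R) (B : set T) : 0 <= a -> measurable B ->
    (wint mu U (sball dist y r `&` B) <= (C0 * b * r ^+ n)%:E)%E ->
    (forall z, annulus dist y r z -> ~ B z ->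
       psi th ka (V z * vdist n dist z y / t) <= a) ->
    a <= (2 ^- n) `^ (- ka) * s `^ e' -> b <= s `^ e' ->
    (wint mu F (annulus dist y r) <= (K1 * C0 * s `^ e')%:E)%E.
  move=> a0 mB hB hpsi ha hb.
  apply: le_trans (annulus_bound mdist dist_ge0 mV mU V0 U0 t0 th0 ka0 r0 a0 mB (hU r0) hB hpsi) _.
  rewrite lee_fin /K1 -!mulrA ler_wpM2l ?exprn_ge0//.
  rewrite [leRHS](_ : _ = C0 * ((2 ^- n) `^ (- ka) * s `^ e' + s `^ e')); last by ring.
  by rewrite ler_wpM2l// lerD.
case: hx => hx.
  have x1 := le_trans hx s1.
  have xle (b : R) : e' <= b -> x r `^ b <= s `^ e'.
    move=> eb; apply: (@le_trans _ _ (x r `^ e')).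
      by apply: ger_powR => //; rewrite xr0.
    by apply: ge0_ler_powR; rewrite ?nnegrE ?(ltW xr0) ?(ltW s0)// !le_min ?divr_ge0 ?(ltW th0) ?(ltW ka0) ?(ltW e0).
  apply: (main (x r `^ (th / 2)) (x r `^ e) [set z : T | (t * x r `^ 2^-1 < V z * r ^+ n)%R]).
  - exact: powR_ge0.
  - exact: measurable_lt_set.
  - exact: hs.
  - move=> z /= /andP[_ zr] /negP; rewrite -leNgt => hz.
    rewrite [th / 2]mulrC powRrM.
    apply: psi_small => //.
    + by rewrite divr_ge0 ?(ltW t0)// mulr_ge0 ?exprn_ge0// ltW.
    + rewrite ler_pdivrMr// [leRHS]mulrC; apply: le_trans hz.
      by rewrite ler_wpM2l ?(ltW (V0 _))// lerXn2r ?nnegrE// ltW.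
    + by rewrite powR_le1// (ltW xr0).
  - apply: le_trans (xle _ e'th) _; rewrite ler_peMl ?powR_ge0//.
  - exact: xle.
have x1 : 1 <= x r by apply: le_trans hx; rewrite invf_ge1.
have xle (b : R) : e' <= b -> x r `^ (- b) <= s `^ e'.
  move=> eb; apply: (@le_trans _ _ (x r `^ (- e'))).
    by apply: ler_powR => //; rewrite lerN2.
  rewrite -powRVx ?(ltW xr0)//; apply: ge0_ler_powR.
  - by rewrite !le_min ?divr_ge0 ?(ltW th0) ?(ltW ka0) ?(ltW e0).
  - by rewrite nnegrE invr_ge0 ltW.
  - by rewrite nnegrE ltW.
  - by rewrite -[s]invrK lef_pV2 ?posrE ?invr_gt0.
apply: (main ((2 ^- n * x r `^ 2^-1) `^ (- ka)) (x r `^ (- e)) [set z : T | (V z * r ^+ n < t * x r `^ 2^-1)%R]).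
- exact: powR_ge0.
- exact: measurable_lt_set.
- exact: hl.
- move=> z /= /andP[zr _] /negP; rewrite -leNgt => hz.
  apply: psi_large => //; first by rewrite mulr_gt0 ?powR_gt0 ?invr_gt0 ?exprn_gt0.
  rewrite ler_pdivlMr// -mulrA ler_pdivrMl ?exprn_gt0// [leLHS]mulrC.
  apply: le_trans hz _; rewrite mulrCA ler_wpM2l ?(ltW (V0 _))//.
  rewrite /vdist -exprMn lerXn2r ?nnegrE ?mulr_ge0 ?(ltW r0)//.
  by move: zr; lra.
- rewrite powRM ?powR_ge0 ?invr_ge0 ?exprn_ge0// ler_wpM2l ?powR_ge0//.
  by rewrite -powRrM mulrN mulrC xle.
- exact: xle.
Qed.

(** The i-th ring inside the pivot radius is paired with the i-th one outside:
    by growth, x is at most A ^- i on the first and at least A ^ i on the second. *)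
Lemma ring_sum : (wint mu F setT <= (ring_const th ka e A * C0)%:E)%E.
Proof.
have [r0 r00 /andP[xr0 xr1]] := growth_pivot A1 x0 xA.
have A0 : 0 < A by exact: lt_trans ltr01 A1.
have e'0 : 0 < e' by rewrite /e' /ring_exp !lt_min !divr_gt0.
pose a := A `^ (- e').
have a1 : 0 <= a < 1.
  rewrite powR_ge0/= /a powRN invf_lt1 ?powR_gt0//.
  have := @gt0_ltr_powR R e' e'0 1 A; rewrite powR1; apply; rewrite ?nnegrE//.
  exact: ltW.
pose E i := annulus dist y (r0 * 2 ^- i) `|` annulus dist y (2 * r0 * 2 ^+ i).
have K10 : 0 <= K1 by rewrite mulr_ge0 ?exprn_ge0// addr_ge0 ?powR_ge0.
have p2 i : 0 < 2 ^+ i :> R by rewrite exprn_gt0.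
have mF : measurable_fun setT F by apply: measurable_ringF.
have F0 z : 0 <= F z by apply: ringF_ge0.
have mE i : measurable (E i) by apply: measurableU; exact: measurable_annulus.
have hE i : (wint mu F (E i) <= (2 * K1 * C0 * a ^+ i)%:E)%E.
  apply: le_trans (wint_setU_le mF F0 _ _) _; [exact: measurable_annulus|exact: measurable_annulus|].
  rewrite (_ : 2 * K1 * C0 * a ^+ i = K1 * C0 * (A ^- i) `^ e' + K1 * C0 * (A ^- i) `^ e'); last first.
    rewrite [(A ^- i) `^ e'](_ : _ = a ^+ i); first by ring.
    rewrite (powRVx e' (exprn_ge0 i (ltW A0))) -(powR_mulrn i (ltW A0)) -[RHS](powR_mulrn i (powR_ge0 _ _)).
    by rewrite /a -!powRrM mulrC.
  have Ai1 : 0 < A ^- i <= 1.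
    by rewrite invr_gt0 exprn_gt0//= invf_le1 ?exprn_gt0// exprn_ege1// ltW.
  rewrite EFinD; apply: leeD; apply: annulus_est => //.
  - by rewrite mulr_gt0// invr_gt0.
  - left; have := growth_up A1 xA i (r := r0 * 2 ^- i).
    rewrite mulr_gt0 ?invr_gt0// => /(_ isT); rewrite mulrCA mulfV ?gt_eqF// mulr1 => h.
    by rewrite -(ler_pM2l (exprn_gt0 i A0)) mulfV ?gt_eqF ?exprn_gt0// (le_trans h).
  - by rewrite !mulr_gt0.
  - right; rewrite invrK [2 * r0 * _]mulrC.
    apply: le_trans (growth_up A1 xA i _); last by rewrite mulr_gt0.
    by rewrite ler_peMr// exprn_ge0// ltW.
apply: le_trans (integral_cover_le mF F0 mE _ hE) _; last first.
  rewrite nneseries_geometric//; last by rewrite !mulr_ge0.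
  by rewrite lee_fin mulrAC.
move=> z Fz; have dz : 0 < dist z y.
  rewrite lt_neqAle dist_ge0 andbT eq_sym; apply/eqP => dz.
  by move: Fz; rewrite /F /vdist dz expr0n gtn_eqF// invr0 mulr0 ltxx.
have [h|h] := leP (dist z y) r0.
  have ei : exists i, r0 * 2 ^- i / 2 < dist z y.
    have [k hk] := @expr_unbounded R 2 (r0 / dist z y) (ltr1n _ 2).
    exists k; rewrite ltr_pdivrMr// ltr_pdivrMr ?p2//.
    move: hk; rewrite ltr_pdivrMr// => /lt_le_trans; apply.
    by rewrite [leRHS]mulrC ler_wpM2l ?(ltW (p2 k))// ler_peMr// ler1n.
  case: (ex_minnP ei) => i hi hm; exists i; left; rewrite /annulus /= hi/=.
  case: i hi hm => [_ _|i hi hm]; first by rewrite expr0 invr1 mulr1.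
  rewrite leNgt; apply/negP => hd; have := hm i; rewrite ltnn => hmi.
  by apply/(notF (hmi _)); rewrite -mulrA -invfM -exprSr.
have ei : exists i, dist z y <= 2 * r0 * 2 ^+ i.
  have [k hk] := @expr_unbounded R 2 (dist z y / r0) (ltr1n _ 2).
  exists k; move: hk; rewrite ltr_pdivrMr// => /ltW/le_trans; apply.
  by rewrite [leRHS]mulrC ler_wpM2l ?(ltW (p2 k))// ler_peMl ?(ltW r00)// ler1n.
case: (ex_minnP ei) => i hi hm; exists i; right; rewrite /annulus /= hi andbT.
case: i hi hm => [_ _|i hi hm]; first by rewrite expr0 mulr1 mulrAC mulfV// mul1r.
rewrite ltNge; apply/negP => hd; have := hm i; rewrite ltnn => hmi.
apply/(notF (hmi _)); apply: le_trans hd _.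
by rewrite exprS; lra.
Qed.

End ring.

End ring_sum.

(** * Weight classes over balls and the testing condition *)

Section wint_ae.
Context (R : realType) d (T : measurableType d).
Variable mu : {measure set T -> \bar R}.
Implicit Types (f g w : T -> R) (A B : set T).

Lemma wint_aele f g A : measurable A -> measurable_fun setT f -> measurable_fun setT g ->
  (forall x, 0 <= f x) -> (forall x, 0 <= g x) ->
  {ae mu, forall x, A x -> f x <= g x} -> (wint mu f A <= wint mu g A)%E.
Proof.
move=> mA mf mg f0 g0 fg; apply: ae_ge0_le_integral => //.
- by move=> x _; rewrite lee_fin.
- by apply: measurable_funTS; exact/measurable_EFinP.
- by move=> x _; rewrite lee_fin.
- by apply: measurable_funTS; exact/measurable_EFinP.
Qed.

Lemma wint_cst1 A : measurable A -> wint mu (fun=> 1%R) A = mu A.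
Proof. by move=> mA; rewrite /wint integral_cst// mul1e. Qed.

Lemma wint_ae0 w A : measurable A -> measurable_fun setT w -> (forall x, 0 <= w x) ->
  {ae mu, forall x, ~ A x} -> wint mu w A = 0%E.
Proof.
move=> mA mw w0 hA; apply/eqP; rewrite eq_le wint_ge0// andbT.
apply: (@le_trans _ _ (wint mu (fun=> 0) A)); last by rewrite /wint integral0.
by apply: wint_aele => //; apply: filterS hA => x nA /nA.
Qed.

Lemma wint_gt0 w A : measurable A -> measurable_fun setT w -> (forall x, 0 < w x) ->
  (0 < mu A)%E -> (0 < wint mu w A)%E.
Proof.
move=> mA mw w0 muA; rewrite lt0e wint_ge0 ?andbT => [|x _]; last exact: ltW.
apply/eqP => h0; have mw' : measurable_fun A (fun x => (w x)%:E).
  by apply: measurable_funTS; exact/measurable_EFinP.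
have : (\int[mu]_(x in A) `|(w x)%:E| = 0)%E.
  rewrite -[RHS]h0; apply: eq_integral => x _; rewrite gee0_abs// lee_fin; exact: ltW.
move/(ae_eq_integral_abs mu mA mw') => [N [mN N0 AN]].
move: muA; rewrite (_ : mu A = 0%E) ?ltxx//.
apply/eqP; rewrite eq_le measure_ge0 andbT -N0; apply: le_measure; rewrite ?inE//.
move=> x Ax; apply: AN => /= h; have := h Ax; move/eqP; rewrite eqe => /eqP h1.
by have := w0 x; rewrite h1 ltxx.
Qed.

Lemma chebyshev_wint f g (c : R) (E : set T) : measurable E ->
  measurable_fun setT f -> measurable_fun setT g -> 0 <= c ->
  (forall x, 0 <= f x) -> (forall x, E x -> c * f x <= g x) ->
  (c%:E * wint mu f E <= wint mu g E)%E.
Proof.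
move=> mE mf mg c0 f0 fg; rewrite -wintZ//; apply: le_wint => //.
  exact: measurable_funM.
by move=> x Ex; rewrite mulr_ge0//= fg.
Qed.

End wint_ae.

Section weight_classes.
Context (R : realType) (n : nat) d (T : measurableType d).
Variable mu : {measure set T -> \bar R}.
Variable dist : T -> T -> R.
Hypothesis mdist : measurable_fun setT (fun z : T * T => dist z.1 z.2).
Hypothesis dist_ge0 : forall x y, 0 <= dist x y.
Hypothesis n0 : (0 < n)%N.
Hypothesis mu_ball : forall (y : T) (r : R), 0 < r -> mu (sball dist y r) = ((2 * r) ^+ n)%:E.
Local Notation ball := (sball dist).
Implicit Types (U V w : T -> R).

(** Positivity is asked at every point, so that all powers and quotients of
    weights can be manipulated pointwise. *)
Definition pos_weight w := [/\ measurable_fun setT w, (forall x, 0 < w x) &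
  forall (y : T) (r : R), 0 < r -> (wint mu w (ball y r) < +oo)%E].

(** The essential infimum over a ball is unfolded into an almost everywhere
    bound, with a null set that may depend on the ball. *)
Definition A1_ball w := exists2 C : R, 0 < C & forall (y : T) (r : R), 0 < r ->
  {ae mu, forall x, ball y r x -> (wint mu w (ball y r) <= (C * r ^+ n * w x)%:E)%E}.

(** A single null set serves all centres and radii, so that the bound can be used
    at all scales around a fixed point. *)
Definition A1_center w := exists2 C : R, 0 < C &
  {ae mu, forall (y : T) (r : R), 0 < r -> (wint mu w (ball y r) <= (C * r ^+ n * w y)%:E)%E}.

(** The quantitative form of the A_infinity property: the power rate is what
    makes the sums over rings converge. *)
Definition Ainfty_ball w := exists2 K : R, 0 < K & exists2 e : R, 0 < e & forall (y : T) (r s : R) (E : set T),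
  0 < r -> 0 < s -> measurable E -> E `<=` ball y r ->
  (mu E <= (s * r ^+ n)%:E)%E -> (wint mu w E <= (K * s `^ e)%:E * wint mu w (ball y r))%E.

(** The A_r condition with respect to U, with s = 1 / (r - 1), solved for the
    integral of V ^ (- s) U. *)
Definition Ar_ball U V := exists2 C : R, 0 < C & exists2 s : R, 0 < s & forall (y : T) (r : R), 0 < r ->
  (wint mu (fun x => V x * U x)%R (ball y r) < +oo)%E /\
  (wint mu (fun x => V x `^ (- s) * U x)%R (ball y r) <=
    (fine (wint mu U (ball y r)) * (C * fine (wint mu U (ball y r)) /
      fine (wint mu (fun x => V x * U x)%R (ball y r))) `^ s)%:E)%E.

(** The ball of radius r around y contributes about the average of U over it
    when V r ^ n is comparable to t there, and little otherwise. *)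
Definition testing V U := forall th ka : R, 0 < th -> 0 < ka -> exists2 C : R, 0 < C &
  {ae mu, forall (y : T) (t : R), 0 < t ->
    (wint mu (fun x => psi th ka (V x * vdist n dist x y / t) * U x * (vdist n dist x y)^-1)%R setT
      <= (C * U y)%:E)%E}.

Lemma wint_ball_fin w y r : pos_weight w -> 0 < r ->
  exists2 a, 0 < a & wint mu w (ball y r) = a%:E.
Proof.
move=> [mw w0 fw] r0; have h := fw y r r0.
have p : (0 < wint mu w (ball y r))%E.
  apply: wint_gt0 => //; first exact: measurable_sball.
  by rewrite mu_ball// lte_fin exprn_gt0// mulr_gt0.
exists (fine (wint mu w (ball y r))); first by rewrite fine_gt0// p.
by rewrite fineK// gt0_fin_numE.
Qed.

(** On the ring between r and 2 r the weight is at least a multiple of its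
    average over the ball of radius 2 r, so the ring carries a fixed fraction of
    the mass of that ball. *)
Lemma A1_ball_growth w : pos_weight w -> A1_ball w -> exists2 C : R, 0 < C & forall y r a b, 0 < r ->
  wint mu w (ball y r) = a%:E -> wint mu w (ball y (2 * r)) = b%:E ->
  a + b / C <= b.
Proof.
move=> pw [C C0 hC]; have [mw w0 _] := pw; exists C => // y r a b r0 ha hb.
have r20 : 0 < 2 * r by rewrite mulr_gt0.
have w0' x : 0 <= w x by exact: ltW.
have mb z : measurable (ball y z) by exact: measurable_sball.
have sub : ball y r `<=` ball y (2 * r) by exact: sball_double.
have := wint_splitI mu mw w0' (mb (2 * r)) (mb r).
rewrite setIC (setIidl sub) ha hb => hsum.
rewrite -lee_fin EFinD hsum; apply: leeD2l.
have mD : measurable (ball y (2 * r) `\` ball y r) by exact: measurableD.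
pose c := b / (C * (2 * r) ^+ n).
have b0 : 0 <= b by rewrite -lee_fin -hb; exact: wint_ge0.
have c0 : 0 <= c by rewrite divr_ge0// mulr_ge0 ?exprn_ge0 ?(ltW C0)// ltW.
apply: (@le_trans _ _ (wint mu (fun=> c * 1%R) (ball y (2 * r) `\` ball y r))); last first.
  apply: wint_aele => //; first by move=> x; rewrite mulr1.
  have := hC y (2 * r) r20; apply: filterS => x h [/h + _]; rewrite hb lee_fin mulr1.
  by rewrite /c ler_pdivrMr ?mulr_gt0 ?exprn_gt0// mulrC.
rewrite wintZ// wint_cst1// measureD//=; last by rewrite mu_ball// ltry.
rewrite setIC (setIidl sub) !mu_ball// -EFinB -EFinM lee_fin.
rewrite [X in c * (X - _)]exprMn -[X in c * X]/(2 ^+ n * (2 * r) ^+ n - (2 * r) ^+ n).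
rewrite -[X in _ - X]mul1r -mulrBl.
have h2 : 1 <= 2 ^+ n - 1 :> R.
  have : 2 ^+ 1 <= 2 ^+ n :> R by rewrite ler_eXn2l ?ltr1n.
  by rewrite expr1; lra.
rewrite [leRHS](_ : _ = b / C * (2 ^+ n - 1)).
  by rewrite ler_peMr// divr_ge0// ltW.
have : (2 * r) ^+ n != 0 by rewrite expf_neq0 ?gt_eqF.
by rewrite /c; move: ((2 * r) ^+ n) => z z0; field; rewrite z0 gt_eqF.
Qed.

Lemma A1_ball_doubling w : pos_weight w -> A1_ball w -> exists2 C, 0 < C & forall y r, 0 < r ->
  (wint mu w (ball y (2 * r)) <= C%:E * wint mu w (ball y r))%E.
Proof.
move=> pw [C C0 hC]; have [mw w0 _] := pw; exists C => // y r r0.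
have r20 : 0 < 2 * r by rewrite mulr_gt0.
have [b b0 hb] := wint_ball_fin y pw r20.
have mb z : measurable (ball y z) by exact: measurable_sball.
have c0 : 0 <= b / (C * (2 * r) ^+ n).
  by rewrite divr_ge0 ?(ltW b0)// mulr_ge0 ?exprn_ge0// ltW.
have : ((b / (C * (2 * r) ^+ n))%:E * mu (ball y r) <= wint mu w (ball y r))%E.
  rewrite -(wint_cst1 _ (mb r)) -wintZ//.
  apply: wint_aele => //; [by move=> x; rewrite mulr1|by move=> x; exact: ltW|].
  apply: filterS (hC y _ r20) => x hx xr; rewrite mulr1 ler_pdivrMr ?mulr_gt0 ?exprn_gt0//.
  rewrite mulrC -lee_fin -hb; apply: hx; apply: (le_trans xr).
  by rewrite ler_peMl ?(ltW r0)// ler1n.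
rewrite mu_ball// -EFinM hb => h.
apply: le_trans (lee_wpmul2l _ h); last by rewrite lee_fin ltW.
rewrite -EFinM lee_fin; apply: le_of_eq.
have : (2 * r) ^+ n != 0 by rewrite expf_neq0 ?gt_eqF.
by move: ((2 * r) ^+ n) => z z0; field; rewrite z0 gt_eqF.
Qed.

(** Apply [ring_sum] with x r = V(B(y, r)) / t.  If x r is small, Chebyshev's
    inequality bounds the Lebesgue measure of the part of the ball where V is
    large, and the A_infinity inequality its U-measure.  If x r is large, the A_1
    bound of V excludes small values of V. *)
Lemma testing_A1 V U : pos_weight V -> pos_weight U -> A1_ball V -> A1_center U -> Ainfty_ball U -> testing V U.
Proof.
move=> pV pU aV [CU CU0 hU] [K K0 [e1 e10 hK]] th ka th0 ka0.
have [mV V0 fV] := pV; have [mU U0 fU] := pU.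
have [CG CG0 hG] := A1_ball_growth pV aV; have [CV CV0 hV] := aV.
pose e := e1 / 2; have e0 : 0 < e by rewrite divr_gt0.
(* K serves for small x r; for large x r, the power of CV covers the bounded
   range of x r where the A_1 bound of V excludes nothing *)
pose M := K + 1 + (CV ^+ 2) `^ e.
have M0 : 0 < M by rewrite /M ltr_pwDl ?powR_ge0// addr_gt0.
have KM : K <= M by rewrite /M -addrA lerDl addr_ge0 ?powR_ge0.
have M1 : 1 <= M by rewrite /M addrAC lerDr addr_ge0 ?powR_ge0// ltW.
have CM : (CV ^+ 2) `^ e <= M by rewrite /M lerDr addr_ge0// ltW.
pose A := 1 + CG^-1; have A1 : 1 < A by rewrite /A ltrDl invr_gt0.
exists (ring_const n th ka e A * (M * CU)).
  by rewrite mulr_gt0 ?ring_const_gt0// mulr_gt0.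
apply: filterS hU => y hUy t t0.
have mb z : measurable (ball y z) by exact: measurable_sball.
pose v r := fine (wint mu V (ball y r)).
have vE r : 0 < r -> 0 < v r /\ wint mu V (ball y r) = (v r)%:E.
  by move=> r0; have [a a0 ha] := wint_ball_fin y pV r0; rewrite /v ha.
pose C0 := M * CU * U y.
have C00 : 0 <= C0 by rewrite !mulr_ge0// ltW.
have U0' x : 0 <= U x by exact: ltW.
have V0' x : 0 <= V x by exact: ltW.
have mVr r : measurable_fun setT (fun z : T => V z * r ^+ n) by exact: measurable_funM.
have hUM c r : 0 < r -> 0 <= c -> (c%:E * wint mu U (ball y r) <= (c * CU * U y * r ^+ n)%:E)%E.
  move=> r0 c0; apply: le_trans (lee_wpmul2l _ (hUy r r0)) _; first by rewrite lee_fin.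
  by rewrite -EFinM lee_fin [leRHS](_ : _ = c * (CU * r ^+ n * U y))//; ring.
rewrite -(mulrA (ring_const _ _ _ _ _)); apply: (@ring_sum _ _ _ _ _ _ mdist dist_ge0 n0 V U y t th ka e A C0 (fun r => v r / t)) => //.
- by move=> r r0; rewrite divr_gt0// (vE r r0).1.
- move=> r r0; have [v0 hv] := vE r r0.
  have [v1 hv1] := vE (2 * r) (mulr_gt0 (ltr0n _ 2) r0).
  have := hG y r _ _ r0 hv hv1.
  rewrite mulrA ler_pM2r ?invr_gt0// /A => h.
  have c0 : 0 < CG^-1 by rewrite invr_gt0.
  have vv : v r <= v (2 * r).
    by apply: le_trans h; rewrite lerDl mulr_ge0 ?(ltW v1)// ltW.
  apply: le_trans h; rewrite mulrDl mul1r lerD2l mulrC ler_wpM2r// ltW//.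
- move=> r r0; have := hUM 1 r r0 ler01; rewrite mul1e => /le_trans; apply.
  rewrite lee_fin ler_wpM2r ?exprn_ge0 ?(ltW r0)// /C0 ler_wpM2r// ler_wpM2r// ?ltW//.
- move=> r r0 x1; have [v0 hv] := vE r r0.
  set x := v r / t; have x0 : 0 < x by rewrite divr_gt0.
  set E := ball y r `&` _.
  have mE : measurable E by apply: measurableI => //; exact: measurable_lt_set.
  have muE : (mu E <= (x `^ 2^-1 * r ^+ n)%:E)%E.
    have h1 : ((t * x `^ 2^-1 / r ^+ n)%:E * mu E <= (v r)%:E)%E.
      rewrite -hv -(wint_cst1 _ mE); apply: le_trans (_ : wint mu V E <= _)%E.
        apply: chebyshev_wint => //; first by rewrite divr_ge0 ?mulr_ge0 ?powR_ge0 ?exprn_ge0// ltW.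
        move=> z [_ /= /ltW]; rewrite mulr1 ler_pdivrMr ?exprn_gt0//.
      by apply: wint_subset => // z [].
    have c0 : 0 < t * x `^ 2^-1 / r ^+ n by rewrite divr_gt0 ?mulr_gt0 ?powR_gt0 ?exprn_gt0.
    rewrite -(lee_pmul2l _ (x := (t * x `^ 2^-1 / r ^+ n)%:E))//.
    apply: le_trans h1 _; rewrite -EFinM lee_fin.
    have rn0 : r ^+ n != 0 by rewrite expf_neq0 ?gt_eqF.
    rewrite [leRHS](_ : _ = t * (x `^ 2^-1 * x `^ 2^-1)); last by field.
    by rewrite powR_halfM// /x mulrCA mulfV ?mulr1 ?gt_eqF.
  have s0 : 0 < x `^ 2^-1 by exact: powR_gt0.
  apply: le_trans (hK y r _ E r0 s0 mE _ muE) _; first by move=> z [].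
  apply: le_trans (hUM _ _ r0 _) _; first by rewrite mulr_ge0 ?powR_ge0// ltW.
  rewrite -powRrM [2^-1 * e1]mulrC -/e lee_fin ler_wpM2r ?exprn_ge0 ?(ltW r0)//.
  rewrite /C0 [leLHS](_ : _ = K * (CU * U y * x `^ e)); last by ring.
  rewrite [leRHS](_ : _ = M * (CU * U y * x `^ e)); last by ring.
  by rewrite ler_wpM2r// !mulr_ge0 ?powR_ge0// ltW.
- move=> r r0 x1; have [v0 hv] := vE r r0.
  set x := v r / t; have x0 : 0 < x by rewrite divr_gt0.
  set E := ball y r `&` _.
  have mE : measurable E by apply: measurableI => //; exact: measurable_lt_set.
  have rn0 : 0 < r ^+ n by rewrite exprn_gt0.
  have [xC|xC] := leP CV (x `^ 2^-1).
    rewrite wint_ae0//; first by rewrite lee_fin mulr_ge0 ?exprn_ge0 ?(ltW r0)// mulr_ge0 ?powR_ge0.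
    apply: filterS (hV y r r0) => z hz [bz /=]; have := hz bz.
    rewrite hv lee_fin => h1 h2.
    have x12 := powR_halfM x0.
    have tx : t * x = v r by rewrite /x mulrCA mulfV ?gt_eqF// mulr1.
    have : v r < v r.
      rewrite -[ltRHS]tx -[X in _ < t * X]x12.
      apply: le_lt_trans h1 _; rewrite -mulrA [r ^+ n * _]mulrC.
      apply: (@lt_le_trans _ _ (CV * (t * x `^ 2^-1))); first by rewrite ltr_pM2l.
      by rewrite mulrCA ler_wpM2l ?(ltW t0)// ler_wpM2r ?powR_ge0.
    by rewrite ltxx.
  apply: (@le_trans _ _ (wint mu U (ball y r))); first by apply: wint_subset => // z [].
  have := hUM 1 r r0 ler01; rewrite mul1e mul1r => /le_trans; apply.
  rewrite lee_fin ler_wpM2r ?exprn_ge0 ?(ltW r0)// /C0.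
  rewrite [leRHS](_ : _ = M * x `^ (- e) * (CU * U y)); last by ring.
  rewrite ler_peMl ?mulr_ge0 ?(ltW CU0)//.
  rewrite powRN -ler_pdivrMr ?invr_gt0 ?powR_gt0// invrK mul1r; apply: le_trans CM.
  apply: ge0_ler_powR; rewrite ?nnegrE ?(ltW x0) ?sqr_ge0 ?(ltW e0)//.
  have -> : x = (x `^ 2^-1) ^+ 2 by rewrite -powR_mulrn ?powR_ge0// -powRrM mulVf ?powRr1 ?(ltW x0).
  by rewrite lerXn2r ?nnegrE ?powR_ge0 ?(ltW CV0)// ltW.
Qed.

End weight_classes.

(** * The testing condition for an A_r weight *)

Section testingAr.
Context (R : realType) (n : nat) d (T : measurableType d).
Variable mu : {measure set T -> \bar R}.
Variable dist : T -> T -> R.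
Hypothesis mdist : measurable_fun setT (fun z : T * T => dist z.1 z.2).
Hypothesis dist_ge0 : forall x y, 0 <= dist x y.
Hypothesis n0 : (0 < n)%N.
Hypothesis mu_ball : forall y r, 0 < r -> mu (sball dist y r) = ((2 * r) ^+ n)%:E.
Local Notation ball := (sball dist).
Variables U V : T -> R.
Hypotheses (pU : pos_weight mu dist U) (aU : A1_ball n mu dist U) (mV : measurable_fun setT V).
Hypothesis V0 : forall x, 0 < V x.

Let VU x := V x * U x.

Let mU : measurable_fun setT U. Proof. by case: pU. Qed.
Let U0 x : 0 < U x. Proof. by case: pU. Qed.
Let mVU : measurable_fun setT VU. Proof. exact: measurable_funM. Qed.
Let VU0 x : 0 < VU x. Proof. by rewrite mulr_gt0. Qed.

(** On the set where V < l, the function l ^ s V ^ (- s) is at least 1. *)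
Lemma Ar_sublevel (C s : R) y r l u w : 0 < C -> 0 < s -> 0 < r -> 0 <= l ->
  0 < u -> 0 < w ->
  (wint mu (fun x => V x `^ (- s) * U x)%R (ball y r) <= (u * (C * u / w) `^ s)%:E)%E ->
  (wint mu U (ball y r `&` [set z : T | (V z < l)%R]) <= (u * (C * l * u / w) `^ s)%:E)%E.
Proof.
move=> C0 s0 r0 l0 u0 w0 h.
have mE : measurable (ball y r `&` [set z : T | (V z < l)%R]).
  by apply: measurableI; [exact: measurable_sball|exact: measurable_lt_set].
have mVs : measurable_fun setT (fun x => V x `^ (- s) * U x).
  by apply: measurable_funM => //; exact: measurable_funpow.
have Vs0 x : 0 <= V x `^ (- s) * U x by rewrite mulr_ge0 ?powR_ge0// ltW.
rewrite [X in (_ <= X)%E](_ : _ = ((l `^ s)%:E * (u * (C * u / w) `^ s)%:E)%E); last first.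
  rewrite -EFinM [C * l]mulrC -!mulrA powRM// ?mulr_ge0 ?invr_ge0 ?(ltW u0) ?(ltW w0) ?(ltW C0)//.
  by rewrite mulrCA.
apply: (@le_trans _ _ ((l `^ s)%:E * wint mu (fun x => V x `^ (- s) * U x)%R (ball y r))%E); last first.
  by apply: lee_wpmul2l => //; rewrite lee_fin powR_ge0.
apply: (@le_trans _ _ (wint mu (fun x => l `^ s * (V x `^ (- s) * U x))%R
   (ball y r `&` [set z : T | (V z < l)%R]))).
  apply: le_wint => //; first exact: measurable_funM.
  move=> x [_ /= Vl]; rewrite (ltW (U0 x))/= mulrA ler_peMl ?(ltW (U0 x))//.
  rewrite powRN ler_pdivlMr ?powR_gt0// mul1r.
  by apply: ge0_ler_powR; rewrite ?nnegrE ?(ltW s0) ?(ltW (V0 x))// ltW.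
rewrite wintZ ?powR_ge0//; apply: lee_wpmul2l; first by rewrite lee_fin powR_ge0.
apply: wint_subset => //; first exact: measurable_sball.
Qed.

Lemma Ar_mass_fin : Ar_ball mu dist U V -> forall y r, 0 < r ->
  exists2 w, 0 < w & wint mu VU (ball y r) = w%:E.
Proof.
move=> [C C0 [s s0 hA]] y r r0; apply: (wint_ball_fin mdist mu_ball) => //.
by split => // z q q0; exact: (hA z q q0).1.
Qed.

(** By [A1_ball_growth] the ring between r and 2 r carries a fixed fraction of
    the U-measure of the large ball, and by [Ar_sublevel] V is on most of the
    ring at least a multiple of its U-average. *)
Lemma Ar_growth : Ar_ball mu dist U V -> exists2 A, 1 < A & forall y r, 0 < r ->
  A * fine (wint mu VU (ball y r)) <= fine (wint mu VU (ball y (2 * r))).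
Proof.
move=> aV; have [C C0 [s s0 hA]] := aV; have [CG CG0 hG] := A1_ball_growth mdist n0 mu_ball pU aU.
have mb y r : measurable (ball y r) by exact: measurable_sball.
have fw := Ar_mass_fin aV.
pose c1 := (CG + 1)^-1.
have CG10 : 0 < CG + 1 by rewrite addr_gt0.
have c10 : 0 < c1 by rewrite invr_gt0.
(* chosen such that V < c0 w2 / u2 holds on at most half of the U-measure of the
   ring, w2 and u2 being the masses of V U and U on the ball of radius 2 r *)
pose c0 := (c1 / 2) `^ s^-1 / C.
have c00 : 0 < c0 by rewrite divr_gt0// powR_gt0// divr_gt0.
have c'0 : 0 < c0 * (c1 / 2) by rewrite mulr_gt0// divr_gt0.
exists (1 + c0 * (c1 / 2)); first by rewrite ltrDl.
move=> y r r0; have r20 : 0 < 2 * r by rewrite mulr_gt0.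
have [w w0 hw] := fw y r r0; have [w2 w20 hw2] := fw y _ r20.
have [u u0 hu] := wint_ball_fin mdist mu_ball y pU r0.
have [u2 u20 hu2] := wint_ball_fin mdist mu_ball y pU r20.
have huu := hG y r u u2 r0 hu hu2.
have sub : ball y r `<=` ball y (2 * r) by exact: sball_double.
have VU0' x : 0 <= VU x by exact: ltW.
have U0' x : 0 <= U x by exact: ltW.
pose D := ball y (2 * r) `\` ball y r.
have mD : measurable D by exact: measurableD.
have hwD : (w2%:E = w%:E + wint mu VU D)%E.
  by rewrite -hw2 (wint_splitI mu mVU VU0' (mb y (2 * r)) (mb y r)) setIC (setIidl sub) hw.
have huD : (u2%:E = u%:E + wint mu U D)%E.
  by rewrite -hu2 (wint_splitI mu mU U0' (mb y (2 * r)) (mb y r)) setIC (setIidl sub) hu.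
have [wD hwDe] : exists wD, wint mu VU D = wD%:E.
  by move: hwD; case: (wint mu VU D) (wint_ge0 mu (A := D) (fun x _ => VU0' x)) => [a _ _|//|//]; exists a.
have [uD huDe] : exists uD, wint mu U D = uD%:E.
  by move: huD; case: (wint mu U D) (wint_ge0 mu (A := D) (fun x _ => U0' x)) => [a _ _|//|//]; exists a.
move: hwD huD; rewrite hwDe huDe -!EFinD => -[hwD] [huD].
have uDge : c1 * u2 <= uD.
  rewrite /c1 ler_pdivrMl//.
  have : u2 / CG <= uD by lra.
  rewrite ler_pdivrMr// => h1.
  have := u0; nra.
pose l := c0 * w2 / u2.
have l0 : 0 < l by rewrite divr_gt0// mulr_gt0.
pose S := [set z : T | (V z < l)%R].
have mS : measurable S by exact: measurable_lt_set.
have [_ hA2] := hA y _ r20; rewrite hw2 hu2 /= in hA2.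
have hS := Ar_sublevel C0 s0 r20 (ltW l0) u20 w20 hA2.
have hS2 : (wint mu U (D `&` S) <= (c1 / 2 * u2)%:E)%E.
  apply: (@le_trans _ _ (wint mu U (ball y (2 * r) `&` S))).
    by apply: wint_subset => //; try exact: measurableI; move=> x [[]].
  apply: le_trans hS _; rewrite lee_fin mulrC ler_wpM2r ?(ltW u20)//.
  rewrite (_ : C * l * u2 / w2 = (c1 / 2) `^ s^-1).
    by rewrite -powRrM mulVf ?gt_eqF// powRr1// ltW// divr_gt0.
  by rewrite /l /c0; field; rewrite !gt_eqF.
have hDS : ((c1 / 2 * u2)%:E <= wint mu U (D `\` S))%E.
  have := wint_splitI mu mU U0' mD mS; rewrite huDe.
  case: (wint mu U (D `&` S)) hS2 (wint_ge0 mu (A := D `&` S) (fun x _ => U0' x)) => [a ha _|//|//].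
  case: (wint mu U (D `\` S)) (wint_ge0 mu (A := D `\` S) (fun x _ => U0' x)) => [z _|//|//].
  rewrite -EFinD => -[h2]; move: ha; rewrite !lee_fin => ha.
  have : c1 * u2 <= a + z by rewrite -h2.
  lra.
have : ((l * (c1 / 2 * u2))%:E <= wD%:E)%E.
  rewrite -hwDe EFinM; apply: le_trans (lee_wpmul2l _ hDS) _; first by rewrite lee_fin ltW.
  apply: (@le_trans _ _ (wint mu VU (D `\` S))).
    apply: chebyshev_wint => //; first exact: measurableD.
    - exact: ltW.
    - by move=> x [_ /= /negP]; rewrite -leNgt => h; rewrite ler_wpM2r.
  by apply: wint_subset => //; exact: measurableD.
rewrite lee_fin hw hw2 /= (_ : l * _ = c0 * (c1 / 2) * w2); last first.
  by rewrite /l; field; rewrite gt_eqF.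
have ww : w <= w2.
  rewrite hwD lerDl -lee_fin -hwDe; exact: wint_ge0.
move=> h; rewrite mulrDl mul1r hwD lerD2l; apply: le_trans h.
by rewrite ler_wpM2l// ltW.
Qed.

(** As for [testing_A1], with Chebyshev's inequality for the measure U.  Now x r
    is (V U)(B(y, r)) / (t U y), which is comparable to r ^ n / t times the
    U-average of V where U(B(y, r)) is comparable to U y r ^ n. *)
Lemma testing_Ar : A1_center n mu dist U -> Ar_ball mu dist U V -> testing n mu dist V U.
Proof.
move=> [CU CU0 hU] aV th ka th0 ka0; have [A A1 hg] := Ar_growth aV.
have [C C0 [s s0 hA]] := aV.
have mb y r : measurable (ball y r) by exact: measurable_sball.
have fw := Ar_mass_fin aV.
have U0' x : 0 <= U x by exact: ltW.
have VU0' x : 0 <= VU x by exact: ltW.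
pose e := Num.min 2^-1 (s / 2).
have e0 : 0 < e by rewrite lt_min invr_gt0 ltr0n divr_gt0.
have e12 : e <= 2^-1 by rewrite ge_min lexx.
have es2 : e <= s / 2 by rewrite ge_min lexx orbT.
pose M := 1 + CU + CU * (C * CU) `^ s.
have CCU : 0 < CU * (C * CU) `^ s by rewrite mulr_gt0 ?powR_gt0 ?mulr_gt0.
have M0 : 0 < M by rewrite /M addr_gt0// addr_gt0.
have M1 : 1 <= M by rewrite /M -addrA lerDl addr_ge0// ltW.
have MCU : CU <= M by rewrite /M -addrA addrCA lerDl addr_ge0// ltW.
have MC : CU * (C * CU) `^ s <= M by rewrite /M lerDr addr_ge0// ltW.
exists (ring_const n th ka e A * M); first by rewrite mulr_gt0 ?ring_const_gt0.
apply: filterS hU => y hUy t t0.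
pose tau := t * U y; have tau0 : 0 < tau by rewrite mulr_gt0.
pose w r := fine (wint mu VU (ball y r)).
have wE r : 0 < r -> 0 < w r /\ wint mu VU (ball y r) = (w r)%:E.
  by move=> r0; have [a a0 ha] := fw y r r0; rewrite /w ha.
have mVr r : measurable_fun setT (fun z : T => V z * r ^+ n) by exact: measurable_funM.
rewrite -(mulrA (ring_const _ _ _ _ _)); apply: (@ring_sum _ _ _ _ _ _ mdist dist_ge0 n0 V U y t th ka e A (M * U y) (fun r => w r / tau)) => //.
- by rewrite mulr_ge0// ltW.
- by move=> r r0; rewrite divr_gt0// (wE r r0).1.
- by move=> r r0; rewrite mulrA ler_pM2r ?invr_gt0// hg.
- move=> r r0; apply: le_trans (hUy r r0) _; rewrite lee_fin mulrAC.
  by rewrite ler_wpM2r ?exprn_ge0 ?(ltW r0)// ler_wpM2r.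
- move=> r r0 x1; have [w0 hw] := wE r r0.
  set x := w r / tau; have x0 : 0 < x by rewrite divr_gt0.
  set E := ball y r `&` _.
  have mE : measurable E by apply: measurableI => //; exact: measurable_lt_set.
  have rn0 : 0 < r ^+ n by rewrite exprn_gt0.
  have c0 : 0 < t * x `^ 2^-1 / r ^+ n by rewrite divr_gt0 ?mulr_gt0 ?powR_gt0.
  have h1 : ((t * x `^ 2^-1 / r ^+ n)%:E * wint mu U E <= (w r)%:E)%E.
    rewrite -hw; apply: (@le_trans _ _ (wint mu VU E)).
      apply: chebyshev_wint => //; first exact: ltW.
      by move=> z [_ /= /ltW h]; rewrite ler_wpM2r// ler_pdivrMr.
    by apply: wint_subset => // z [].
  rewrite -(lee_pmul2l _ (x := (t * x `^ 2^-1 / r ^+ n)%:E))//.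
  apply: le_trans h1 _; rewrite -EFinM lee_fin.
  rewrite [leRHS](_ : _ = M * tau * (x `^ 2^-1 * x `^ e)); last by rewrite /tau; field; rewrite gt_eqF.
  rewrite -powRD; last by rewrite (gt_eqF x0) implybT.
  have wx : w r = tau * x by rewrite /x mulrCA mulfV ?mulr1// gt_eqF.
  rewrite wx -mulrA [leRHS]mulrCA ler_wpM2l ?(ltW tau0)//.
  apply: (@le_trans _ _ (x `^ (2^-1 + e))); last by rewrite ler_peMl// powR_ge0.
  rewrite -[leLHS]powRr1 ?(ltW x0)//; apply: ger_powR; first by rewrite x0.
  by move: e12; lra.
- move=> r r0 x1; have [w0 hw] := wE r r0.
  set x := w r / tau; have x0 : 0 < x by rewrite divr_gt0.
  have rn0 : 0 < r ^+ n by rewrite exprn_gt0.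
  have [u u0 hu] := wint_ball_fin mdist mu_ball y pU r0.
  have [_ hA2] := hA y _ r0; rewrite hw hu /= in hA2.
  pose l := t * x `^ 2^-1 / r ^+ n.
  have l0 : 0 < l by rewrite divr_gt0// mulr_gt0// powR_gt0.
  rewrite (_ : [set z | _] = [set z : T | (V z < l)%R]); last first.
    by apply/seteqP; split => z /=; rewrite /l ltr_pdivlMr.
  apply: le_trans (Ar_sublevel C0 s0 r0 (ltW l0) u0 w0 hA2) _.
  have hu1 : u <= CU * r ^+ n * U y by rewrite -lee_fin -hu hUy.
  have wx : w r = tau * x by rewrite /x mulrCA mulfV ?mulr1// gt_eqF.
  have x12 := powR_halfM x0.
  have x120 : 0 < x `^ 2^-1 by exact: powR_gt0.
  rewrite lee_fin; apply: (@le_trans _ _ ((CU * r ^+ n * U y) * (C * CU * (x `^ 2^-1)^-1) `^ s)).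
    apply: ler_pM => //; rewrite ?powR_ge0 ?(ltW u0)//.
    apply: ge0_ler_powR; rewrite ?nnegrE ?(ltW s0)//.
    - by rewrite divr_ge0 ?(ltW w0)// mulr_ge0 ?(ltW u0)// mulr_ge0 ?(ltW l0)// ltW.
    - by rewrite mulr_ge0 ?invr_ge0 ?(ltW x120)// mulr_ge0// ltW.
    - rewrite ler_pdivrMr// wx -[X in _ * (tau * X)]x12.
      rewrite [leRHS](_ : _ = C * l * (CU * r ^+ n * U y)).
        by rewrite ler_wpM2l// mulr_ge0// ltW.
      by rewrite /l /tau; field; rewrite !gt_eqF.
  rewrite powRM ?invr_ge0 ?powR_ge0 ?mulr_ge0 ?(ltW C0) ?(ltW CU0)//.
  rewrite powRVx ?powR_ge0// -powRrM.
  rewrite [leLHS](_ : _ = CU * (C * CU) `^ s * x `^ (2^-1 * - s) * (U y * r ^+ n)); last by ring.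
  rewrite [leRHS](_ : _ = M * x `^ (- e) * (U y * r ^+ n)); last by ring.
  rewrite ler_wpM2r ?mulr_ge0 ?(ltW rn0)//.
  apply: ler_pM => //; rewrite ?powR_ge0 ?(ltW CCU)//.
  by apply: ler_powR => //; lra.
Qed.

End testingAr.

(** * Estimates of the two parts of a fractional integral *)

Lemma le_poweR (R : realType) (x y : \bar R) (r : R) : 0 <= r -> (0 <= x)%E ->
  (x <= y)%E -> (x `^ r <= y `^ r)%E.
Proof.
move=> r0 x0 xy; apply: gt0_ler_poweR => //; rewrite in_itv/= leey andbT//.
exact: le_trans xy.
Qed.

Section hoelder_wint.
Context (R : realType) d (T : measurableType d).
Variable mu : {measure set T -> \bar R}.

Lemma wint_hoelder (f g : T -> R) (p q : R) (A : set T) : measurable A ->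
  measurable_fun setT f -> measurable_fun setT g ->
  (forall x, 0 <= f x) -> (forall x, 0 <= g x) ->
  0 < p -> 0 < q -> p^-1 + q^-1 = 1 ->
  (wint mu (fun x => f x * g x)%R A <=
    (wint mu (fun x => f x `^ p)%R A) `^ p^-1 * (wint mu (fun x => g x `^ q)%R A) `^ q^-1)%E.
Proof.
move=> mA mf mg f0 g0 p0 q0 pq.
pose fA x := \1_A x * f x; pose gA x := \1_A x * g x.
have mfA : measurable_fun setT fA by apply: measurable_funM => //; exact: measurable_indic.
have mgA : measurable_fun setT gA by apply: measurable_funM => //; exact: measurable_indic.
have LE (h : T -> R) (s : R) : (forall x, 0 <= h x) -> 0 < s ->
    ('N[mu]_s%:E[EFin \o (fun x => \1_A x * h x)%R] = (wint mu (fun x => h x `^ s)%R A) `^ s^-1)%E.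
  move=> h0 s0; rewrite unlock /= /wint [in RHS]integral_mkcond; congr (_ `^ _)%E.
  apply: eq_integral => x _; rewrite patchE /= indicE; case: ifP => _.
    by rewrite mul1r ger0_norm.
  by rewrite mul0r normr0 powR0 ?gt_eqF.
have := hoelder mu mfA mgA p0 q0 pq.
rewrite /fA /gA !LE// => h; apply: le_trans h.
rewrite Lnorm1 /wint integral_mkcond; apply: le_of_eq.
apply: eq_integral => x _; rewrite patchE /= indicE; case: ifP => _.
  by rewrite !mul1r ger0_norm// mulr_ge0.
by rewrite !mul0r normr0.
Qed.

End hoelder_wint.

Lemma powR_pos_sum (R : realType) (x a b : R) : 0 < x -> x `^ (a + b) = x `^ a * x `^ b.
Proof. by move=> x0; apply: powRD; rewrite (gt_eqF x0) implybT. Qed.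

Section nearfar.
Context (R : realType) d (T : measurableType d).
Variable mu : {measure set T -> \bar R}.
Variables (g U S D : T -> R) (p q t : R).
Hypotheses (mg : measurable_fun setT g) (mU : measurable_fun setT U)
  (mS : measurable_fun setT S) (mD : measurable_fun setT D).
Hypotheses (g0 : forall x, 0 <= g x) (U0 : forall x, 0 < U x)
  (S0 : forall x, 0 < S x) (D0 : forall x, 0 <= D x).
Hypotheses (p1 : 1 < p) (pq : p < q) (t0 : 0 < t).
Let p' : R := 1 - p^-1.
Let a : R := q^-1 + p'.
Let p0 : 0 < p. Proof. exact: lt_trans p1. Qed.
Let q0 : 0 < q. Proof. exact: lt_trans pq. Qed.
Let p'0 : 0 < p'. Proof. by rewrite subr_gt0 invf_lt1. Qed.
Let a0 : 0 < a. Proof. by rewrite addr_gt0// invr_gt0. Qed.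
Let pp' : p^-1 + (p'^-1)^-1 = 1. Proof. by rewrite invrK addrC subrK. Qed.
Let testing_bound (th ka c M : R) (A : set T) (f : T -> R) : measurable A ->
  measurable_fun setT f -> 0 <= c ->
  (wint mu (fun y => psi th ka (U y * D y / t) * S y * (D y)^-1)%R setT <= M%:E)%E ->
  (forall y, A y -> 0 <= f y <= c * (psi th ka (U y * D y / t) * S y * (D y)^-1)) ->
  (wint mu f A <= (c * M)%:E)%E.
Proof.
move=> mA mf c0 hM; set P := (fun y => psi th ka _ * _ * _)%R in hM * => fP.
have mP : measurable_fun setT P.
  apply: measurable_funM; last exact: measurable_funV.
  apply: measurable_funM => //; apply: (measurableT_comp (measurable_psi _ _)).
  by apply: measurable_funM => //; exact: measurable_funM.
have P0 y : 0 <= P y by rewrite !mulr_ge0 ?psi_ge0 ?invr_ge0// ltW.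
rewrite EFinM; apply: le_trans (lee_wpmul2l _ hM); last by rewrite lee_fin.
rewrite -wintZ//; apply: (@le_trans _ _ (wint mu (fun y => c * P y)%R A)).
  by apply: le_wint => //; exact: measurable_funM.
by apply: wint_subset => //; [exact: measurable_funM|move=> y; rewrite mulr_ge0].
Qed.
Let pmp' : p * p' = p - 1. Proof. by rewrite mulrBr mulr1 mulfV// gt_eqF. Qed.

(** Hoelder's inequality for f1 f2, where f1 ^ p is the integrand that B bounds
    and the conjugate power of f2 is a multiple of the testing integrand: in the
    far part psi is the power - ka, and ka is chosen to match. *)
Lemma far_part_le (M B th : R) : 0 <= M -> 0 <= B ->
  (wint mu (fun y => psi th (p'^-1 / q) (U y * D y / t) * S y * (D y)^-1)%R setT <= M%:E)%E ->
  (wint mu (fun y => g y `^ p * U y `^ (p / q) * S y `^ (1 - p))%R setT <= B%:E)%E ->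
  (wint mu (fun y => g y * D y `^ (- a))%R [set y | (t <= U y * D y)%R] <=
    (B `^ p^-1 * (t `^ (- (p'^-1 / q)) * M) `^ p')%:E)%E.
Proof.
move=> M0 B0 hM hB; pose ka := p'^-1 / q.
pose A := [set y | t <= U y * D y].
have mUD : measurable_fun setT (fun y => U y * D y) by exact: measurable_funM.
have mA : measurable A by exact: measurable_le_set.
pose f1 y := g y * U y `^ q^-1 * S y `^ (- p').
pose f2 y := U y `^ (- q^-1) * S y `^ p' * D y `^ (- a).
have mf1 : measurable_fun setT f1.
  by apply: measurable_funM; [apply: measurable_funM => //; exact: measurable_funpow|exact: measurable_funpow].
have mf2 : measurable_fun setT f2.
  by do !apply: measurable_funM; exact: measurable_funpow.
have f10 y : 0 <= f1 y by rewrite !mulr_ge0 ?powR_ge0.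
have f20 y : 0 <= f2 y by rewrite !mulr_ge0 ?powR_ge0.
have -> : (fun y => g y * D y `^ (- a)) = (fun y => f1 y * f2 y).
  apply/funext => y; rewrite /f1 /f2 !powRN.
  have : U y `^ q^-1 != 0 by rewrite gt_eqF// powR_gt0.
  have : S y `^ p' != 0 by rewrite gt_eqF// powR_gt0.
  move: (U y `^ q^-1) (S y `^ p') ((D y `^ a)^-1) => u s w s0 u0.
  by field; rewrite s0 u0.
have ip' : 0 < p'^-1 by rewrite invr_gt0.
apply: le_trans (wint_hoelder mu mA mf1 mf2 f10 f20 p0 ip' pp') _.
rewrite EFinM invrK -!poweR_EFin; apply: lee_pmul; rewrite ?poweR_ge0//.
  apply: le_poweR; [by rewrite invr_ge0 ltW|by apply: wint_ge0 => y _; exact: powR_ge0|].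
  apply: le_trans hB; apply: (@le_trans _ _ (wint mu (fun y => (f1 y `^ p)%R) setT)).
    apply: wint_subset => //; first exact: measurable_funpow.
    by move=> y; rewrite powR_ge0.
  apply: le_of_eq; apply: eq_integral => y _; congr EFin.
  rewrite /f1 !powRM ?mulr_ge0 ?powR_ge0// -!powRrM mulNr [p' * p]mulrC pmp' opprB.
  by rewrite [q^-1 * p]mulrC.
apply: le_poweR; [exact: ltW|by apply: wint_ge0 => y _; exact: powR_ge0|].
apply: (testing_bound mA _ (powR_ge0 _ _) hM); first exact: measurable_funpow.
move=> y Ay; rewrite powR_ge0/=.
have Dy : 0 < D y.
  rewrite lt_neqAle D0 andbT eq_sym; apply/eqP => h; move: Ay.
  by rewrite /A/= h mulr0 leNgt t0.
have z1 : (U y * D y / t < 1) = false.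
  by apply/negbTE; rewrite -leNgt ler_pdivlMr// mul1r.
rewrite /psi z1 /f2.
have UD0 : 0 < U y * D y by rewrite mulr_gt0.
rewrite !powRM ?mulr_ge0 ?powR_ge0 ?invr_ge0 ?(ltW t0) ?(ltW (U0 _))//.
rewrite -!powRrM powRVx ?(ltW t0)// opprK mulfV ?gt_eqF// powRr1 ?(ltW (S0 _))//.
rewrite [- q^-1 * _](_ : _ = - ka); last by rewrite /ka mulNr mulrC.
rewrite [- a * _](_ : _ = - ka + -1); last by rewrite /a /ka; field; rewrite !gt_eqF.
rewrite powR_pos_sum// powR_inv1//.
have tka : t `^ ka != 0 by rewrite gt_eqF// powR_gt0.
by rewrite !powRN; apply: le_of_eq; field; rewrite tka !gt_eqF// powR_gt0.
Qed.

(** The factor (U D) ^ ep is moved from one Hoelder factor to the other.  It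
    gives psi a positive exponent in the factor that is bounded by testing; it is
    paid by (U D) ^ (- (ep p)) in the factor that remains. *)
Lemma near_part_le (M ep ka : R) : 0 <= M -> 0 < ep ->
  (wint mu (fun y => psi (ep / p') ka (U y * D y / t) * S y * (D y)^-1)%R setT <= M%:E)%E ->
  ((wint mu (fun y => g y * D y `^ (- a))%R [set y | (U y * D y < t)%R]) `^ p <=
   ((t `^ (ep / p') * M) `^ (p - 1))%:E *
   wint mu (fun y => g y `^ p * S y `^ (1 - p) * (U y * D y) `^ (- (ep * p)) * D y `^ (- (p / q)))%R
     [set y | (U y * D y < t)%R])%E.
Proof.
move=> M0 ep0 hM; pose th := ep / p'.
have th0 : 0 < th by rewrite divr_gt0.
pose A := [set y | U y * D y < t].
have mUD : measurable_fun setT (fun y => U y * D y) by exact: measurable_funM.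
have mA : measurable A by exact: measurable_lt_set.
pose f3 y := g y * S y `^ (- p') * (U y * D y) `^ (- ep) * D y `^ (- q^-1).
pose f4 y := (U y * D y) `^ ep * S y `^ p' * D y `^ (- p').
have mf3 : measurable_fun setT f3.
  apply: measurable_funM; last exact: measurable_funpow.
  apply: measurable_funM; last exact: measurable_funpow.
  by apply: measurable_funM => //; exact: measurable_funpow.
have mf4 : measurable_fun setT f4.
  by do !apply: measurable_funM; exact: measurable_funpow.
have UD0 y : 0 <= U y * D y by rewrite mulr_ge0// ltW.
have f30 y : 0 <= f3 y by rewrite !mulr_ge0 ?powR_ge0.
have f40 y : 0 <= f4 y by rewrite !mulr_ge0 ?powR_ge0.
have -> : (fun y => g y * D y `^ (- a)) = (fun y => f3 y * f4 y).
  apply/funext => y; rewrite /f3 /f4.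
  have := D0 y; rewrite le_eqVlt => /predU1P[<-|Dy].
    by rewrite !powR0 ?oppr_eq0 ?invr_eq0 ?gt_eqF// !(mulr0, mul0r).
  rewrite /a opprD powR_pos_sum// !powRN.
  have : (U y * D y) `^ ep != 0 by rewrite gt_eqF// powR_gt0// mulr_gt0.
  have : S y `^ p' != 0 by rewrite gt_eqF// powR_gt0.
  have : D y `^ p' != 0 by rewrite gt_eqF// powR_gt0.
  have : D y `^ q^-1 != 0 by rewrite gt_eqF// powR_gt0.
  move: (D y `^ q^-1) (D y `^ p') ((U y * D y) `^ ep) (S y `^ p') => x1 x2 x3 x4 h1 h2 h3 h4.
  by field; rewrite h1 h2 h3 h4.
have ip' : 0 < p'^-1 by rewrite invr_gt0.
have H := wint_hoelder mu mA mf3 mf4 f30 f40 p0 ip' pp'.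
have W0 h : (forall y, 0 <= h y) -> (0 <= wint mu h A)%E by move=> h0; apply: wint_ge0.
have hf4 : (wint mu (fun y => f4 y `^ p'^-1)%R A <= (t `^ th * M)%:E)%E.
  apply: (testing_bound mA _ (powR_ge0 _ _) hM); first exact: measurable_funpow.
  move=> y Ay; rewrite powR_ge0/=.
  have z1 : U y * D y / t < 1 by rewrite ltr_pdivrMr// mul1r.
  rewrite /psi z1 /f4.
  have := D0 y; rewrite le_eqVlt => /predU1P[<-|Dy].
    by rewrite [0 `^ (- p')]powR0 ?oppr_eq0 ?gt_eqF// mulr0 powR0 ?gt_eqF// invr0 mulr0.
  rewrite [((U y * D y) `^ ep * _ * _) `^ _]powRM ?mulr_ge0 ?powR_ge0//.
  rewrite [((U y * D y) `^ ep * _) `^ _]powRM ?powR_ge0//.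
  rewrite [(U y * D y / t) `^ _]powRM ?invr_ge0 ?(ltW t0)// powRVx ?(ltW t0)//.
  rewrite -!powRrM mulNr mulfV ?gt_eqF// powRr1 ?(ltW (S0 _))// powR_inv1//.
  rewrite powRN -/th.
  have tth : t `^ th != 0 by rewrite gt_eqF// powR_gt0.
  by apply: le_of_eq; field; rewrite tth gt_eqF.
apply: le_trans (le_poweR (ltW p0) _ H) _; first by apply: W0 => y; rewrite mulr_ge0.
have X0 : (0 <= wint mu (fun x => f3 x `^ p)%R A)%E by apply: W0 => y; exact: powR_ge0.
have Y0 : (0 <= wint mu (fun x => f4 x `^ p'^-1)%R A)%E by apply: W0 => y; exact: powR_ge0.
have key (X Y : \bar R) : (0 <= X)%E -> (0 <= Y)%E ->
    ((X `^ p^-1 * Y `^ p'^-1^-1) `^ p = Y `^ (p - 1) * X)%E.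
  move=> x0 y0; rewrite (poweRM p (poweR_ge0 _ _) (poweR_ge0 _ _)).
  rewrite -(poweRrM X) -(poweRrM Y) mulVf ?gt_eqF// (poweRe1 x0).
  by rewrite invrK [p' * p]mulrC pmp' muleC.
rewrite (key _ _ X0 Y0); apply: lee_pmul; [exact: poweR_ge0|exact: X0| |].
  by rewrite -poweR_EFin; apply: le_poweR => //; rewrite subr_ge0 ltW.
apply: le_of_eq; apply: eq_integral => y _; congr EFin.
rewrite /f3 [(g y * _ * _ * _) `^ p]powRM ?mulr_ge0 ?powR_ge0//.
rewrite [(g y * _ * _) `^ p]powRM ?mulr_ge0 ?powR_ge0//.
rewrite [(g y * _) `^ p]powRM ?mulr_ge0 ?powR_ge0// -!powRrM.
by rewrite !mulNr [p' * p]mulrC pmp' opprB [q^-1 * p]mulrC.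
Qed.

End nearfar.

(** * Weak type bound for a fractional integral *)

Section weak_type.
Context (R : realType) (n : nat) d (T : measurableType d).
Variable mu : {sigma_finite_measure set T -> \bar R}.
Variable dist : T -> T -> R.
Hypothesis mdist : measurable_fun setT (fun z : T * T => dist z.1 z.2).
Hypothesis dist_ge0 : forall x y, 0 <= dist x y.
Hypothesis distC : forall x y, dist x y = dist y x.
Variables (U V S : T -> R) (p q : R).
Hypotheses (mU : measurable_fun setT U) (mV : measurable_fun setT V)
  (mS : measurable_fun setT S).
Hypotheses (U0 : forall x, 0 < U x) (V0 : forall x, 0 < V x) (S0 : forall x, 0 < S x).
Hypotheses (p1 : 1 <= p) (pq : p < q).
Hypothesis PUS : 1 < p -> testing n mu dist U S.
Hypothesis PVU : testing n mu dist V U.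
Local Notation vd := (vdist n dist).
Let p' : R := 1 - p^-1.
Let a : R := q^-1 + p'.
Let p0 : 0 < p. Proof. exact: lt_le_trans ltr01 p1. Qed.
Let q0 : 0 < q. Proof. exact: lt_trans pq. Qed.
Let vd0 x y : 0 <= vd x y. Proof. exact: vdist_ge0. Qed.

(** For p = 1 the bound is pointwise: D ^ (- 1/q) is at most (U / t) ^ (1/q)
    on the far part. *)
Lemma far_part_ae : exists2 Cf, 0 < Cf & {ae mu, forall x (g : T -> R) (B t : R),
  measurable_fun setT g -> (forall y, 0 <= g y) -> 0 < t -> 0 <= B ->
  (wint mu (fun y => g y `^ p * U y `^ (p / q) * S y `^ (1 - p))%R setT <= B%:E)%E ->
  (wint mu (fun y => g y * vd y x `^ (- a))%R [set y | (t <= U y * vd y x)%R] <=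
    (Cf * B `^ p^-1 * t `^ (- q^-1) * S x `^ p')%:E)%E}.
Proof.
move: p1; rewrite le_eqVlt => /predU1P[p1e|p1lt].
  exists 1 => //; apply: nearW => x g B t mg g0 t0 B0 hB.
  have mvd : measurable_fun setT (fun y => vd y x) by exact: measurable_vdistl.
  rewrite /a /p' -p1e invr1 subrr addr0 powRr0 mulr1 mul1r powRr1//.
  have mA : measurable [set y | (t <= U y * vd y x)%R].
    by apply: measurable_le_set => //; exact: measurable_funM.
  pose h y := g y `^ p * U y `^ (p / q) * S y `^ (1 - p).
  have mh : measurable_fun setT h.
    by do !apply: measurable_funM; exact: measurable_funpow.
  have h0 y : 0 <= h y by rewrite !mulr_ge0 ?powR_ge0.
  apply: (@le_trans _ _ (wint mu (fun y => t `^ (- q^-1) * h y)%R setT)); last first.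
    rewrite wintZ ?powR_ge0// mulrC EFinM; apply: lee_wpmul2l => //.
    by rewrite lee_fin powR_ge0.
  apply: (@le_trans _ _ (wint mu (fun y => t `^ (- q^-1) * h y)%R [set y | (t <= U y * vd y x)%R])); last first.
    by apply: wint_subset => //; [exact: measurable_funM|move=> y; rewrite mulr_ge0 ?powR_ge0].
  apply: le_wint => //; [|exact: measurable_funM|].
    by apply: measurable_funM => //; exact: measurable_funpow.
  move=> y /= hy; rewrite mulr_ge0 ?powR_ge0//= /h -p1e subrr powRr0 mulr1 powRr1//.
  rewrite mulrCA ler_wpM2l// div1r !powRN.
  have vy : 0 < vd y x.
    rewrite lt_neqAle vd0 andbT eq_sym; apply/eqP => h1; move: hy.
    by rewrite h1 mulr0 leNgt t0.
  rewrite [leRHS]mulrC ler_pdivlMr ?powR_gt0// mulrC ler_pdivrMr ?powR_gt0//.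
  rewrite -powRM ?vd0 ?(ltW (U0 _))//.
  by apply: ge0_ler_powR => //; rewrite ?nnegrE ?invr_ge0 ?mulr_ge0 ?vd0// ltW.
have p'0 : 0 < p' by rewrite subr_gt0 invf_lt1.
have k0 : 0 < p'^-1 / q by rewrite divr_gt0// invr_gt0.
have [C C0 hC] := PUS p1lt ltr01 k0.
exists (C `^ p'); first exact: powR_gt0.
apply: filterS hC => x hx g B t mg g0 t0 B0 hB.
have mvd : measurable_fun setT (fun y => vd y x) by exact: measurable_vdistl.
have M0 : 0 <= C * S x by rewrite mulr_ge0// ltW.
apply: le_trans (far_part_le mg mU mS mvd g0 U0 S0 (vd0 ^~ x) p1lt pq t0 M0 B0 (hx t t0) hB) _.
rewrite lee_fin -/p' powRM ?powR_ge0// powRM ?(ltW C0) ?(ltW (S0 _))// -powRrM.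
rewrite [- _ * p'](_ : _ = - q^-1); last by field; rewrite !gt_eqF.
by apply: le_of_eq; ring.
Qed.

(** For p = 1 both sides agree, with ep = 0.  Otherwise ep is so small
    that 1 - p / q - ep p, the exponent of the last use of testing, stays
    positive. *)
Lemma near_part_ae : exists2 ep, 0 <= ep & 0 < 1 - p / q - ep * p /\ exists2 C1, 0 < C1 &
  {ae mu, forall x (g : T -> R) (t : R),
  measurable_fun setT g -> (forall y, 0 <= g y) -> 0 < t ->
  ((wint mu (fun y => g y * vd y x `^ (- a))%R [set y | (U y * vd y x < t)%R]) `^ p <=
   (C1 * t `^ (ep * p) * S x `^ (p - 1))%:E *
   wint mu (fun y => g y `^ p * S y `^ (1 - p) * (U y * vd y x) `^ (- (ep * p)) * vd y x `^ (- (p / q)))%R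
     [set y | (U y * vd y x < t)%R])%E}.
Proof.
have pq1 : 0 < 1 - p / q by rewrite subr_gt0 ltr_pdivrMr// mul1r.
move: p1; rewrite le_eqVlt => /predU1P[p1e|p1lt].
  exists 0 => //; split; first by rewrite mul0r subr0.
  exists 1 => //; apply: nearW => x g t mg g0 t0.
  rewrite /a /p' -p1e invr1 subrr addr0 mul0r !powRr0 !mulr1 mul1e.
  rewrite poweRe1; last by apply: wint_ge0 => y _; rewrite mulr_ge0 ?powR_ge0.
  apply: le_of_eq; apply: eq_integral => y _.
  by rewrite !powRr0 oppr0 powRr0 !mulr1 powRr1// div1r.
have p'0 : 0 < p' by rewrite subr_gt0 invf_lt1.
(* this makes ep p half of 1 - p / q *)
pose ep := (1 - p / q) / (2 * p).
have ep0 : 0 < ep by rewrite divr_gt0// mulr_gt0.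
exists ep; first exact: ltW.
split; first by rewrite (_ : ep * p = (1 - p / q) / 2); [lra|rewrite /ep; field; rewrite !gt_eqF].
have th0 : 0 < ep / p' by rewrite divr_gt0.
have [C C0 hC] := PUS p1lt th0 ltr01.
exists (C `^ (p - 1)); first exact: powR_gt0.
apply: filterS hC => x hx g t mg g0 t0.
have mvd : measurable_fun setT (fun y => vd y x) by exact: measurable_vdistl.
have M0 : 0 <= C * S x by rewrite mulr_ge0// ltW.
apply: le_trans (near_part_le mg mU mS mvd g0 U0 S0 (vd0 ^~ x) p1lt pq t0 M0 ep0 (hx t t0)) _.
apply: lee_wpmul2r.
  by apply: wint_ge0 => y _; rewrite !mulr_ge0 ?powR_ge0.
rewrite lee_fin powRM ?powR_ge0// powRM ?(ltW C0) ?(ltW (S0 _))// -powRrM.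
rewrite [X in t `^ X](_ : _ = ep * p); last first.
  by rewrite /p'; field; rewrite (gt_eqF p0) subr_eq0 gt_eqF.
by apply: le_of_eq; ring.
Qed.

(** The near part bounds the measure of the level set by a double integral in
    which, for fixed y, the integral over x is a testing integral for (V, U). *)
Theorem weak_type : exists2 C, 0 < C & forall (g : T -> R) (B t : R) (E : set T),
  measurable_fun setT g -> (forall y, 0 <= g y) -> 0 < B -> 0 < t -> measurable E ->
  (wint mu (fun y => g y `^ p * U y `^ (p / q) * S y `^ (1 - p))%R setT <= B%:E)%E ->
  (forall x, E x -> ((t * V x `^ q^-1 * S x `^ (1 - p^-1))%:E <
     wint mu (fun y => g y * vd y x `^ (- (q^-1 + (1 - p^-1))))%R setT)%E) ->
  (wint mu (fun x => U x * V x)%R E <= (C * t `^ (- q) * B `^ (q / p))%:E)%E.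
Proof.
have [Cf Cf0 hfar] := far_part_ae.
have [ep ep0 [th0 [C1 C10 hnear]]] := near_part_ae.
set th := 1 - p / q - ep * p in th0.
have [C2 C20 hVU] := PVU th0 ltr01.
exists (C1 * C2 * Cf `^ (q - p) * 2 `^ q); first by rewrite !mulr_gt0 ?powR_gt0.
move=> g B t E mg g0 B0 t0 mE hB hE.
have [c c0 cE] : exists2 c, 0 < c & c = t / 2 by exists (t / 2); rewrite ?divr_gt0.
(* for this threshold the far part is at most c v(x), half of the lower bound
   in hE *)
pose tau := (Cf * B `^ p^-1 / c) `^ q.
have tau0 : 0 < tau by rewrite powR_gt0// divr_gt0// mulr_gt0// powR_gt0.
have [K K0 KE] : exists2 K, 0 < K & K = C1 * c `^ (- p).
  by exists (C1 * c `^ (- p)); rewrite ?mulr_gt0 ?powR_gt0.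
pose near x y := U y * vd y x < tau / V x.
pose H x y := (g y `^ p * S y `^ (1 - p) * (U y * vd y x) `^ (- (ep * p)) * vd y x `^ (- (p / q))).
pose W x := K * (tau / V x) `^ (ep * p) * V x `^ (- (p / q)) * (U x * V x).
(* W x carries all factors that depend on x alone, so that the integral of G
   over y is at least U x V x on E *)
pose G (z : T * T) := if near z.1 z.2 then W z.1 * H z.1 z.2 else 0.
have W0 x : 0 <= W x by rewrite /W !mulr_ge0 ?powR_ge0 ?(ltW (U0 _)) ?(ltW (V0 _)) ?(ltW K0).
have H0 x y : 0 <= H x y by rewrite /H !mulr_ge0 ?powR_ge0.
have G0 z : 0 <= G z by rewrite /G; case: ifP => // _; rewrite mulr_ge0.
have mvd2 : measurable_fun setT (fun z : T * T => vd z.2 z.1).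
  apply: measurable_funX; under eq_fun do rewrite distC; exact: mdist.
have mfst h : measurable_fun setT h -> measurable_fun setT (fun z : T * T => h z.1 : R).
  by move=> mh; exact: (measurableT_comp mh measurable_fst).
have msnd h : measurable_fun setT h -> measurable_fun setT (fun z : T * T => h z.2 : R).
  by move=> mh; exact: (measurableT_comp mh measurable_snd).
have mUvd : measurable_fun setT (fun z : T * T => U z.2 * vd z.2 z.1).
  by apply: measurable_funM => //; exact: (msnd _ mU).
have mtV : measurable_fun setT (fun x => tau / V x).
  by apply: measurable_funM => //; exact: measurable_funV.
have mW : measurable_fun setT W.
  apply: measurable_funM; last exact: measurable_funM.
  apply: measurable_funM; last exact: measurable_funpow.
  by apply: measurable_funM => //; exact: measurable_funpow.
have mG : measurable_fun setT G.
  apply: measurable_fun_ifT => //.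
    by apply: measurable_fun_ltr => //; exact: (mfst _ mtV).
  apply: measurable_funM; first exact: (mfst _ mW).
  apply: measurable_funM; last exact: measurable_funpow.
  apply: measurable_funM; last exact: measurable_funpow.
  by apply: measurable_funM; [apply: (msnd (fun y => g y `^ p))|apply: (msnd (fun y => S y `^ (1 - p)))]; exact: measurable_funpow.
have mGe : measurable_fun setT (fun z => (G z)%:E) by exact/measurable_EFinP.
have G0e z : (0 <= (G z)%:E)%E by rewrite lee_fin.
have mvd x : measurable_fun setT (fun y => vd y x) by exact: measurable_vdistl.
have mA x : measurable [set y | near x y].
  by apply: measurable_lt_set => //; exact: measurable_funM.
have mH x : measurable_fun setT (H x).
  apply: measurable_funM; last exact: measurable_funpow.
  apply: measurable_funM; last by apply: measurable_funpow; exact: measurable_funM.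
  by apply: measurable_funM; exact: measurable_funpow.
have GE x : wint mu (fun y => G (x, y)) setT = ((W x)%:E * wint mu (H x) [set y | near x y])%E.
  have mi : measurable_fun setT (fun y => \1_[set y | near x y] y * H x y).
    by apply: measurable_funM => //; exact: measurable_indic.
  rewrite -[X in wint mu (H x) X]setTI -wint_indic -wintZ//; last by move=> y; rewrite mulr_ge0.
  apply: eq_integral => y _; congr EFin; rewrite /G /= indicE.
  case: ifPn => h; first by rewrite mem_set// mul1r.
  by rewrite memNset ?mul0r ?mulr0// => /= h1; rewrite h1 in h.
apply: (@le_trans _ _ (\int[mu]_(x in E) (wint mu (fun y => G (x, y)) setT))%E).
  apply: ae_ge0_le_integral => //.
  - by move=> x _; rewrite lee_fin mulr_ge0// ltW.
  - by apply: measurable_funTS; apply/measurable_EFinP; exact: measurable_funM.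
  - by move=> x _; apply: wint_ge0.
  - apply: measurable_funTS.
    exact: (measurable_fun_fubini_tonelli_F (fun z => (G z)%:E) mGe G0e).
  apply: filterS2 hfar hnear => x hf hn Ex; have hIx := hE x Ex.
  pose v := V x `^ q^-1 * S x `^ (1 - p^-1).
  have v0 : 0 < v by rewrite mulr_gt0 ?powR_gt0.
  have tV0 : 0 < tau / V x by rewrite divr_gt0.
  have mk : measurable_fun setT (fun y => g y * vd y x `^ (- a)).
    by apply: measurable_funM => //; exact: measurable_funpow.
  have k0 y : 0 <= g y * vd y x `^ (- a) by rewrite mulr_ge0 ?powR_ge0.
  have := wint_splitI mu mk k0 measurableT (mA x); rewrite setTI setTD => hsplit.
  have hfar1 : (wint mu (fun y => g y * vd y x `^ (- a))%R (~` [set y | near x y]) <= (c * v)%:E)%E.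
    rewrite (_ : ~` _ = [set y | tau / V x <= U y * vd y x]); last first.
      by apply/seteqP; split => y /=; rewrite /near; [move/negP; rewrite -leNgt|move=> h; apply/negP; rewrite -leNgt].
    apply: le_trans (hf g B _ mg g0 tV0 (ltW B0) hB) _.
    rewrite lee_fin powRM ?invr_ge0 ?(ltW tau0) ?(ltW (V0 x))// powRVx ?(ltW (V0 x))// opprK.
    rewrite /tau -powRrM mulrN mulfV ?gt_eqF// powR_inv1; last first.
      by rewrite !mulr_ge0 ?powR_ge0 ?invr_ge0 ?(ltW c0) ?(ltW Cf0).
    have Bp : B `^ p^-1 != 0 by rewrite gt_eqF// powR_gt0.
    by apply: le_of_eq; rewrite /v /p'; field; rewrite Bp !gt_eqF.
  have hnear1 : ((c * v)%:E <= wint mu (fun y => g y * vd y x `^ (- a))%R [set y | near x y])%E.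
    rewrite leNgt; apply/negP => h; move: hIx; rewrite hsplit ltNge => /negP; apply.
    rewrite [X in (_ <= X)%E](_ : _ = ((c * v)%:E + (c * v)%:E)%E).
      by apply: leeD => //; exact: ltW.
    by rewrite -EFinD /v cE; congr EFin; lra.
  have hp : (((c * v) `^ p)%:E <= (C1 * (tau / V x) `^ (ep * p) * S x `^ (p - 1))%:E
        * wint mu (H x) [set y | near x y])%E.
    rewrite -poweR_EFin; apply: le_trans (hn g _ mg g0 tV0).
    by apply: le_poweR => //; rewrite ?(ltW p0)// lee_fin mulr_ge0// ltW.
  rewrite GE /W.
  have vp : v `^ p = V x `^ (p / q) * S x `^ (p - 1).
    rewrite /v powRM ?powR_ge0// -!powRrM [q^-1 * p]mulrC; congr (_ * _ `^ _).
    by field; rewrite gt_eqF.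
  have cvp : 0 < (c * v) `^ p by rewrite powR_gt0// mulr_gt0.
  have -> : (U x * V x)%:E = ((U x * V x / (c * v) `^ p)%:E * ((c * v) `^ p)%:E)%E.
    by rewrite -EFinM divfK// gt_eqF.
  apply: le_trans (lee_wpmul2l _ hp) _.
    by rewrite lee_fin divr_ge0 ?powR_ge0// mulr_ge0// ltW.
  rewrite muleA -EFinM; apply: lee_wpmul2r; first by apply: wint_ge0 => y _.
  rewrite lee_fin (powRM p (ltW c0) (ltW v0)) vp KE !powRN.
  have h1 : c `^ p != 0 by rewrite gt_eqF// powR_gt0.
  have h2 : V x `^ (p / q) != 0 by rewrite gt_eqF// powR_gt0.
  have h3 : S x `^ (p - 1) != 0 by rewrite gt_eqF// powR_gt0.
  move: ((tau / V x) `^ (ep * p)) => w.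
  by apply: le_of_eq; field; rewrite h1 h2 h3.
apply: (@le_trans _ _ (\int[mu]_x (wint mu (fun y => G (x, y)) setT))%E).
  apply: ge0_subset_integral => //.
    exact: (measurable_fun_fubini_tonelli_F (fun z => (G z)%:E) mGe G0e).
  by move=> x _; apply: wint_ge0.
(* from here on, y is fixed first and x is integrated *)
rewrite /wint (fubini_tonelli (fun z => (G z)%:E) mGe G0e).
pose h y := g y `^ p * U y `^ (p / q) * S y `^ (1 - p).
have mh : measurable_fun setT h by do !apply: measurable_funM; exact: measurable_funpow.
have h0 y : 0 <= h y by rewrite !mulr_ge0 ?powR_ge0.
have [L L0 LE] : exists2 L, 0 < L & L = K * tau `^ (1 - p / q) * C2.
  by exists (K * tau `^ (1 - p / q) * C2) => //; rewrite !mulr_gt0// powR_gt0.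
apply: (@le_trans _ _ (wint mu (fun y => L * h y)%R setT)); last first.
  rewrite wintZ ?(ltW L0)//; apply: le_trans (lee_wpmul2l _ hB) _; first by rewrite lee_fin ltW.
  rewrite -EFinM lee_fin LE KE /tau -powRrM mulrBr mulr1 mulrCA mulfV ?gt_eqF// mulr1.
  rewrite powRM ?invr_ge0 ?(ltW c0) ?mulr_ge0 ?powR_ge0 ?(ltW Cf0)//.
  rewrite powRM ?powR_ge0 ?(ltW Cf0)// powRVx ?(ltW c0)// -powRrM.
  have -> : C1 * c `^ (- p) * (Cf `^ (q - p) * B `^ (p^-1 * (q - p)) * c `^ (- (q - p))) * C2 * B
    = C1 * C2 * Cf `^ (q - p) * (c `^ (- p) * c `^ (- (q - p))) * (B `^ (p^-1 * (q - p)) * B) by ring.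
  rewrite -powR_pos_sum// -[X in _ * (_ * X)](powRr1 (ltW B0)) -powR_pos_sum//.
  rewrite (_ : - p + - (q - p) = - q); last by ring.
  rewrite (_ : p^-1 * (q - p) + 1 = q / p); last by field; rewrite gt_eqF.
  rewrite cE powRM ?invr_ge0 ?(ltW t0)// powRVx// opprK.
  by apply: le_of_eq; ring.
apply: ae_ge0_le_integral => //.
- by move=> y _; apply: integral_ge0.
- exact: (measurable_fun_fubini_tonelli_G (fun z => (G z)%:E) mGe G0e).
- by move=> y _; rewrite lee_fin mulr_ge0// ltW.
- by apply/measurable_EFinP; exact: measurable_funM.
apply: filterS hVU => y hy _; have tU0 : 0 < tau / U y by rewrite divr_gt0.
have := hy _ tU0; set P := (fun x => psi th 1 _ * _ * _)%R => hP.
have mP : measurable_fun setT P by exact: measurable_ringF.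
have P0 x : 0 <= P x by rewrite !mulr_ge0 ?psi_ge0 ?invr_ge0 ?vd0// ltW.
pose w := K * tau `^ (1 - p / q) * (g y `^ p * U y `^ (p / q - 1) * S y `^ (1 - p)).
have w0 : 0 <= w by rewrite /w !mulr_ge0 ?powR_ge0// ltW.
apply: (@le_trans _ _ (wint mu (fun x => w * P x)%R setT)).
  apply: le_wint => //; [by exact: (measurableT_comp mG (pair2_measurable y))|exact: measurable_funM|].
  move=> x _; rewrite G0/= /G /near/=; case: ifPn => nr; last by rewrite mulr_ge0.
  rewrite /P /psi.
  have -> : V x * vd x y / (tau / U y) < 1.
    rewrite ltr_pdivrMr// mul1r ltr_pdivlMr//; move: nr; rewrite ltr_pdivlMr//.
    rewrite (_ : vd x y = vd y x); last by rewrite /vdist distC.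
    by apply: le_lt_trans; apply: le_of_eq; ring.
  rewrite /W /H (_ : vd x y = vd y x); last by rewrite /vdist distC.
  have := vd0 y x; rewrite le_eqVlt => /predU1P[<-|D0].
    by rewrite (powR0 (x := - (p / q))) ?oppr_eq0 ?gt_eqF ?divr_gt0// invr0 !mulr0.
  move: (vd y x) D0 => D D0.
  rewrite /w (_ : V x * D / (tau / U y) = V x * D * U y * tau^-1); last by field; rewrite !gt_eqF.
  rewrite !powRM ?mulr_ge0 ?invr_ge0 ?(ltW tau0) ?(ltW (V0 _)) ?(ltW (U0 _)) ?(ltW D0)//.
  rewrite !powRVx ?(ltW tau0) ?(ltW (V0 _))//.
  set e := ep * p; set s := p / q.
  rewrite (_ : th = 1 + - s + - e)// (_ : s - 1 = - 1 + s); last by rewrite addrC.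
  rewrite !opprD !opprK !powR_pos_sum// !powRr1 ?(ltW tau0) ?(ltW (V0 _)) ?(ltW (U0 _)) ?(ltW D0) ?(ltW (S0 _))//.
  rewrite !powR_inv1 ?(ltW tau0) ?(ltW (V0 _)) ?(ltW (U0 _)) ?(ltW D0)// !powRN.
  have nz z r : 0 < z -> z `^ r != 0 :> R by move=> z0; rewrite gt_eqF// powR_gt0.
  have := nz _ s tau0; have := nz _ e tau0; have := nz _ s (V0 x); have := nz _ e (V0 x).
  have := nz _ s D0; have := nz _ e D0; have := nz _ e (U0 y); have := nz _ s (U0 y).
  have := gt_eqF (U0 y); have := gt_eqF (V0 x); have := gt_eqF tau0; have := gt_eqF D0.
  move: (tau `^ s) (tau `^ e) (V x `^ s) (V x `^ e) (D `^ s) (D `^ e) (U y `^ e) (U y `^ s) (g y `^ p).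
  move=> x1 x2 x3 x4 x5 x6 x7 x8 x9 e1 e2 e3 e4 n1 n2 n3 n4 n5 n6 n7 n8.
  by apply: le_of_eq; field; rewrite ?n1 ?n2 ?n3 ?n4 ?n5 ?n6 ?n7 ?n8 ?e1 ?e2 ?e3 ?e4 ?(nz _ _ (S0 y)).
rewrite wintZ//; apply: le_trans (lee_wpmul2l _ hP) _; first by rewrite lee_fin.
rewrite -EFinM lee_fin /w LE /h (_ : p / q - 1 = - 1 + p / q); last by rewrite addrC.
rewrite (powR_pos_sum (-1) (p / q) (U0 y)) powR_inv1 ?(ltW (U0 y))//.
move: (U y `^ (p / q)) (g y `^ p) (S y `^ (1 - p)) (tau `^ (1 - p / q)) => x1 x2 x3 x4.
by apply: le_of_eq; field; rewrite gt_eqF.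
Qed.

End weak_type.

(** * Dyadic decay of A_1 weights *)

Section dyadic.
Context (R : realType) d (T : measurableType d).
Variable mu : {measure set T -> \bar R}.

Lemma wint_partition (I : finType) (h : T -> I) (w : T -> R) (A : set T) :
  measurable A -> measurable_fun setT w -> (forall x, 0 <= w x) ->
  (forall i, measurable [set x | h x = i]) ->
  wint mu w A = (\sum_(i : I) wint mu w (A `&` [set x | h x = i]))%E.
Proof.
move=> mA mw w0 mh.
under eq_bigr do rewrite -wint_indic.
rewrite /wint -ge0_integral_sum//; last first.
- by move=> i x _; rewrite lee_fin mulr_ge0.
- move=> i; apply: measurable_funTS; apply/measurable_EFinP.
  by apply: measurable_funM => //; exact: measurable_indic.
apply: eq_integral => x _; rewrite sumEFin (bigD1 (h x))//= indicE mem_set// mul1r.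
rewrite big1 ?addr0// => i /eqP hi; rewrite indicE memNset ?mul0r//.
by move=> /= /esym.
Qed.

(* F N x names the cell of level N that contains x, and h N x the child of that
   cell that contains x *)
Context (I : finType) (X : Type) (F : nat -> T -> X) (h : nat -> T -> I).
Hypothesis Fh : forall N x y, F N.+1 x = F N.+1 y <-> F N x = F N y /\ h N x = h N y.
Hypothesis mh : forall N i, measurable [set x | h N x = i].
Definition cell N x : set T := [set y | F N y = F N x].
Hypothesis mcell : forall N x, measurable (cell N x).
Variables (M : nat -> R) (K C : R) (U : T -> R).
Hypotheses (M0 : forall N, 0 < M N) (K1 : 1 <= K) (C1 : 1 <= C).
Hypothesis MK : forall N, M N = K * M N.+1.
Hypothesis mu_cell : forall N x, mu (cell N x) = (M N)%:E.
Hypotheses (mU : measurable_fun setT U) (U0 : forall x, 0 < U x).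
Hypothesis U_cell : forall N x, (wint mu U (cell N x) < +oo)%E.
Hypothesis U_A1 : forall N x, {ae mu, forall z, cell N x z ->
  (wint mu U (cell N x) <= (C * M N * U z)%:E)%E}.

(** The unions of cells of level N. *)
Definition saturated N (E : set T) := forall x y, F N x = F N y -> E x -> E y.

Lemma F_refine N j x y : F (N + j)%N x = F (N + j)%N y -> F N x = F N y.
Proof. by elim: j => [|j IH]; rewrite ?addn0// addnS => /Fh[/IH]. Qed.

Lemma saturated_le N j E : saturated N E -> saturated (N + j) E.
Proof. by move=> sE x y /F_refine; exact: sE. Qed.

Lemma saturated_cell N x : saturated N (cell N x).
Proof. by move=> y z yz; rewrite /cell/= -yz. Qed.

Let c := 1 - (2 * C)^-1.
Let K0 : 0 < K. Proof. exact: lt_le_trans K1. Qed.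
Let U0' x : 0 <= U x. Proof. exact: ltW. Qed.
Let C0 : 0 < C. Proof. exact: lt_le_trans C1. Qed.
Let c0 : 0 <= c.
Proof. rewrite subr_ge0 invf_le1 ?mulr_gt0//; move: C1; lra. Qed.

Lemma wint_fin_sub (w : T -> R) (A B : set T) : measurable_fun setT w -> (forall x, 0 <= w x) ->
  measurable A -> measurable B -> A `<=` B -> (wint mu w B < +oo)%E ->
  exists2 a : R, 0 <= a & wint mu w A = a%:E.
Proof.
move=> mw w0 mA mB AB fB; have A0 : (0 <= wint mu w A)%E by apply: wint_ge0.
have : (wint mu w A < +oo)%E by apply: le_lt_trans fB; exact: wint_subset.
case: (wint mu w A) A0 => [a|//|//]; rewrite lee_fin => a0 _; by exists a.
Qed.

(** The part of the cell outside E has at least half of the measure of the cell,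
    so by the A_1 bound it carries at least the fraction 1 / (2 C) of U. *)
Lemma cell_step N x E : measurable E -> (mu (E `&` cell N x) <= (M N / 2)%:E)%E ->
  (wint mu U (E `&` cell N x) <= c%:E * wint mu U (cell N x))%E.
Proof.
move=> mE hE; have mQ := mcell N x.
have mD : measurable (cell N x `\` E) by exact: measurableD.
have mI : measurable (cell N x `&` E) by exact: measurableI.
have [q q0 hq] := wint_fin_sub mU U0' mQ mQ (fun _ => id) (U_cell N x).
have [a a0 ha] := wint_fin_sub mU U0' mI mQ (@subIsetl _ _ _) (U_cell N x).
have [b b0 hb] := wint_fin_sub mU U0' mD mQ (@subDsetl _ _ _) (U_cell N x).
have hs := wint_splitI mu mU U0' mQ mE; rewrite hq ha hb -EFinD in hs; move: hs => [hs].
have hD : ((M N / 2)%:E <= mu (cell N x `\` E))%E.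
  rewrite measureD//=; last by rewrite mu_cell ltry.
  rewrite mu_cell setIC; move: (hE).
  have : (mu (E `&` cell N x) < +oo)%E by apply: le_lt_trans hE _; rewrite ltry.
  case: (mu (E `&` cell N x)) (measure_ge0 mu (E `&` cell N x)) => [z _ _|//|//].
  by rewrite -EFinB !lee_fin; lra.
have : ((q / (C * M N) * (M N / 2))%:E <= b%:E)%E.
  have e0 : 0 <= q / (C * M N) by rewrite divr_ge0// mulr_ge0// ltW.
  rewrite -hb EFinM; apply: le_trans (lee_wpmul2l _ hD) _; first by rewrite lee_fin.
  rewrite -(wint_cst1 _ mD) -wintZ//.
  apply: wint_aele => //; first by move=> z; rewrite mulr1.
  apply: filterS (U_A1 N x) => z hz [Qz _]; have := hz Qz.
  by rewrite hq lee_fin mulr1 ler_pdivrMr ?mulr_gt0// mulrC.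
rewrite lee_fin (_ : _ * _ = q / (2 * C)); last by field; rewrite !gt_eqF.
by rewrite setIC ha hq -EFinM lee_fin /c mulrBl mul1r [_^-1 * q]mulrC; lra.
Qed.

(** Starting from a cell of which E fills at most half, stop at the first
    cells, itself included, of which E fills at least the fraction 1 / (2 K).
    If a cell is not stopped, E fills less than half of each of its K children,
    so the hypothesis passes to them.  As E is a union of cells of level N + j, nothing
    is left after j generations.  O is the union of the stopped cells, and
    [cell_step] applies in each of them. *)
Lemma cell_stopping j N x E : measurable E -> saturated (N + j) E ->
  (mu (E `&` cell N x) <= (M N / 2)%:E)%E ->
  exists O, [/\ measurable O, saturated (N + j) O, E `&` cell N x `<=` O, O `<=` cell N x &
    (mu O <= (2 * K)%:E * mu (E `&` cell N x))%E /\
    (wint mu U (E `&` cell N x) <= c%:E * wint mu U O)%E].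
Proof.
move=> mE; elim: j N x => [|j IH] N x sE hE.
  have E0 : E `&` cell N x = set0.
    apply: contrapT => /eqP/set0P[z [Ez Qz]]; move: hE.
    rewrite (_ : E `&` cell N x = cell N x).
      by rewrite mu_cell lee_fin; have := M0 N; lra.
    apply/seteqP; split => y [] // Qy; split => //; apply: sE Ez.
    by rewrite addn0 Qz.
  exists set0; rewrite E0; split => //; split.
    by rewrite measure0 mule0.
  by rewrite /wint integral_set0 mule0.
have mI : measurable (E `&` cell N x) by exact: measurableI.
have [big|small] := leP (M N / (2 * K))%:E (mu (E `&` cell N x)).
  exists (cell N x); split => //; first by apply: saturated_le; exact: saturated_cell.
  split; last exact: cell_step.
  rewrite mu_cell; apply: le_trans (lee_wpmul2l _ big); last by rewrite lee_fin mulr_ge0// ltW.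
  by rewrite -EFinM lee_fin mulrC divfK// gt_eqF// mulr_gt0.
have : forall i, exists O, [/\ measurable O, saturated (N + j.+1) O,
    E `&` cell N x `&` [set z | h N z = i] `<=` O, O `<=` cell N x `&` [set z | h N z = i] &
    (mu O <= (2 * K)%:E * mu (E `&` cell N x `&` [set z | h N z = i]))%E /\
    (wint mu U (E `&` cell N x `&` [set z | h N z = i]) <= c%:E * wint mu U O)%E].
  move=> i; have [[y [Qy hy]]|nex] := pselect (exists y, cell N x y /\ h N y = i).
    have cE : cell N x `&` [set z | h N z = i] = cell N.+1 y.
      apply/seteqP; split => z /=.
        by move=> [Qz hz]; apply/Fh; rewrite hz hy Qz Qy.
      by move=> /Fh[Fz ->]; split => //; rewrite /cell/= Fz.
    rewrite -setIA cE -addSnnS.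
    apply: IH; first by rewrite addSnnS.
    apply: (@le_trans _ _ (mu (E `&` cell N x))).
      apply: le_measure; rewrite ?inE//; first exact: measurableI.
      by rewrite -cE; move=> z [? []].
    apply: (le_trans (ltW small)); rewrite lee_fin MK.
    by apply: le_of_eq; field; rewrite gt_eqF.
  have E0 : E `&` cell N x `&` [set z | h N z = i] = set0.
    by apply/seteqP; split => z // [[_ Qz] hz]; apply: nex; exists z.
  exists set0; rewrite E0; split => //; split.
    by rewrite measure0 mule0.
  by rewrite /wint integral_set0 mule0.
move=> /choice => -[Oc hOc].
pose OO := \bigcup_(i in [set: I]) Oc i.
have mO i : measurable (Oc i) by case: (hOc i).
have mOO : measurable OO by apply: fin_bigcup_measurable.
have OOi i : OO `&` [set z | h N z = i] = Oc i.
  apply/seteqP; split => z.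
    by move=> [[k _ Oz] <-]; case: (hOc k) => _ _ _ /(_ _ Oz)[_ ->].
  by move=> Oz; split; [exists i|case: (hOc i) => _ _ _ /(_ _ Oz)[]].
exists OO; split => //.
- move=> z y zy [i _ Oz]; exists i => //.
  by case: (hOc i) => _ sO _ _ _; exact: sO zy Oz.
- by move=> z Ez; exists (h N z) => //; case: (hOc (h N z)) => _ _ + _ _; apply.
- by move=> z [i _ Oz]; case: (hOc i) => _ _ _ /(_ _ Oz)[].
split.
  rewrite -(wint_cst1 _ mOO) -(wint_cst1 _ mI) !(wint_partition (h := h N))//.
  rewrite ge0_sume_distrr; last by move=> i _; apply: wint_ge0.
  apply: lee_sum => i _; rewrite !wint_cst1//; last 2 first.
  - exact: measurableI.
  - exact: measurableI.
  by rewrite OOi; case: (hOc i) => _ _ _ _ [].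
rewrite !(wint_partition (h := h N) (w := U))//.
rewrite ge0_sume_distrr; last by move=> i _; apply: wint_ge0.
by apply: lee_sum => i _; rewrite OOi; case: (hOc i) => _ _ _ _ [].
Qed.

(** Each use of [cell_stopping] replaces E by a set at most 2 K times as large
    and gains a factor c for U. *)
Lemma saturated_decay N x j E : measurable E -> saturated N E -> E `<=` cell 0 x ->
  (mu E <= ((2 * K) ^- j * (M 0 / 2))%:E)%E ->
  (wint mu U E <= (c ^+ j)%:E * wint mu U (cell 0 x))%E.
Proof.
move=> mE; have K20 : 0 < 2 * K by rewrite mulr_gt0.
elim: j E mE => [|j IH] E mE sE Ex hE.
  by rewrite expr0 mul1e; apply: wint_subset.
have EI : E `&` cell 0 x = E by apply/setIidl.
have M00 := M0 0%N.
have hE0 : (mu (E `&` cell 0 x) <= (M 0%N / 2)%:E)%E.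
  rewrite EI; apply: le_trans hE _; rewrite lee_fin ler_piMl ?divr_ge0 ?(ltW M00)//.
  rewrite invf_le1 ?exprn_gt0// exprn_ege1//; move: K1; lra.
have [] := @cell_stopping N 0%N x E mE _ hE0; first by rewrite add0n.
rewrite add0n EI => O' [mO sO EO Ox [muO UO]].
apply: le_trans UO _; rewrite exprS EFinM -muleA.
apply: lee_wpmul2l; first by rewrite lee_fin.
apply: IH => //; apply: le_trans muO _.
apply: le_trans (lee_wpmul2l _ hE) _; first by rewrite lee_fin ltW.
have : (2 * K) ^+ j != 0 by rewrite expf_neq0 ?gt_eqF.
rewrite -EFinM lee_fin exprS; move: ((2 * K) ^+ j) => z z0.
by apply: le_of_eq; field; rewrite z0 gt_eqF.
Qed.

Section approx.
Variables (w : T -> R) (Q : set T).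
Hypotheses (mw : measurable_fun setT w) (w0 : forall x, 0 <= w x) (mQ : measurable Q).
Hypothesis wQ : (wint mu w Q < +oo)%E.

Definition symdiff (A B : set T) := (A `\` B) `|` (B `\` A).

Lemma measurable_symdiff A B : measurable A -> measurable B -> measurable (symdiff A B).
Proof. by move=> mA mB; apply: measurableU; exact: measurableD. Qed.

(** With w = 1 + U this controls the Lebesgue measure and the measure U at the
    same time. *)
Definition approximable (E : set T) := measurable E /\ forall e : R, 0 < e ->
  exists N S, [/\ measurable S, saturated N S & (wint mu w (symdiff E S `&` Q) <= e%:E)%E].

Lemma approximable_saturated N E : measurable E -> saturated N E -> approximable E.
Proof.
move=> mE sE; split => // e e0; exists N, E; split => //.
by rewrite /symdiff setDv setU0 set0I /wint integral_set0 lee_fin ltW.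
Qed.

Lemma approximableC E : approximable E -> approximable (~` E).
Proof.
move=> [mE hE]; split; first exact: measurableC.
move=> e /hE[N [S [mS sS hS]]]; exists N, (~` S); split; first exact: measurableC.
  by move=> x y xy nS Sy; apply: nS; apply: sS Sy.
rewrite (_ : symdiff (~` E) (~` S) = symdiff E S)//.
by rewrite /symdiff !setDE !setCK setUC; congr (_ `|` _); rewrite setIC.
Qed.

Lemma approximableU A B : approximable A -> approximable B -> approximable (A `|` B).
Proof.
move=> [mA hA] [mB hB]; split; first exact: measurableU.
move=> e e0; have e2 : 0 < e / 2 by rewrite divr_gt0.
have [N1 [S1 [mS1 sS1 h1]]] := hA _ e2; have [N2 [S2 [mS2 sS2 h2]]] := hB _ e2.
exists (N1 + N2)%N, (S1 `|` S2); split; first exact: measurableU.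
  move=> x y xy [S1x|S2x]; [left|right].
    exact: (saturated_le sS1 xy S1x).
  by rewrite addnC in xy; exact: (saturated_le sS2 xy S2x).
have mI A1 A2 : measurable A1 -> measurable A2 -> measurable (symdiff A1 A2 `&` Q).
  by move=> m1 m2; apply: measurableI => //; exact: measurable_symdiff.
apply: (@le_trans _ _ (wint mu w ((symdiff A S1 `&` Q) `|` (symdiff B S2 `&` Q)))).
  apply: wint_subset => //.
  - by apply: mI; exact: measurableU.
  - by apply: measurableU; exact: mI.
  - move=> x [[[[Ax|Bx]]|[[S1x|S2x]]] /not_orP[n1 n2] Qx].
    + by left; split => //; left.
    + by right; split => //; left.
    + by left; split => //; right.
    + by right; split => //; right.
apply: le_trans (wint_setU_le _ _ _ _ _) _ => //; [exact: mI|exact: mI|].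
by rewrite [e in e%:E]splitr EFinD leeD.
Qed.

Lemma approximable_bigcup (E : (set T)^nat) : (forall k, approximable (E k)) ->
  approximable (\bigcup_k E k).
Proof.
move=> hE; have mE k : measurable (E k) by case: (hE k).
have mUE : measurable (\bigcup_k E k) by exact: bigcupT_measurable.
split => // e e0; have e2 : 0 < e / 2 by rewrite divr_gt0.
(* a finite union captures all but e / 2 of the countable one inside Q, because
   w(Q) is finite *)
pose H m := \big[setU/set0]_(k < m.+1) E k.
have aH m : approximable (H m).
  rewrite /H; elim: m.+1 => {m} [|m IH]; rewrite ?big_ord0 ?big_ord_recr/=; last exact: approximableU.
  by apply: (@approximable_saturated 0) => // x y _ [].
have mH m : measurable (H m) by case: (aH m).
have HE : \bigcup_m H m = \bigcup_k E k by rewrite bigcup_bigsetU_bigcup.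
have HQ : \bigcup_m (H m `&` Q) = (\bigcup_k E k) `&` Q by rewrite -setI_bigcupl HE.
have mIQ m : measurable (H m `&` Q) by exact: measurableI.
have mUQ : measurable ((\bigcup_k E k) `&` Q) by exact: measurableI.
have ndH : nondecreasing_seq (fun m => H m `&` Q).
  apply/nondecreasing_seqP => m; apply/subsetPset => x [Hx Qx]; split => //.
  by rewrite /H big_ord_recr/=; left.
have ndw : nondecreasing_seq (fun m => wint mu w (H m `&` Q)).
  by move=> m1 m2 m12; apply: wint_subset => //; exact/subsetPset/ndH.
have cvH : ereal_sup (range (fun m => wint mu w (H m `&` Q))) = wint mu w ((\bigcup_k E k) `&` Q).
  apply: (cvg_unique _ (ereal_nondecreasing_cvgn ndw)) => //; rewrite -HQ.
  apply: ge0_nondecreasing_set_cvg_integral => //.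
  - by move=> m; apply: measurable_funTS; exact/measurable_EFinP.
  - by move=> m x _; rewrite lee_fin.
have [a a0 ha] := wint_fin_sub mw w0 mUQ mQ (@subIsetr _ _ _) wQ.
have [m hm] : exists m, (a%:E - (e / 2)%:E <= wint mu w (H m `&` Q))%E.
  have fs : ereal_sup (range (fun m => wint mu w (H m `&` Q))) \is a fin_num by rewrite cvH ha.
  by have [_ [m _ <-] hm] := ub_ereal_sup_adherent e2 fs; exists m; rewrite -ha -cvH ltW.
have [N [S [mS sS hS]]] := (aH m).2 _ e2.
exists N, S; split => //.
have mI A1 A2 : measurable A1 -> measurable A2 -> measurable (symdiff A1 A2 `&` Q).
  by move=> m1 m2; apply: measurableI => //; exact: measurable_symdiff.
have mD : measurable (((\bigcup_k E k) `&` Q) `\` H m) by exact: measurableD.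
have hD : (wint mu w (((\bigcup_k E k) `&` Q) `\` H m) <= (e / 2)%:E)%E.
  have := wint_splitI mu mw w0 mUQ (mH m); rewrite ha.
  have -> : \bigcup_k E k `&` Q `&` H m = H m `&` Q.
    apply/seteqP; split => x; first by move=> [[_ ?] ?].
    by move=> [Hx Qx]; split => //; split => //; rewrite -HE; exists m.
  move: hm.
  have [b b0 hb] := wint_fin_sub mw w0 (mIQ m) mQ (@subIsetr _ _ _) wQ.
  have [z z0 hz] := wint_fin_sub mw w0 mD mUQ (@subDsetl _ _ _) (le_lt_trans (wint_subset mu mw w0 mUQ mQ (@subIsetr _ _ _)) wQ).
  by rewrite hb hz -EFinB -EFinD !lee_fin => h1 [h2]; lra.
apply: (@le_trans _ _ (wint mu w (((\bigcup_k E k) `&` Q) `\` H m `|` (symdiff (H m) S `&` Q)))).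
  apply: wint_subset => //; [exact: mI|by apply: measurableU => //; exact: mI|].
  move=> x [[[Ex nS]|[Sx nE]] Qx].
    have [Hx|nH] := pselect (H m x); last by left.
    by right; split => //; left.
  right; split => //; right; split => // Hx; apply: nE.
  by rewrite -HE; exists m.
apply: le_trans (wint_setU_le _ _ _ _ _) _ => //; first exact: mI.
by rewrite [e in e%:E]splitr EFinD leeD.
Qed.

End approx.

(** [saturated_decay] for the approximating union of cells; the error counts for
    the Lebesgue measure, where a factor 2 is kept in reserve, and for U, where it
    tends to 0. *)
Lemma approximable_decay x j E : approximable (fun z => 1 + U z) (cell 0 x) E ->
  E `<=` cell 0 x -> (mu E <= ((2 * K) ^- j * (M 0%N / 4))%:E)%E ->
  (wint mu U E <= (c ^+ j)%:E * wint mu U (cell 0 x))%E.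
Proof.
move=> [mE hE] Ex muE; have mQ := mcell 0 x.
have mU1 : measurable_fun setT (fun z => 1 + U z) by exact: measurable_funD.
have b0 : 0 < (2 * K) ^- j * (M 0%N / 4).
  by rewrite mulr_gt0 ?invr_gt0 ?exprn_gt0 ?mulr_gt0// divr_gt0.
apply/lee_addgt0Pr => e e0.
pose e' := Num.min e ((2 * K) ^- j * (M 0%N / 4)).
have e'0 : 0 < e' by rewrite lt_min e0.
have [N [S [mS sS hS]]] := hE _ e'0.
pose D := symdiff E S `&` cell 0 x.
have mD : measurable D by apply: measurableI => //; exact: measurable_symdiff.
pose S' := S `&` cell 0 x.
have mS' : measurable S' by exact: measurableI.
have sS' : saturated N S'.
  move=> y z yz [Sy Qy]; split; first exact: sS Sy.
  by rewrite /cell/= -(@F_refine 0 N y z)// add0n.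
have hsum : (mu D + wint mu U D <= e'%:E)%E.
  rewrite -(wint_cst1 _ mD) -wintD//.
have muD : (mu D <= e'%:E)%E by apply: le_trans hsum; rewrite leeDl// wint_ge0.
have UD : (wint mu U D <= e%:E)%E.
  apply: (@le_trans _ _ e'%:E); last by rewrite lee_fin ge_min lexx.
  by apply: le_trans hsum; rewrite leeDr.
have muS' : (mu S' <= ((2 * K) ^- j * (M 0%N / 2))%:E)%E.
  apply: (@le_trans _ _ (mu (E `|` D))).
    apply: le_measure; rewrite ?inE//; first exact: measurableU.
    move=> y [Sy Qy]; have [Ey|nE] := pselect (E y); [by left|right].
    by split => //; right.
  apply: (@le_trans _ _ (mu E + mu D)%E); first exact: measureU2.
  rewrite [leRHS](_ : _ = (((2 * K) ^- j * (M 0%N / 4))%:E + ((2 * K) ^- j * (M 0%N / 4))%:E)%E).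
    by apply: leeD => //; apply: le_trans muD _; rewrite lee_fin ge_min lexx orbT.
  by rewrite -EFinD; congr EFin; field; rewrite expf_neq0 ?gt_eqF ?mulr_gt0.
have hS' := saturated_decay mS' sS' (@subIsetr _ _ _) muS'.
apply: (@le_trans _ _ (wint mu U (S' `|` D))).
  apply: wint_subset => //; first exact: measurableU.
  move=> y Ey; have Qy := Ex _ Ey; have [Sy|nS] := pselect (S y); [by left|right].
  by split => //; left.
by apply: le_trans (wint_setU_le _ _ _ _ _) _ => //; apply: leeD.
Qed.

(** The exponent for which c is (2 K) ^ (- dyadic_exp). *)
Definition dyadic_exp : R := - ln c / ln (2 * K).

Let c1 : 0 < c < 1.
Proof.
have : 0 < (2 * C)^-1 < 1.
  by rewrite invr_gt0 mulr_gt0//= invf_lt1 ?mulr_gt0//; move: C1; lra.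
by rewrite /c; lra.
Qed.

Let K21 : 1 < 2 * K. Proof. by move: K1; lra. Qed.

Lemma dyadic_exp_gt0 : 0 < dyadic_exp.
Proof.
have /andP[c00 c11] := c1.
by rewrite divr_gt0 ?oppr_gt0 ?ln_lt0 ?ln_gt0// c00.
Qed.

Lemma dyadic_exp_pow j : c ^+ j = ((2 * K) ^- j) `^ dyadic_exp.
Proof.
have /andP[c00 c11] := c1; have K20 : 0 < 2 * K by rewrite mulr_gt0.
rewrite powRVx ?exprn_ge0 ?(ltW K20)// -powR_mulrn ?(ltW K20)// -powRrM.
rewrite -powR_mulrn ?(ltW c00)// /powR !gt_eqF//; congr expR.
by rewrite /dyadic_exp; field; rewrite gt_eqF// ln_gt0.
Qed.

(** Apply [approximable_decay] with the j for which (2 K) ^- j is comparable to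
    s; for s >= 1/4 the trivial bound suffices. *)
Lemma dyadic_Ainfty x E s : approximable (fun z => 1 + U z) (cell 0 x) E ->
  E `<=` cell 0 x -> 0 < s -> (mu E <= (s * M 0%N)%:E)%E ->
  (wint mu U E <= ((8 * K) `^ dyadic_exp * s `^ dyadic_exp)%:E * wint mu U (cell 0 x))%E.
Proof.
move=> aE Ex s0 muE; have mE := aE.1; have e0 := dyadic_exp_gt0.
have K20 : 0 < 2 * K by rewrite mulr_gt0.
have K80 : 0 <= 8 * K by rewrite mulr_ge0 ?(ltW K0)//.
rewrite -powRM ?(ltW s0)//.
have Q0 : (0 <= wint mu U (cell 0 x))%E by exact: wint_ge0.
have [s4|s4] := leP 4^-1 s.
  apply: (@le_trans _ _ (wint mu U (cell 0 x))); first exact: wint_subset.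
  rewrite -[leLHS]mul1e; apply: lee_wpmul2r => //; rewrite lee_fin.
  by apply: powR_ge1; [exact: ltW|move: K1 s4; nra].
have ej : exists j, (2 * K) ^- j / (2 * K) / 4 < s.
  have [k hk] := expr_unbounded s^-1 K21; exists k.
  apply: (@le_lt_trans _ _ ((2 * K) ^- k)).
    rewrite -mulrA ler_piMr ?invr_ge0 ?exprn_ge0 ?(ltW K20)//.
    by rewrite -invfM invf_le1 ?mulr_gt0//; move: K1; lra.
  by rewrite invf_plt ?posrE ?exprn_gt0.
case: (ex_minnP ej) => j hj hm.
have sj : s <= (2 * K) ^- j / 4.
  case: j hj hm => [|j] hj hm; first by rewrite expr0 invr1 mul1r ltW.
  rewrite leNgt; apply/negP => hs; have := hm j; rewrite ltnn => hmj.
  by apply/(notF (hmj _)); rewrite -[_ / (2 * K)]invfM -exprSr.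
have muE' : (mu E <= ((2 * K) ^- j * (M 0%N / 4))%:E)%E.
  apply: le_trans muE _; rewrite lee_fin.
  rewrite [leRHS](_ : _ = (2 * K) ^- j / 4 * M 0%N); last by ring.
  by rewrite ler_wpM2r// ltW.
apply: le_trans (approximable_decay aE Ex muE') _.
apply: lee_wpmul2r => //; rewrite lee_fin dyadic_exp_pow.
apply: ge0_ler_powR; rewrite ?nnegrE ?(ltW e0) ?invr_ge0 ?exprn_ge0 ?mulr_ge0 ?(ltW K20) ?(ltW s0) ?(ltW K0)//.
move: hj; rewrite ltr_pdivrMr// ltr_pdivrMr// => /ltW/le_trans; apply.
by apply: le_of_eq; ring.
Qed.

End dyadic.

(** * The sup distance under Lebesgue measure *)

Section concrete.
Context (R : realType) (n : nat).
Local Notation T := (lebesgue_rV_type R n).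
Local Notation mu := (@lebesgue_rV R n).

Definition ldist (x y : T) : R := supdist x y.

Lemma measurable_ldist : measurable_fun setT (fun z : T * T => ldist z.1 z.2).
Proof.
apply: measurable_supdist.
  exact: (measurableT_comp (@measurable_idb R n) measurable_fst).
exact: (measurableT_comp (@measurable_idb R n) measurable_snd).
Qed.

Lemma lebesgue_ball (y : T) (r : R) : 0 < r ->
  mu (sball ldist y r) = ((2 * r) ^+ n)%:E.
Proof.
move=> r0; rewrite /sball /ldist (cubeball _ (ltW r0)) lebesgue_cube// mulr_gt0//.
Qed.

Lemma supdist_triangle (x y z : 'rV[R]_n) : supdist x z <= supdist x y + supdist y z.
Proof.
apply/supdist_leP; first by rewrite addr_ge0// supdist_ge0.
move=> i; rewrite -(subrKA (y ord0 i)); apply: le_trans (ler_normD _ _) _.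
by apply: lerD; [have /(supdist_leP _ _ (supdist_ge0 x y)) := lexx (supdist x y)|have /(supdist_leP _ _ (supdist_ge0 y z)) := lexx (supdist y z)]; exact.
Qed.

(** Countably many balls suffice: y lies in a ball with rational centre and
    rational radius less than 2 r that contains the ball of centre y and radius r. *)
Lemma A1_center_of_A1 (w : T -> R) : measurable_fun setT w -> (forall x, 0 < w x) ->
  A1_ball n mu ldist w -> A1_center n mu ldist w.
Proof.
move=> mw w0 [C C0 hC]; exists (C * 2 ^+ n); first by rewrite mulr_gt0// exprn_gt0.
have mb := measurable_sball measurable_ldist.
pose ctr (c : 'rV[rat]_n) : T := \row_i ratr (c ord0 i).
have : {ae mu, forall x (k : nat), if @unpickle ('rV[rat]_n * rat)%type k is Some (c, rho)
   then 0 < rho -> sball ldist (ctr c) (ratr rho) x ->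
     (wint mu w (sball ldist (ctr c) (ratr rho)) <= (C * ratr rho ^+ n * w x)%:E)%E else True}.
  apply: ae_foralln => k; case: unpickle => [[c rho]|]; last exact: nearW.
  have [rho0|rho0] := ltP 0 rho; last by apply: nearW => x.
  have r0 : 0 < ratr rho :> R by rewrite ltr0q.
  by apply: filterS (hC (ctr c) _ r0) => x hx _ /hx.
apply: filterS => y hy r r0.
have rc : exists rho : rat, 3 * r / 2 < ratr rho < 2 * r.
  have [|q hq] := @rat_in_itvoo R (3 * r / 2) (2 * r); first by lra.
  by exists q; move: hq; rewrite in_itv.
have [rho /andP[rho1 rho2]] := rc.
have hc i : exists c : rat, (y : 'rV[R]_n) ord0 i - r / 2 < ratr c < (y : 'rV[R]_n) ord0 i + r / 2.
  have [|q hq] := @rat_in_itvoo R ((y : 'rV[R]_n) ord0 i - r / 2) ((y : 'rV[R]_n) ord0 i + r / 2); first by lra.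
  by exists q; move: hq; rewrite in_itv.
have [c hcc] := choice hc.
have := hy (pickle ((\row_i c i : 'rV[rat]_n), rho)); rewrite pickleK.
have rho0 : 0 < rho by rewrite -(ltr0q R); lra.
set y' := ctr _ => /(_ rho0) h.
have dy : supdist (y : 'rV[R]_n) y' <= r / 2.
  apply/supdist_leP; first by rewrite divr_ge0// ltW.
  move=> i; rewrite !mxE; have := hcc i; rewrite ler_norml; lra.
have hb : sball ldist y' (ratr rho) y.
  by rewrite /sball/= /ldist; apply: le_trans dy _; lra.
apply: le_trans (_ : (wint mu w (sball ldist y r) <= _)%E) (le_trans (h hb) _).
  apply: wint_subset; [exact: mw|by move=> x; exact: ltW|exact: mb|exact: mb|].
  move=> x; rewrite /sball/= /ldist => hx; apply: le_trans (supdist_triangle x y y') _.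
  lra.
rewrite lee_fin ler_wpM2r ?(ltW (w0 _))// -mulrA ler_wpM2l ?(ltW C0)// -exprMn.
by rewrite lerXn2r ?nnegrE//; lra.
Qed.

End concrete.

(** * Dyadic grids *)

(** The boolean is the next binary digit of a: it tells in which half of the
    dyadic interval of a the number lies. *)
Lemma floor_double (R : realType) (a : R) :
  Num.floor (2 * a) = (2 * Num.floor a + (Num.floor (2 * a) == 2 * Num.floor a + 1)%:Z)%R.
Proof.
have h1 := floor_itv a; have h2 := floor_itv (2 * a).
set k := Num.floor a in h1 *; set m := Num.floor (2 * a) in h2 *.
have k1 : (2 * k <= m)%R.
  rewrite -ltzD1 -(ltr_int R) intrD intrM; move: h1 h2; rewrite intrD; lra.
have k2 : (m < 2 * k + 2)%R.
  rewrite -(ltr_int R) intrD intrM; move: h1 h2; rewrite intrD; lra.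
case: eqP => [->//|/eqP ne] /=; rewrite ?addr0//.
apply/eqP; rewrite eq_le k1 andbT -ltzD1 lt_neqAle ne/=.
by rewrite -ltzD1 -addrA.
Qed.

Section dyadic_grid.
Context (R : realType) (n : nat) (a : 'rV[R]_n) (l : R).
Hypothesis l0 : 0 < l.
Local Notation T := (lebesgue_rV_type R n).
Local Notation mu := (@lebesgue_rV R n).

Definition grid_coord (x : 'rV[R]_n) (i : 'I_n) : R := (x ord0 i - a ord0 i) / l.
Definition grid N (x : T) : 'rV[int]_n := \row_i Num.floor (2 ^+ N * grid_coord x i).
Definition grid_child N (x : T) : {ffun 'I_n -> bool} :=
  [ffun i => Num.floor (2 ^+ N.+1 * grid_coord x i) ==
             2 * Num.floor (2 ^+ N * grid_coord x i) + 1].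

Lemma grid_step N x y : grid N.+1 x = grid N.+1 y <->
  grid N x = grid N y /\ grid_child N x = grid_child N y.
Proof.
have E z i : Num.floor (2 ^+ N.+1 * grid_coord z i) =
    2 * Num.floor (2 ^+ N * grid_coord z i) + (grid_child N z i)%:Z.
  by rewrite ffunE exprS -mulrA -floor_double.
split=> [h|[h1 h2]]; last first.
  apply/rowP => i; rewrite !mxE !E h2; congr (2 * _ + _).
  by have /rowP/(_ i) := h1; rewrite !mxE.
have hi i : Num.floor (2 ^+ N * grid_coord x i) = Num.floor (2 ^+ N * grid_coord y i) /\
    grid_child N x i = grid_child N y i.
  have /rowP/(_ i) := h; rewrite !mxE !E.
  case: (grid_child N x i) (grid_child N y i) => [] [] /=; lia.
split; first by apply/rowP => i; rewrite !mxE (hi i).1.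
by apply/ffunP => i; rewrite (hi i).2.
Qed.

Lemma grid_cell_box N (x : T) : cell grid N x =
  box (fun i => `[a ord0 i + l / 2 ^+ N * (Num.floor (2 ^+ N * grid_coord x i))%:~R,
                  a ord0 i + l / 2 ^+ N * (Num.floor (2 ^+ N * grid_coord x i) + 1)%:~R[%classic).
Proof.
have p0 : 0 < 2 ^+ N :> R by rewrite exprn_gt0.
have key (s k : R) i : (a ord0 i + l / 2 ^+ N * k <= s) = (k <= 2 ^+ N * ((s - a ord0 i) / l)).
  by rewrite -lerBrDl -ler_pdivlMl ?divr_gt0// invf_div -mulrA [l^-1 * _]mulrC.
have key2 (s k : R) i : (s < a ord0 i + l / 2 ^+ N * k) = (2 ^+ N * ((s - a ord0 i) / l) < k).
  by rewrite !ltNge key.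
apply/seteqP; split => z; rewrite /cell /box /=.
  move=> /rowP h i; have := h i; rewrite !mxE in_itv/= key key2 => <-.
  exact: floor_itv.
move=> h; apply/rowP => i; have := h i; rewrite !mxE in_itv/= key key2 => h1.
exact: floor_def.
Qed.

Lemma measurable_grid_cell N (x : T) : measurable (cell grid N x).
Proof. by rewrite grid_cell_box; apply: measurable_box => i; exact: measurable_itv. Qed.

Lemma lebesgue_grid_cell N (x : T) : mu (cell grid N x) = ((l / 2 ^+ N) ^+ n)%:E.
Proof.
have p0 : 0 < l / 2 ^+ N :> R by rewrite divr_gt0// exprn_gt0.
rewrite grid_cell_box lebesgue_box => [|i]; last exact: measurable_itv.
rewrite -prod_cst_EFin; apply: eq_bigr => i _.
rewrite lebesgue_measure_itv/= lte_fin ltrD2l ltr_pM2l// ltr_int ltrDl ltr01.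
rewrite -EFinB; congr EFin; rewrite intrD; move: (l / _) (_%:~R) (a _ _) => u v w.
by ring.
Qed.

Lemma grid_cell_ball N (x : T) : exists c : T,
  cell grid N x `<=` sball (@ldist R n) c (l / 2 ^+ N / 2).
Proof.
have p0 : 0 < l / 2 ^+ N :> R by rewrite divr_gt0// exprn_gt0.
exists (\row_i (a ord0 i + l / 2 ^+ N * ((Num.floor (2 ^+ N * grid_coord x i))%:~R + 2^-1))).
rewrite grid_cell_box => z hz; rewrite /sball/= /ldist.
apply/supdist_leP; first by rewrite ltW// divr_gt0.
move=> i; have := hz i; rewrite mxE /= in_itv/= intrD.
move: (l / _) (_%:~R) (a _ _) ((z : 'rV[R]_n) _ _) => u v w s.
by rewrite ler_norml; lra.
Qed.

Lemma measurable_grid_coord (i : 'I_n) : measurable_fun setT (fun x : T => grid_coord x i).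
Proof.
apply: measurable_funM; last exact: measurable_cst.
apply: measurable_funB; last exact: measurable_cst.
exact: measurable_coord_leb.
Qed.

Definition grid_floor N (i : 'I_n) (x : T) : R := (Num.floor (2 ^+ N * grid_coord x i))%:~R.

Lemma measurable_grid_floor N i : measurable_fun setT (grid_floor N i).
Proof.
have mf : measurable_fun [set: R] (fun s : R => (Num.floor s)%:~R : R).
  apply: nondecreasing_measurable => // s t st.
  by rewrite ler_int; exact: le_floor.
apply: (measurableT_comp mf).
by apply: measurable_funM; [exact: measurable_cst|exact: measurable_grid_coord].
Qed.

Lemma measurable_grid_child N (e : {ffun 'I_n -> bool}) :
  measurable [set x : T | grid_child N x = e].
Proof.
rewrite (_ : [set x : T | _] = \bigcap_(i in [set: 'I_n])
   [set x | (grid_floor N.+1 i x == 2 * grid_floor N i x + 1) = e i]).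
  apply: fin_bigcap_measurable => // i _.
  have mb : measurable_fun setT (fun x => grid_floor N.+1 i x == 2 * grid_floor N i x + 1).
    apply: measurable_fun_eqr; first exact: measurable_grid_floor.
    apply: measurable_funD; last exact: measurable_cst.
    by apply: measurable_funM; [exact: measurable_cst|exact: measurable_grid_floor].
  rewrite -[X in measurable X]setTI.
  exact: (mb measurableT [set e i]).
have E x i : (grid_floor N.+1 i x == 2 * grid_floor N i x + 1) = grid_child N x i.
  by rewrite ffunE /grid_floor -[2]/(2%:~R) -intrM -[1]/(1%:~R) -intrD eqr_int.
apply/seteqP; split => x /=.
  by move=> h i _; rewrite /= E h.
by move=> h; apply/ffunP => i; rewrite -E; exact: h.
Qed.

End dyadic_grid.

(** * Approximation by unions of dyadic cells *)

Section borel_hull.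
Context (R : realType) (n : nat).
Local Notation T := (lebesgue_rV_type R n).
Local Notation mu := (@lebesgue_rV R n).

(** Lebesgue measurable sets are defined by an outer measure, that is, by covers
    with Borel sets. *)
Lemma borel_hull (E : set T) : measurable E -> (mu E < +oo)%E ->
  exists B : set (borel_rV R n), [/\ measurable B, E `<=` B & mu ((B : set T) `\` E) = 0%E].
Proof.
move=> mE Eoo.
have Efin : mu E \is a fin_num by rewrite ge0_fin_numE.
have coverE (k : nat) : exists G : set (borel_rV R n), [/\ measurable G, E `<=` G &
    (mu G <= mu E + (k.+1%:R^-1)%:E)%E].
  have s0 : (0 < k.+1%:R^-1 :> R) by rewrite invr_gt0.
  have [_ /= [A EA <-] hA] := lb_ereal_inf_adherent s0 Efin.
  have mA i : measurable (A i) by exact: (cover_measurable EA).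
  have mUA : measurable (\bigcup_i A i) by exact: bigcupT_measurable.
  exists (\bigcup_i A i); split; [exact: mUA|exact: (cover_subset EA)|].
  apply: (le_trans _ (ltW hA)); rewrite (lebesgue_rVE mUA).
  by apply: measure_sigma_subadditive => //.
have [G hG] := choice coverE.
have mG k : measurable (G k) by case: (hG k).
pose B := \bigcap_k G k.
have mB : measurable B by exact: bigcapT_measurable.
have EB : E `<=` B by move=> x Ex k _; case: (hG k) => _ + _; apply.
exists B; split => //.
have mB' : measurable (B : set T) by exact: borel_measurable_rV.
have BE : (mu B <= mu E)%E.
  apply/lee_addgt0Pr => e e0.
  have [k hk] : exists k : nat, k.+1%:R^-1 <= e :> R.
    exists (Num.truncn e^-1); rewrite -[e]invrK lef_pV2 ?posrE ?invr_gt0//.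
    by apply/ltW; rewrite invrK truncnS_gt.
  have [_ _ hk2] := hG k.
  apply: (@le_trans _ _ (mu (G k))).
    apply: le_measure; rewrite ?inE; [exact: mB'|exact: borel_measurable_rV|].
    exact: bigcap_inf.
  by apply: (le_trans hk2); apply: leeD2l; rewrite lee_fin.
have BoE : (mu B < +oo)%E by exact: le_lt_trans BE Eoo.
rewrite measureD/=; [|exact: mB'|exact: mE|exact: BoE].
rewrite (_ : B `&` E = E); last exact/setIidr.
have -> : mu B = mu E.
  apply/eqP; rewrite eq_le BE/=; apply: le_measure; rewrite ?inE; [exact: mE|exact: mB'|exact: EB].
exact: subee.
Qed.

End borel_hull.

Section grid_approx.
Context (R : realType) (n : nat) (a : 'rV[R]_n) (l : R).
Hypothesis l0 : 0 < l.
Local Notation T := (lebesgue_rV_type R n).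
Local Notation mu := (@lebesgue_rV R n).
Variables (w : T -> R) (Q : set T).
Hypotheses (mw : measurable_fun setT w) (w0 : forall x, 0 <= w x) (mQ : measurable Q).
Hypothesis wQ : (wint mu w Q < +oo)%E.
Local Notation appr := (approximable mu (grid a l) w Q).

Lemma appr_bigcup (E : (set T)^nat) : (forall k, appr (E k)) -> appr (\bigcup_k E k).
Proof. exact: (approximable_bigcup (grid_step a l0) mw w0 mQ wQ). Qed.

(** An open half space is the union, over all levels, of the cells that it
    contains. *)
Lemma appr_halfspace (i : 'I_n) (s : R) : appr [set x : T | ((x : 'rV[R]_n) ord0 i < s)%R].
Proof.
pose S N : set T := [set x | grid_floor a l N i x + 1 <= 2 ^+ N * ((s - a ord0 i) / l)].
rewrite (_ : [set x : T | _] = \bigcup_N S N).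
  apply: appr_bigcup => N; apply: (@approximable_saturated _ _ _ _ _ _ _ _ N).
    apply: measurable_le_set; last exact: measurable_cst.
    by apply: measurable_funD; [exact: measurable_grid_floor|exact: measurable_cst].
  move=> x y /rowP/(_ i); rewrite !mxE => h.
  by rewrite /S/= /grid_floor h.
have p0 N : 0 < 2 ^+ N :> R by rewrite exprn_gt0.
apply/seteqP; split => x /=; last first.
  move=> [N _]; rewrite /S/= /grid_floor => h.
  have := floorD1_gt (2 ^+ N * grid_coord a l x i); rewrite intrD => /lt_le_trans/(_ h).
  by rewrite ltr_pM2l// /grid_coord ltr_pM2r ?invr_gt0// ltrD2r.
move=> xs; have d0 : 0 < (s - (x : 'rV[R]_n) ord0 i) / l by rewrite divr_gt0// subr_gt0.
have [N hN] := @expr_unbounded R 2 ((s - (x : 'rV[R]_n) ord0 i) / l)^-1 (ltr1n _ 2).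
exists N => //; rewrite /S/= /grid_floor.
have h1 := floor_le (2 ^+ N * grid_coord a l x i).
have h2 : 1 <= 2 ^+ N * ((s - (x : 'rV[R]_n) ord0 i) / l).
  by rewrite -ler_pdivrMr// div1r ltW.
rewrite (_ : (s - a ord0 i) / l = grid_coord a l x i + (s - (x : 'rV[R]_n) ord0 i) / l).
  by rewrite mulrDr lerD.
by rewrite /grid_coord -mulrDl; congr (_ / _); ring.
Qed.

Lemma appr_sigma : sigma_algebra setT appr.
Proof.
split.
- by apply: (@approximable_saturated _ _ _ _ _ _ _ _ 0) => [|x y _ []]; exact: measurable0.
- by move=> A hA; rewrite setTD; exact: approximableC.
- exact: appr_bigcup.
Qed.

(** Approximable sets form a sigma-algebra, and the half spaces generate the
    Borel sets. *)
Lemma appr_borel (E : set (borel_rV R n)) : measurable E -> appr E.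
Proof.
apply: smallest_sub; first exact: appr_sigma.
move=> _ [i [A [mA ->]]].
pose H := [set A : set R | appr [set x : T | A ((x : 'rV[R]_n) ord0 i)]].
have sH : sigma_algebra setT H.
  have [h1 h2 h3] := appr_sigma; split.
  - exact: h1.
  - move=> A' hA'; have := h2 _ hA'; rewrite setTD => h; rewrite /H/=.
    rewrite (_ : [set x : T | _] = ~` [set x : T | A' ((x : 'rV[R]_n) ord0 i)]); first exact: h.
    by apply/seteqP; split => x /= => [[]|nA].
  - move=> F hF; rewrite /H/=; have := h3 _ hF; congr appr.
have sub : @RGenInftyO.G R `<=` H.
  move=> _ [s ->]; rewrite /H/=.
  rewrite (_ : [set x : T | _] = [set x : T | ((x : 'rV[R]_n) ord0 i < s)%R]); first exact: appr_halfspace.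
  by apply/seteqP; split => x /=; rewrite in_itv.
have mA' : (@RGenInftyO.G R).-sigma.-measurable A by rewrite -RGenInftyO.measurableE.
exact: (smallest_sub sH sub mA').
Qed.

Lemma appr_lebesgue (E : set T) : measurable E -> (mu E < +oo)%E -> appr E.
Proof.
move=> mE Eoo; have [B [mB EB B0]] := borel_hull mE Eoo.
have [mB' hB] := appr_borel mB; split; first exact: mE.
move=> e e0; have [N [S [mS sS hS]]] := hB e e0.
exists N, S; split; [exact: mS|exact: sS|].
have mD : measurable ((B : set T) `\` E) by exact: measurableD.
have mI (F : set T) : measurable F -> measurable (symdiff F S `&` Q).
  by move=> mF; apply: measurableI; [exact: measurable_symdiff|exact: mQ].
apply: (@le_trans _ _ (wint mu w ((symdiff B S `&` Q) `|` ((B : set T) `\` E)))).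
  apply: wint_subset; [exact: mw|exact: w0|exact: mI|by apply: measurableU; [exact: mI|exact: mD]|].
  move=> x [[[Ex nS]|[Sx nE]] Qx].
    by left; split => //; left; split => //; exact: EB.
  have [Bx|nB] := pselect (B x); first by right.
  by left; split => //; right.
apply: le_trans (wint_setU_le mu mw w0 (mI _ mB') mD) _.
rewrite [X in (_ + X)%E](_ : _ = 0%E) ?adde0; first exact: hS.
apply: (wint_ae0 mD mw w0); exists ((B : set T) `\` E); split; [exact: mD|exact: B0|].
by move=> x /= /contrapT.
Qed.

End grid_approx.

(** * The A_infinity inequality for A_1 weights *)

Section Ainfty_instance.
Context (R : realType) (n : nat).
Local Notation T := (lebesgue_rV_type R n).
Local Notation mu := (@lebesgue_rV R n).
Local Notation dist := (@ldist R n).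

(** The ball of centre y and radius r lies in the cell of level 0 of the grid with
    origin y - 2 r and side 4 r, which lies in the ball of radius 2 r; apply
    [dyadic_Ainfty] in this cell and return to the ball by doubling. *)
Lemma Ainfty_ball_of_A1 (U : T -> R) : pos_weight mu dist U -> A1_ball n mu dist U -> Ainfty_ball n mu dist U.
Proof.
move=> pU aU; have [mU U0 fU] := pU; have [C C0 hC] := aU.
have [CD CD0 hD] := A1_ball_doubling (@measurable_ldist R n) (@lebesgue_ball R n) pU aU.
pose K : R := 2 ^+ n; pose C' := C + 1.
have K1 : 1 <= K by rewrite exprn_ege1// ler1n.
have C'1 : 1 <= C' by rewrite /C' lerDr ltW.
pose e := dyadic_exp K C'.
have e0 : 0 < e by exact: dyadic_exp_gt0.
have K80 : 0 < 8 * K by rewrite mulr_gt0// (lt_le_trans _ K1).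
exists ((8 * K) `^ e * (4 ^- n) `^ e * CD).
  by rewrite !mulr_gt0// powR_gt0// invr_gt0 exprn_gt0.
exists e => // y r s E r0 s0 mE Ey muE.
pose a : 'rV[R]_n := (y : 'rV[R]_n) - const_mx (2 * r); pose l := 4 * r.
have l0 : 0 < l by rewrite mulr_gt0.
have mb z q : measurable (sball dist z q) by exact: (measurable_sball (@measurable_ldist R n)).
have mc := @measurable_grid_cell R n a l l0.
pose M N : R := (l / 2 ^+ N) ^+ n.
have lN N : 0 < l / 2 ^+ N by rewrite divr_gt0// exprn_gt0.
have M0 N : 0 < M N by rewrite exprn_gt0.
have U0' x : 0 <= U x by exact: ltW.
have U_cell N x : (wint mu U (cell (grid a l) N x) < +oo)%E.
  have [c hc] := grid_cell_ball a l0 N x.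
  apply: (@le_lt_trans _ _ (wint mu U (sball dist c (l / 2 ^+ N / 2)))).
    by apply: wint_subset; [exact: mU|exact: U0'|exact: mc|exact: mb|exact: hc].
  by apply: fU; rewrite divr_gt0.
have U_A1 N x : {ae mu, forall z, cell (grid a l) N x z ->
    (wint mu U (cell (grid a l) N x) <= (C' * M N * U z)%:E)%E}.
  have [c hc] := grid_cell_ball a l0 N x.
  have q0 : 0 < l / 2 ^+ N / 2 by rewrite divr_gt0.
  apply: filterS (hC c _ q0) => z hz cz.
  apply: (@le_trans _ _ (wint mu U (sball dist c (l / 2 ^+ N / 2)))).
    by apply: wint_subset; [exact: mU|exact: U0'|exact: mc|exact: mb|exact: hc].
  apply: (le_trans (hz (hc _ cz))); rewrite lee_fin ler_wpM2r// /C' /M.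
  apply: ler_pM; rewrite ?exprn_ge0 ?(ltW C0) ?(ltW q0) ?lerDl//.
  rewrite lerXn2r ?nnegrE ?(ltW q0) ?(ltW (lN N))//.
  by rewrite ler_pdivrMr// ler_peMr ?(ltW (lN N))// ler1n.
have E0 : E `<=` cell (grid a l) 0 y.
  move=> z /Ey; rewrite /sball/= /ldist => /(supdist_leP _ _ (ltW r0)) hz.
  have fl (x : R) : 0 <= x < 1 -> Num.floor x = 0 by move=> h; apply: floor_def; rewrite add0r.
  apply/rowP => i; rewrite !mxE /grid_coord /a /l !mxE expr0 !mul1r.
  rewrite !fl//.
    rewrite opprB addrCA subrr addr0 divr_ge0 ?mulr_ge0 ?(ltW r0)//=.
    by rewrite ltr_pdivrMr ?mulr_gt0// mul1r ltr_pM2r// ltr_nat.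
  have := hz i; rewrite ler_norml => /andP[h1 h2].
  move: ((z : 'rV[R]_n) ord0 i) ((y : 'rV[R]_n) ord0 i) h1 h2 => zi yi h1 h2.
  rewrite divr_ge0 ?mulr_ge0 ?(ltW r0)//=; last by move: r0; clear -h1; lra.
  by rewrite ltr_pdivrMr ?mulr_gt0// mul1r; move: r0; clear -h2; lra.
have Eball : cell (grid a l) 0 y `<=` sball dist y (2 * r).
  rewrite (@grid_cell_box R n a l l0) => z hz; rewrite /sball/= /ldist.
  have fl (x : R) : 0 <= x < 1 -> Num.floor x = 0 by move=> h; apply: floor_def; rewrite add0r.
  apply/supdist_leP; first by rewrite mulr_ge0// ltW.
  move=> i; have := hz i; rewrite /= in_itv/= /grid_coord /a /l !mxE expr0 mul1r divr1.
  rewrite opprB addrCA subrr addr0 fl; last first.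
    rewrite divr_ge0 ?mulr_ge0 ?(ltW r0)//=.
    by rewrite ltr_pdivrMr ?mulr_gt0// mul1r ltr_pM2r// ltr_nat.
  rewrite add0r mulr0 mulr1 addr0 ler_norml.
  move: ((z : 'rV[R]_n) ord0 i) ((y : 'rV[R]_n) ord0 i) => zi yi /andP[h1 h2].
  by apply/andP; split; move: r0; clear -h1 h2; lra.
have MK N : M N = K * M N.+1.
  have : 2 ^+ N != 0 :> R by rewrite expf_neq0.
  rewrite /M /K -exprMn exprS; move: (2 ^+ N : R) => z z0; congr (_ ^+ n).
  by field; rewrite z0.
have mU1 : measurable_fun setT (fun z => 1 + U z).
  by apply: measurable_funD; [exact: measurable_cst|exact: mU].
have U10 z : 0 <= 1 + U z by rewrite addr_ge0.
have muEoo : (mu E < +oo)%E by apply: le_lt_trans muE _; rewrite ltry.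
have wQ : (wint mu (fun z => 1 + U z)%R (cell (grid a l) 0 y) < +oo)%E.
  rewrite wintD; [|exact: mc|exact: measurable_cst|exact: mU|by []|exact: U0'].
  rewrite wint_cst1; last exact: mc.
  have h0 : (mu (cell (grid a l) 0 y) < +oo)%E by rewrite (lebesgue_grid_cell a l0) ltry.
  exact: lte_add_pinfty h0 (U_cell _ _).
have aE := appr_lebesgue a l0 mU1 U10 (mc 0%N y) wQ mE muEoo.
have s'0 : 0 < s * 4 ^- n by rewrite mulr_gt0// invr_gt0 exprn_gt0.
have muE' : (mu E <= (s * 4 ^- n * M 0%N)%:E)%E.
  have h4 : (4 : R) ^+ n != 0 by rewrite expf_neq0.
  by apply: (le_trans muE); rewrite lee_fin /M expr0 divr1 /l exprMn -mulrA (mulKf h4).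
have := dyadic_Ainfty (grid_step a l0) (@measurable_grid_child R n a l) mc M0 K1 C'1 MK
  (lebesgue_grid_cell a l0) mU U0 U_cell U_A1 aE E0 s'0 muE'.
rewrite -/e => /le_trans; apply.
apply: (@le_trans _ _ (((8 * K) `^ e * (s * 4 ^- n) `^ e)%:E * (CD%:E * wint mu U (sball dist y r)))%E).
  apply: lee_wpmul2l; first by rewrite lee_fin mulr_ge0 ?powR_ge0.
  apply: le_trans (hD y r r0).
  by apply: wint_subset; [exact: mU|exact: U0'|exact: mc|exact: mb|exact: Eball].
rewrite muleA -EFinM; apply: lee_wpmul2r; first by apply: wint_ge0 => x _; exact: U0'.
have h4 : 0 <= (4 : R) ^- n by rewrite invr_ge0 exprn_ge0.
rewrite lee_fin (powRM e (ltW s0) h4).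
by apply: le_of_eq; ring.
Qed.

End Ainfty_instance.

(** * Constant weights and powers of A_1 weights *)

Section weights_more.
Context (R : realType) (n : nat) d (T : measurableType d).
Variable mu : {measure set T -> \bar R}.
Variable dist : T -> T -> R.
Hypothesis mdist : measurable_fun setT (fun z : T * T => dist z.1 z.2).
Hypothesis mu_ball : forall y r, 0 < r -> mu (sball dist y r) = ((2 * r) ^+ n)%:E.
Local Notation ball := (sball dist).

Lemma ae_exists (P : T -> Prop) (A : set T) : measurable A -> (0 < mu A)%E ->
  {ae mu, forall x, A x -> P x} -> exists2 x, A x & P x.
Proof.
move=> mA A0 [N [mN N0 AN]]; apply: contrapT => nex; move: A0.
rewrite (_ : mu A = 0%E) ?ltxx//; apply/eqP; rewrite eq_le measure_ge0 andbT -N0.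
apply: le_measure; rewrite ?inE// => x Ax; apply: AN => /= h.
by apply: nex; exists x => //; exact: h.
Qed.

Lemma pos_weight_cst1 : pos_weight mu dist (fun=> 1).
Proof.
split => // y r r0; rewrite wint_cst1; last exact: measurable_sball.
by rewrite mu_ball// ltry.
Qed.

Lemma A1_ball_cst1 : A1_ball n mu dist (fun=> 1).
Proof.
exists (2 ^+ n); first by rewrite exprn_gt0.
move=> y r r0; apply: nearW => x _; rewrite wint_cst1; last exact: measurable_sball.
by rewrite mu_ball// mulr1 -exprMn.
Qed.

(** For every l > 0, w ^ s is at most l ^ s + (l ^ s / l) w.  Taking for l the
    average of w replaces Jensen's inequality, up to a constant. *)
Lemma A1_ball_powR w s : 0 < s <= 1 -> pos_weight mu dist w -> A1_ball n mu dist w ->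
  pos_weight mu dist (fun x => w x `^ s) /\ A1_ball n mu dist (fun x => w x `^ s).
Proof.
move=> /andP[s0 s1] pw [C C0 hC]; have [mw w0 _] := pw.
have mws : measurable_fun setT (fun x => w x `^ s) by exact: measurable_funpow.
have ws0 x : 0 <= w x `^ s by exact: powR_ge0.
have key y r : 0 < r -> exists2 l, 0 < l & wint mu w (ball y r) = (l * r ^+ n)%:E /\
    (wint mu (fun x => w x `^ s)%R (ball y r) <= (l `^ s * (2 ^+ n + 1) * r ^+ n)%:E)%E.
  move=> r0; have [a a0 ha] := wint_ball_fin mdist mu_ball y pw r0.
  have rn0 : 0 < r ^+ n by rewrite exprn_gt0.
  have [l l0 al] : exists2 l : R, 0 < l & a = l * r ^+ n.
    by exists (a / r ^+ n); rewrite ?divr_gt0// divfK// gt_eqF.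
  exists l => //; split; first by rewrite ha al.
  have mb : measurable (ball y r) by exact: measurable_sball.
  apply: (@le_trans _ _ (wint mu (fun x => l `^ s * 1 + l `^ s / l * w x)%R (ball y r))).
    apply: le_wint => //.
      by apply: measurable_funD => //; exact: measurable_funM.
    move=> x _; rewrite ws0/= mulr1.
    have [wl|lw] := leP (w x) l.
      apply: (@le_trans _ _ (l `^ s)).
        by apply: ge0_ler_powR; rewrite ?nnegrE ?(ltW s0) ?(ltW (w0 _)) ?(ltW l0).
      by rewrite lerDl !mulr_ge0 ?powR_ge0 ?invr_ge0 ?(ltW l0) ?(ltW (w0 _)).
    have wl : w x = l * (w x / l) by rewrite mulrCA mulfV ?mulr1// gt_eqF.
    rewrite [in leLHS]wl powRM ?(ltW l0) ?divr_ge0 ?(ltW l0) ?(ltW (w0 _))//.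
    apply: (@le_trans _ _ (l `^ s * (w x / l))).
      rewrite ler_wpM2l ?powR_ge0//; apply: ler1_powR => //.
      by rewrite ler_pdivlMr// mul1r ltW.
    by rewrite mulrCA mulrC -mulrA lerDr powR_ge0.
  pose f1 (x : T) := l `^ s * 1; pose f2 (x : T) := l `^ s / l * w x.
  have mf2 : measurable_fun setT f2 by exact: measurable_funM.
  have f10 x : 0 <= f1 x by rewrite /f1 mulr1 powR_ge0.
  have f20 x : 0 <= f2 x by rewrite !mulr_ge0 ?powR_ge0 ?invr_ge0 ?(ltW l0) ?(ltW (w0 _)).
  rewrite (wintD mu mb (measurable_cst _ : measurable_fun setT f1) mf2 f10 f20).
  rewrite !wintZ ?powR_ge0//; last 2 first.
  - by move=> x; exact: ltW.
  - by rewrite divr_ge0 ?powR_ge0// ltW.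
  rewrite wint_cst1// mu_ball// ha -!EFinM -EFinD lee_fin exprMn.
  by rewrite al; apply: le_of_eq; field; rewrite gt_eqF.
split.
  split => //; first by move=> x; exact: powR_gt0.
  by move=> y r r0; have [l l0 [_ h]] := key y r r0; apply: le_lt_trans h _; rewrite ltry.
exists (C `^ s * (2 ^+ n + 1)).
  by rewrite mulr_gt0 ?powR_gt0// addr_gt0// exprn_gt0.
move=> y r r0; have [l l0 [hl h]] := key y r r0.
apply: filterS (hC y r r0) => x hx bx; have := hx bx; rewrite hl lee_fin => hlx.
have rn0 : 0 < r ^+ n by rewrite exprn_gt0.
have lC : l <= C * w x.
  by rewrite -(ler_pM2r rn0) (le_trans hlx)// mulrAC.
apply: le_trans h _; rewrite lee_fin.
rewrite [leRHS](_ : _ = C `^ s * w x `^ s * (2 ^+ n + 1) * r ^+ n); last by ring.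
rewrite !ler_wpM2r ?(ltW rn0) ?addr_ge0 ?exprn_ge0// -powRM ?(ltW C0) ?(ltW (w0 _))//.
by apply: ge0_ler_powR; rewrite ?nnegrE ?(ltW s0) ?(ltW l0) ?mulr_ge0 ?(ltW C0) ?(ltW (w0 _)).
Qed.

End weights_more.

(** * Iterated commutators of integral operators *)

Section commutators.
Context (R : realType) d (T : measurableType d).
Variable mu : {sigma_finite_measure set T -> \bar R}.
Variables (k : T -> T -> R) (b : T -> R).
Hypothesis mk : measurable_fun setT (fun z : T * T => k z.1 z.2).
Hypothesis mb : measurable_fun setT b.

Definition kernel_integral (f : T -> R) (x : T) : R := \int[mu]_y (f y * k x y).
Definition kernel_commutator (m : nat) : (T -> R) -> T -> R :=
  iter m (fun S f x => b x * S f x - S (fun y => b y * f y) x) kernel_integral.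

(** The positive and the negative part are measurable by Tonelli's theorem, whether
    or not the integral converges. *)
Lemma measurable_kernel_integral f : measurable_fun setT f ->
  measurable_fun setT (kernel_integral f).
Proof.
move=> mf; rewrite /kernel_integral /Rintegral.
pose F (z : T * T) := (f z.2 * k z.1 z.2)%:E.
have mF : measurable_fun setT F.
  apply/measurable_EFinP; apply: measurable_funM => //.
  exact: (measurableT_comp mf measurable_snd).
have mFp := measurable_fun_fubini_tonelli_F (m2 := mu) _ (measurable_funepos mF) (funepos_ge0 F).
have mFn := measurable_fun_fubini_tonelli_F (m2 := mu) _ (measurable_funeneg mF) (funeneg_ge0 F).
apply: (measurableT_comp (@fine_measurable R setT measurableT)).
under eq_fun do rewrite integralE.
apply: emeasurable_funB.
- rewrite (_ : (fun x : T => _) = fubini_F mu F^\+%E); first exact: mFp.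
  by apply/funext => x; apply: eq_integral => y _; rewrite !funeposE.
- rewrite (_ : (fun x : T => _) = fubini_F mu F^\-%E); first exact: mFn.
  by apply/funext => x; apply: eq_integral => y _; rewrite !funenegE.
Qed.

Lemma measurable_kernel_commutator m f : measurable_fun setT f ->
  measurable_fun setT (kernel_commutator m f).
Proof.
elim: m f => [|m IH] f mf; first exact: measurable_kernel_integral.
apply: measurable_funB; last by apply: IH; exact: measurable_funM.
by apply: measurable_funM => //; exact: IH.
Qed.

Lemma integrable_mul_bounded (f c : T -> R) (M : R) : mu.-integrable setT (EFin \o f) ->
  measurable_fun setT c -> (forall y, f y != 0 -> `|c y| <= M) ->
  mu.-integrable setT (EFin \o (fun y => c y * f y)).
Proof.
move=> intf mc cM.
have mf : measurable_fun setT f by apply/measurable_EFinP; case/integrableP: intf.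
have := integrableZl measurableT M intf.
apply: le_integrable => //; first by apply/measurable_EFinP; exact: measurable_funM.
move=> y _ /=; rewrite lee_fin !normrM.
have [->|fy] := eqVneq (f y) 0; first by rewrite normr0 !mulr0.
by rewrite ler_wpM2r// (le_trans (cM y fy))// ler_norm.
Qed.

(** By induction on m, [b x * S f x - S (b f) x] being a difference of convergent
    integrals. *)
Lemma kernel_commutatorE m (f : T -> R) x (M : R) : measurable_fun setT f ->
  mu.-integrable setT (EFin \o (fun y => f y * k x y)) ->
  (forall y, f y != 0 -> `|b y| <= M) ->
  mu.-integrable setT (EFin \o (fun y => (b x - b y) ^+ m * (f y * k x y))) /\
  kernel_commutator m f x = \int[mu]_y ((b x - b y) ^+ m * (f y * k x y)).
Proof.
move=> mf intf hb.
have INT m' (g : T -> R) : measurable_fun setT g -> mu.-integrable setT (EFin \o (fun y => g y * k x y)) ->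
   (forall y, g y != 0 -> `|b y| <= M) ->
   mu.-integrable setT (EFin \o (fun y => (b x - b y) ^+ m' * (g y * k x y))).
  move=> mg intg hg; apply: (@integrable_mul_bounded _ _ ((`|b x| + M) ^+ m')) => //.
    by apply: measurable_funX; exact: measurable_funB.
  move=> y; rewrite mulf_eq0 negb_or => /andP[gy _].
  rewrite normrX lerXn2r ?nnegrE ?addr_ge0//; first by rewrite (le_trans _ (hg y gy)).
  by apply: le_trans (ler_normB _ _) _; rewrite lerD2l hg.
split; first exact: INT.
elim: m f mf intf hb => [|m IH] f mf intf hb.
  by apply: eq_Rintegral => y _; rewrite expr0 mul1r.
have mbf : measurable_fun setT (fun y => b y * f y) by exact: measurable_funM.
have intbf : mu.-integrable setT (EFin \o (fun y => b y * f y * k x y)).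
  have := @integrable_mul_bounded (fun y => f y * k x y) b M intf mb.
  rewrite (_ : (fun y => b y * f y * k x y) = (fun y => b y * (f y * k x y))).
    by apply => y; rewrite mulf_eq0 negb_or => /andP[fy _]; exact: hb.
  by apply/funext => y; rewrite mulrA.
have hbf y : b y * f y != 0 -> `|b y| <= M.
  by rewrite mulf_eq0 negb_or => /andP[_]; exact: hb.
rewrite /kernel_commutator iterS -/(kernel_commutator m) IH// IH//.
rewrite -RintegralZl//; last exact: INT.
rewrite -RintegralB//; last 2 first.
- have := integrableZl measurableT (b x) (INT m f mf intf hb).
  by apply: eq_integrable => // y _; rewrite /= EFinM.
- exact: INT.
by apply: eq_Rintegral => y _; rewrite exprSr; ring.
Qed.

Lemma kernel_commutator_le m (f : T -> R) x (M : R) (G : T -> R) : measurable_fun setT f ->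
  measurable_fun setT G -> (forall y, 0 <= G y) ->
  mu.-integrable setT (EFin \o (fun y => f y * k x y)) ->
  (forall y, f y != 0 -> `|b y| <= M) ->
  {ae mu, forall y, `|(b x - b y) ^+ m * (f y * k x y)| <= G y} ->
  (`|kernel_commutator m f x|%:E <= wint mu G setT)%E.
Proof.
move=> mf mG G0 intf hb hG.
have [int1 ->] := kernel_commutatorE m mf intf hb.
have m1 : measurable_fun setT (fun y => (b x - b y) ^+ m * (f y * k x y)).
  by apply/measurable_EFinP; case/integrableP: int1.
rewrite EFin_normr_Rintegral//.
have mn : measurable_fun setT (fun y => `|(b x - b y) ^+ m * (f y * k x y)|).
  exact: measurableT_comp.
apply: le_trans (le_abse_integral mu measurableT _) _; first exact/measurable_EFinP.
apply: ae_ge0_le_integral => //.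
- exact/measurable_EFinP.
- by move=> y _; rewrite lee_fin G0.
- exact/measurable_EFinP.
- by apply: filterS hG => y hy _; rewrite lee_fin.
Qed.

End commutators.

(** * Finiteness of fractional integrals *)

Section potential_ae.
Context (R : realType) (n : nat) d (T : measurableType d).
Variable mu : {sigma_finite_measure set T -> \bar R}.
Variable dist : T -> T -> R.
Hypothesis mdist : measurable_fun setT (fun z : T * T => dist z.1 z.2).
Hypothesis dist_ge0 : forall x y, 0 <= dist x y.
Hypothesis distC : forall x y, dist x y = dist y x.
Hypothesis dist_tri : forall x y z, dist x z <= dist x y + dist y z.
Hypothesis n0 : (0 < n)%N.
Hypothesis P11 : testing n mu dist (fun=> 1) (fun=> 1).
Local Notation vd := (vdist n dist).

(** The integral of the potential over a ball is, by Tonelli's theorem, the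
    integral of f against the integral over that ball of a power of the distance,
    which is a testing integral for constant weights. *)
Lemma potential_ae_fin (f : T -> R) (o : T) (M th : R) : measurable_fun setT f ->
  (forall x, 0 <= f x) -> (wint mu f setT < +oo)%E -> 0 < th < 1 ->
  (forall y, f y != 0 -> dist y o <= M) ->
  {ae mu, forall x, (wint mu (fun y => f y * vd y x `^ (- (1 - th)))%R setT < +oo)%E}.
Proof.
move=> mf f0 foo /andP[th0 th1] fM.
pose G (z : T * T) := f z.2 * vd z.2 z.1 `^ (- (1 - th)).
have mvd2 : measurable_fun setT (fun z : T * T => vd z.2 z.1).
  by apply: measurable_funX; under eq_fun do rewrite distC; exact: mdist.
have mG : measurable_fun setT G.
  apply: measurable_funM; last exact: measurable_funpow.
  exact: (measurableT_comp mf measurable_snd).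
have G0 z : 0 <= G z by rewrite mulr_ge0 ?powR_ge0.
have mGe : measurable_fun setT (fun z => (G z)%:E) by exact/measurable_EFinP.
have G0e z : (0 <= (G z)%:E)%E by rewrite lee_fin.
have vd0 x y : 0 <= vd x y by exact: vdist_ge0.
pose I x := wint mu (fun y => G (x, y)) setT.
have mI : measurable_fun setT I.
  exact: (measurable_fun_fubini_tonelli_F (m2 := mu) (fun z => (G z)%:E) mGe G0e).
have I0 x : (0 <= I x)%E by apply: wint_ge0.
have mb y r : measurable (sball dist y r) by exact: measurable_sball.
have [C C0 hC] := P11 th0 ltr01.
have key (N : nat) : (\int[mu]_(x in sball dist o N%:R) I x < +oo)%E.
  pose B := sball dist o N%:R.
  pose r := `|M| + N%:R + 1; have r0 : 0 < r by rewrite /r ltr_wpDl ?addr_ge0.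
  pose t := r ^+ n; have t0 : 0 < t by rewrite exprn_gt0.
  have -> : (\int[mu]_(x in B) I x = \int[mu]_x \int[mu]_y (\1_B x * G (x, y))%:E)%E.
    rewrite integral_mkcond; apply: eq_integral => x _; rewrite patchE indicE.
    case: ifP => _; first by apply: eq_integral => y _; rewrite mul1r.
    by under eq_integral do rewrite mul0r; rewrite integral0.
  pose H (z : T * T) := \1_B z.1 * G z.
  have mH : measurable_fun setT (fun z => (H z)%:E).
    apply/measurable_EFinP; apply: measurable_funM => //.
    have mB : measurable_fun setT (\1_B : T -> R) by apply: measurable_indic; exact: mb.
    exact: (measurableT_comp mB measurable_fst).
  have H0 z : (0 <= (H z)%:E)%E by rewrite lee_fin mulr_ge0.
  have -> : (\int[mu]_x \int[mu]_y (\1_B x * G (x, y))%:E = \int[mu]_y \int[mu]_x (H (x, y))%:E)%E.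
    exact: (fubini_tonelli (fun z => (H z)%:E) mH H0).
  apply: (@le_lt_trans _ _ (wint mu (fun y => t `^ th * C * f y) setT)); last first.
    rewrite wintZ//; last by rewrite mulr_ge0 ?powR_ge0// ltW.
    by apply: lte_mul_pinfty => //; rewrite lee_fin mulr_ge0 ?powR_ge0// ltW.
  apply: ae_ge0_le_integral => //.
  - by move=> y _; apply: integral_ge0.
  - exact: (measurable_fun_fubini_tonelli_G (m1 := mu) (fun z => (H z)%:E) mH H0).
  - by move=> y _; rewrite lee_fin !mulr_ge0 ?powR_ge0// ltW.
  - by apply/measurable_EFinP; exact: measurable_funM.
  apply: filterS hC => y hy _; have := hy t t0.
  set P := (fun x => psi th 1 _ * _ * _)%R => hP.
  have mP : measurable_fun setT P by exact: measurable_ringF.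
  have P0 x : 0 <= P x by rewrite !mulr_ge0 ?psi_ge0 ?invr_ge0 ?vd0.
  have w0 : 0 <= t `^ th * f y by rewrite mulr_ge0 ?powR_ge0.
  apply: (@le_trans _ _ (wint mu (fun x => t `^ th * f y * P x)%R setT)); last first.
    rewrite wintZ//; apply: le_trans (lee_wpmul2l _ hP) _; first by rewrite lee_fin.
    by rewrite -EFinM lee_fin mulr1 mulrAC.
  apply: le_wint => //.
  - by apply/measurable_EFinP; exact: (measurableT_comp mH (pair2_measurable y)).
  - exact: measurable_funM.
  move=> x _; rewrite mulr_ge0 ?G0//=; have [Bx|nB] := pselect (B x); last first.
    by rewrite /H/= indicE memNset// mul0r mulr_ge0.
  rewrite /H/= indicE mem_set// mul1r /G/=.
  have [->|fy] := eqVneq (f y) 0; first by rewrite mulr0 !mul0r.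
  rewrite -mulrA mulrCA ler_wpM2l// /P /psi !mul1r !mulr1.
  rewrite (_ : vd x y = vd y x); last by rewrite /vdist distC.
  have Dt : vd y x < t.
    rewrite /vdist /t ltrXn2r ?nnegrE ?(ltW r0) ?n0// ?gtn_eqF//.
    apply: le_lt_trans (dist_tri y o x) _; rewrite (distC o x).
    have := fM y fy; have := ler_norm M; move: Bx; rewrite /B /sball/= /r.
    by move: (dist x o) (dist y o) (`|M|) => a b c; lra.
  rewrite ltr_pdivrMr// mul1r Dt.
  have := vd0 y x; rewrite le_eqVlt => /predU1P[<-|D0].
    by rewrite powR0 ?oppr_eq0 ?subr_eq0 ?gt_eqF// invr0 !mulr0.
  rewrite powRM ?invr_ge0 ?(ltW t0)// powRVx ?(ltW t0)// opprB powR_pos_sum//.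
  rewrite powR_inv1 ?(ltW D0)// powRN.
  have tt : t `^ th != 0 by rewrite gt_eqF// powR_gt0.
  by apply: le_of_eq; field; rewrite tt gt_eqF.
have : {ae mu, forall x (N : nat), sball dist o N%:R x -> (I x < +oo)%E}.
  apply: ae_foralln => N.
  have intI : mu.-integrable (sball dist o N%:R) I.
    apply/integrableP; split; first exact: measurable_funTS.
    by under eq_integral do rewrite gee0_abs//; exact: key.
  apply: filterS (integrable_ae (mb _ _) intI) => x hx /hx.
  by rewrite ge0_fin_numE.
apply: filterS => x hx; apply: (hx (Num.truncn (dist x o)).+1).
by rewrite /sball/= ltW// truncnS_gt.
Qed.

End potential_ae.

(** * Weak type bound for commutators *)

Lemma wint_ae_subset (R : realType) d (T : measurableType d) (mu : {measure set T -> \bar R})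
    (w : T -> R) (A B : set T) :
  measurable A -> measurable B -> measurable_fun setT w -> (forall x, 0 <= w x) ->
  {ae mu, forall x, A x -> B x} -> (wint mu w A <= wint mu w B)%E.
Proof.
move=> mA mB mw w0 AB; have mAB : measurable (A `\` B) by exact: measurableD.
rewrite -[leRHS]adde0 -(@wint_ae0 _ _ _ mu _ _ mAB mw w0); last first.
  by apply: filterS AB => x hx [/hx].
apply: le_trans (wint_setU_le mu mw w0 mB mAB); apply: wint_subset => //.
  exact: measurableU.
by move=> x Ax; have [Bx|nB] := pselect (B x); [left|right].
Qed.

Section commutator_weak_type.
Context (R : realType) (n : nat) d (T : measurableType d).
Variable mu : {sigma_finite_measure set T -> \bar R}.
Variable dist : T -> T -> R.
Hypothesis mdist : measurable_fun setT (fun z : T * T => dist z.1 z.2).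
Hypothesis dist_ge0 : forall x y, 0 <= dist x y.
Hypothesis distC : forall x y, dist x y = dist y x.
Variables (U V S : T -> R) (p q : R).
Hypotheses (mU : measurable_fun setT U) (mV : measurable_fun setT V)
  (mS : measurable_fun setT S).
Hypotheses (U0 : forall x, 0 < U x) (V0 : forall x, 0 < V x) (S0 : forall x, 0 < S x).
Hypotheses (p1 : 1 <= p) (pq : p < q).
Hypothesis PUS : 1 < p -> testing n mu dist U S.
Hypothesis PVU : testing n mu dist V U.
Local Notation vd := (vdist n dist).
Variables (k : T -> T -> R) (b : T -> R).
Hypothesis mk : measurable_fun setT (fun z : T * T => k z.1 z.2).
Hypothesis mb : measurable_fun setT b.
Variables (m : nat) (L : R).
Hypothesis L0 : 0 <= L.
Hypothesis bk_le : forall x y,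
  `|(b x - b y) ^+ m * k x y| <= L * vd y x `^ (- (q^-1 + (1 - p^-1))).

(** [weak_type] is applied to the points of the level set where the commutator is
    bounded by the fractional integral; the others form a null set.  Its bound B
    has to be positive and finite, so the norm 0 is reached by letting B tend to
    0. *)
Theorem commutator_weak_type : exists2 C : R, 0 < C & forall (f v : T -> R) (M t : R),
  measurable_fun setT f -> measurable_fun setT v -> (forall x, 0 < v x) ->
  (forall x, v x = V x `^ q^-1 * S x `^ (1 - p^-1)) -> 0 < t ->
  (forall y, f y != 0 -> `|b y| <= M) ->
  {ae mu, forall x, mu.-integrable setT (EFin \o (fun y => f y * v y * k x y))} ->
  ((wint mu (fun x => U x * V x)%R
     [set x | (t < `|kernel_commutator mu k b m (fun y => f y * v y) x| / v x)%R]) `^ q^-1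
   <= (C / t * L)%:E *
      (wint mu (fun y => (`|f y| * v y) `^ p * U y `^ (p / q) * S y `^ (1 - p))%R setT) `^ p^-1)%E.
Proof.
have [C0 C00 hC0] := weak_type mdist dist_ge0 distC mU mV mS U0 V0 S0 p1 pq PUS PVU.
have p0 : 0 < p by rewrite (lt_le_trans _ p1).
have q0 : 0 < q by rewrite (lt_trans _ pq).
have qi0 : 0 < q^-1 by rewrite invr_gt0.
have pi0 : 0 < p^-1 by rewrite invr_gt0.
exists (C0 `^ q^-1); first exact: powR_gt0.
move=> f v M t mf mv v0 vE t0 hb hint.
pose h y := f y * v y.
have mh : measurable_fun setT h by exact: measurable_funM.
pose K x := kernel_commutator mu k b m h x.
have mK : measurable_fun setT K by exact: measurable_kernel_commutator.
pose g y := `|f y| * v y.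
have mg : measurable_fun setT g.
  by apply: measurable_funM => //; exact: measurableT_comp.
have g0 y : 0 <= g y by rewrite mulr_ge0// ltW.
pose e := - (q^-1 + (1 - p^-1)).
pose I x := wint mu (fun y => g y * vd y x `^ e) setT.
have mI : measurable_fun setT I.
  pose G (z : T * T) := (g z.2 * vd z.2 z.1 `^ e)%:E.
  have mvd2 : measurable_fun setT (fun z : T * T => vd z.2 z.1).
    by apply: measurable_funX; under eq_fun do rewrite distC; exact: mdist.
  have mG : measurable_fun setT G.
    apply/measurable_EFinP; apply: measurable_funM; last exact: measurable_funpow.
    exact: (measurableT_comp mg measurable_snd).
  have G0 z : (0 <= G z)%E by rewrite lee_fin mulr_ge0 ?powR_ge0.
  exact: (measurable_fun_fubini_tonelli_F (m2 := mu) G mG G0).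
have KI : {ae mu, forall x, (`|K x|%:E <= L%:E * I x)%E}.
  apply: filterS hint => x intx.
  have mGx : measurable_fun setT (fun y => L * (g y * vd y x `^ e)).
    apply: measurable_funM => //; apply: measurable_funM => //.
    by apply: measurable_funpow; exact: measurable_vdistl.
  have Gx0 y : 0 <= g y * vd y x `^ e by rewrite mulr_ge0 ?powR_ge0.
  have := @kernel_commutator_le _ _ _ mu k b mb m h x M _ mh mGx.
  rewrite /I -wintZ//; last first.
    apply: measurable_funM => //.
    by apply: measurable_funpow; exact: measurable_vdistl.
  apply => //.
  - by move=> y; rewrite mulr_ge0.
  - by move=> y; rewrite /h mulf_eq0 negb_or => /andP[fy _]; exact: hb.
  - apply: nearW => y; rewrite mulrCA normrM /h normrM (gtr0_norm (v0 y)) -/(g y).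
    by rewrite [leRHS]mulrCA ler_wpM2l.
set E := [set x | _].
have EE : E = [set x | t * v x < `|K x|].
  by apply/funext => x; rewrite /E/= ltr_pdivlMr.
have mE : measurable E.
  rewrite EE; apply: measurable_lt_set; first exact: measurable_funM.
  exact: measurableT_comp.
pose D := [set x | (`|K x|%:E <= L%:E * I x)%E].
have mD : measurable D.
  rewrite -[D]setTI; apply: emeasurable_fun_le => //.
    by apply/measurable_EFinP; exact: measurableT_comp.
  exact: measurable_funeM.
pose B0 := wint mu (fun y => g y `^ p * U y `^ (p / q) * S y `^ (1 - p))%R setT.
rewrite -/B0.
have B00 : (0 <= B0)%E by apply: wint_ge0 => y _; rewrite !mulr_ge0 ?powR_ge0.
pose w x := U x * V x.
have mw : measurable_fun setT w by exact: measurable_funM.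
have w0 x : 0 <= w x by rewrite mulr_ge0// ltW.
have R0 : (0 <= (C0 `^ q^-1 / t * L)%:E * B0 `^ p^-1)%E.
  by rewrite mule_ge0 ?poweR_ge0// lee_fin !mulr_ge0 ?powR_ge0 ?invr_ge0// ltW.
have wED : (wint mu w E <= wint mu w (E `&` D))%E.
  have mED : measurable (E `&` D) by exact: measurableI.
  by apply: (wint_ae_subset mE mED mw w0); apply: filterS KI => x Dx Ex; split.
have [L00|Ln0] := eqVneq L 0.
  rewrite (_ : wint mu w E = 0%E) ?poweR0r ?gt_eqF//.
  apply/eqP; rewrite eq_le wint_ge0// andbT; apply: le_trans wED _.
  rewrite (_ : E `&` D = set0) ?/wint ?integral_set0//.
  rewrite -subset0 EE => x [/= tK]; rewrite /D/= L00 mul0e lee_fin leNgt.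
  by rewrite (lt_trans _ tK)// mulr_gt0.
have Lp : 0 < L by rewrite lt0r Ln0.
have tL : 0 < t / L by rewrite divr_gt0.
have main B : 0 < B -> (B0 <= B%:E)%E -> (wint mu w E <= (C0 * (t / L) `^ (- q) * B `^ (q / p))%:E)%E.
  move=> Bp hB; apply: le_trans wED _.
  have mED : measurable (E `&` D) by exact: measurableI.
  apply: (hC0 g B (t / L) (E `&` D) mg g0 Bp tL mED hB) => x [Ex Dx].
  rewrite -/e -/(I x) -mulrA -vE.
  have : ((t * v x)%:E < L%:E * I x)%E.
    by apply: lt_le_trans Dx; rewrite lte_fin; move: Ex; rewrite EE; exact.
  rewrite -(lte_pdivrMl _ _ Lp) => hI; apply: le_lt_trans hI.
  by rewrite -EFinM lee_fin mulrA [L^-1 * t]mulrC.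
have [B0y|B0f] := eqVneq B0 +oo%E.
  rewrite B0y poweRyr ?gt_eqF// gt0_muley ?leey// lte_fin.
  by rewrite !mulr_gt0 ?invr_gt0 ?powR_gt0.
have B0fin : B0 \is a fin_num by rewrite ge0_fin_numE// lt_neqAle B0f leey.
have wE0 : (0 <= wint mu w E)%E by exact: wint_ge0.
have fin_pow (A B : R) : 0 <= A -> 0 < B -> (wint mu w E <= (A * B `^ (q / p))%:E)%E ->
   ((wint mu w E) `^ q^-1 <= (A `^ q^-1 * B `^ p^-1)%:E)%E.
  move=> A0 Bp hw; have := le_poweR (ltW qi0) wE0 hw.
  rewrite poweR_EFin powRM ?powR_ge0//.
  by rewrite -powRrM mulrAC mulfV ?mul1r// gt_eqF.
move: B00; rewrite -(fineK B0fin) lee_fin le_eqVlt => /predU1P[b0|b0]; last first.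
  have := main (fine B0) b0; rewrite fineK// lexx => /(_ isT) hB.
  have := fin_pow _ _ _ b0 hB => h1.
  have -> : (B0 `^ p^-1 = (fine B0 `^ p^-1)%:E)%E by rewrite -poweR_EFin fineK.
  rewrite -EFinM.
  apply: le_trans (h1 _) _; first by rewrite mulr_ge0 ?powR_ge0// ltW.
  rewrite lee_fin ler_wpM2r ?powR_ge0// (powRM q^-1 (ltW C00) (powR_ge0 _ _)) -powRrM.
  rewrite mulNr mulfV ?gt_eqF// powR_inv1 ?(ltW tL)// invf_div.
  by apply: le_of_eq; ring.
rewrite (_ : wint mu w E = 0%E) ?poweR0r ?gt_eqF//.
  by rewrite fineK.
have B0E : B0 = 0%E by rewrite -(fineK B0fin) -b0.
have := main 1 ltr01; rewrite B0E lee_fin ler01 => /(_ isT) h1.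
have wEf : wint mu w E \is a fin_num by rewrite ge0_fin_numE// (le_lt_trans h1)// ltry.
apply/eqP; rewrite eq_le wE0 andbT -(fineK wEf) lee_fin leNgt; apply/negP => ep.
have [A A0 hA] : exists2 A, 0 < A & forall B, 0 < B -> fine (wint mu w E) <= A * B `^ (q / p).
  exists (C0 * (t / L) `^ (- q)); first by rewrite mulr_gt0 ?powR_gt0.
  by move=> B Bp; rewrite -lee_fin fineK// main// B0E lee_fin ltW.
have := hA (((fine (wint mu w E)) / (2 * A)) `^ (p / q)).
rewrite powR_gt0 ?divr_gt0 ?mulr_gt0// => /(_ isT).
rewrite -powRrM mulrA divfK ?gt_eqF// mulfV ?gt_eqF// powRr1; last first.
  by rewrite divr_ge0 ?mulr_ge0// ltW.
move: (fine _) ep => z ep; have -> : A * (z / (2 * A)) = z / 2.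
  by field; rewrite gt_eqF.
by move: ep; lra.
Qed.

End commutator_weak_type.

(** * Weights given by averages over cubes *)

Section Ainfty_ineq.
Context (R : realType).
Implicit Types (u w s C : R) (W X : \bar R).

(** Both averages are positive and their product is bounded, so neither is
    infinite and the inequality can be solved for X. *)
Lemma Ar_ineq u s C W X : 0 < u -> 0 < s -> 0 < C -> (0 < W)%E -> (0 < X)%E ->
  (u%:E^-1 * W * (u%:E^-1 * X) `^ s^-1 <= C%:E)%E ->
  (W < +oo)%E /\ (X <= (u * (C * u / fine W) `^ s)%:E)%E.
Proof.
move=> u0 s0 C0 W0 X0; rewrite inver gt_eqF// => h.
have si0 : 0 < s^-1 by rewrite invr_gt0.
have ui : (0 < (u^-1)%:E)%E by rewrite lte_fin invr_gt0.
have Wf : (W < +oo)%E.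
  rewrite ltey; apply/eqP => Wy; move: h; rewrite Wy gt0_muley// gt0_mulye.
    by rewrite leye_eq.
  by apply: poweR_gt0; rewrite mule_gt0.
split => //; have [w ww] : exists w, W = w%:E.
  by exists (fine W); rewrite fineK// gt0_fin_numE.
move: h W0; rewrite ww lte_fin /= => h w0.
have Xf : (X < +oo)%E.
  rewrite ltey; apply/eqP => Xy; move: h; rewrite Xy gt0_muley// poweRyr ?gt_eqF//.
  by rewrite gt0_muley ?leye_eq// -EFinM lte_fin mulr_gt0 ?invr_gt0.
have [x xx] : exists x, X = x%:E.
  by exists (fine X); rewrite fineK// gt0_fin_numE.
move: h X0; rewrite xx lte_fin => h x0.
rewrite lee_fin; move: h; rewrite -!EFinM lee_fin => h.
rewrite -ler_pdivrMl//.
have ux : 0 <= u^-1 * x by rewrite mulr_ge0 ?invr_ge0// ltW.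
rewrite -[leLHS](powRr1 ux) -(mulVf (lt0r_neq0 s0)) powRrM.
apply: ge0_ler_powR; rewrite ?nnegrE ?powR_ge0 ?(ltW s0)//.
  by rewrite divr_ge0 ?mulr_ge0// ltW.
have uw : 0 < u^-1 * w by rewrite mulr_gt0// invr_gt0.
rewrite -(ler_pM2l uw) (le_trans h)//; apply: le_of_eq.
by field; rewrite !gt_eqF.
Qed.

(** The A_1 bound makes 1 / V at most C u / W almost everywhere on Q; this is
    the inequality of [Ar_ball] with s = 1. *)
Lemma A1_ineq d (T : measurableType d) (mu : {measure set T -> \bar R}) (U V : T -> R)
    (Q : set T) (C u : R) :
  measurable Q -> (0 < mu Q)%E -> measurable_fun setT U -> measurable_fun setT V ->
  (forall x, 0 < U x) -> (forall x, 0 < V x) -> 0 < C -> wint mu U Q = u%:E ->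
  {ae mu, forall x, Q x ->
    ((u%:E)^-1 * wint mu (fun x => V x * U x)%R Q <= C%:E * (V x)%:E)%E} ->
  (wint mu (fun x => V x * U x)%R Q < +oo)%E /\
  (wint mu (fun x => V x `^ (- 1) * U x)%R Q <=
    (u * (C * u / fine (wint mu (fun x => V x * U x)%R Q)) `^ 1)%:E)%E.
Proof.
move=> mQ Q0 mU mV U0 V0 C0 hu; set W := wint mu _ Q => h.
have u0 : 0 < u by rewrite -lte_fin -hu; exact: wint_gt0.
have mVU : measurable_fun setT (fun x => V x * U x) by exact: measurable_funM.
have W0 : (0 < W)%E by apply: wint_gt0 => // x; rewrite mulr_gt0.
move: h; rewrite inver gt_eqF// => h.
have Wf : (W < +oo)%E.
  have [x _ hx] := ae_exists mQ Q0 h.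
  rewrite ltey; apply/eqP => Wy; by move: hx; rewrite Wy gt0_muley ?lte_fin ?invr_gt0//.
split => //; have [w ww] : exists w, W = w%:E.
  by exists (fine W); rewrite fineK// gt0_fin_numE.
move: h W0; rewrite ww lte_fin /= => h w0.
have cw : 0 <= C * u / w by rewrite divr_ge0 ?mulr_ge0// ltW.
rewrite powRr1//.
apply: (@le_trans _ _ (wint mu (fun x => C * u / w * U x) Q)).
  apply: wint_aele => //.
  - by apply: measurable_funM => //; exact: measurable_funpow.
  - exact: measurable_funM.
  - by move=> x; rewrite mulr_ge0 ?powR_ge0// ltW.
  - by move=> x; rewrite mulr_ge0// ltW.
  apply: filterS h => x hx Qx; have := hx Qx; rewrite -!EFinM lee_fin => {}hx.
  rewrite ler_wpM2r ?(ltW (U0 _))// powR_inv1 ?(ltW (V0 _))//.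
  rewrite -[leLHS]mul1r ler_pdivrMr// mulrAC ler_pdivlMr// mul1r.
  by move: hx; rewrite ler_pdivrMl// mulrCA mulrA.
rewrite wintZ ?hu//; last by move=> x; exact: ltW.
by rewrite -EFinM lee_fin mulrC.
Qed.

End Ainfty_ineq.

Section weight_conversion.
Context (R : realType) (n : nat).
Local Notation T := (lebesgue_rV_type R n).
Local Notation mu := (@lebesgue_rV R n).
Local Notation ball := (sball (@ldist R n)).

Lemma ball_cube (y : T) (r : R) : 0 < r -> is_cube (ball y r : set 'rV[R]_n).
Proof.
move=> r0; exists ((y : 'rV[R]_n) - const_mx r), (2 * r); split; first by rewrite mulr_gt0.
by rewrite -cubeball ?(ltW r0).
Qed.

Lemma weighted_wint (f g : T -> R) (A : set T) : measurable A ->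
  measurable_fun setT f -> measurable_fun setT g ->
  {ae mu, forall x, f x = g x} -> weighted (f : 'rV[R]_n -> R) A = wint mu g A.
Proof.
move=> mA mf mg fg; apply: ae_eq_integral; first exact: mA.
- by apply: measurable_funTS; apply/measurable_EFinP; exact: mf.
- by apply: measurable_funTS; apply/measurable_EFinP; exact: mg.
- by apply: filterS fg => x -> _.
Qed.

Lemma ess_inf_on_ae (f g : T -> R) (A : set T) :
  {ae mu, forall x, f x = g x} ->
  {ae mu, forall x, A x -> (ess_inf_on A (f : 'rV[R]_n -> R) <= (g x)%:E)%E}.
Proof.
move=> fg; have := @ess_inf_le _ _ _ mu (patch (cst +oo%E) A (EFin \o f)).
apply: filterS2 fg => x fgx; rewrite /patch => h Ax; move: h.
by rewrite mem_set//= fgx.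
Qed.

Lemma A1_ball_of_A1 (f g : T -> R) : measurable_fun setT f -> measurable_fun setT g ->
  (forall x, 0 < g x) -> {ae mu, forall x, f x = g x} -> A1 (f : 'rV[R]_n -> R) ->
  pos_weight mu (@ldist R n) g /\ A1_ball n mu (@ldist R n) g.
Proof.
move=> mf mg g0 fg [C C0 hC].
have mb y r : measurable (ball y r) by apply: measurable_sball; exact: measurable_ldist.
have key y r : 0 < r -> {ae mu, forall x, ball y r x ->
    (wint mu g (ball y r) <= (C * 2 ^+ n * r ^+ n * g x)%:E)%E}.
  move=> r0; have := hC _ (ball_cube y r0).
  rewrite (weighted_wint (mb y r) mf mg fg) lebesgue_ball// => h.
  have l0 : 0 < (2 * r) ^+ n by rewrite exprn_gt0// mulr_gt0.
  apply: filterS (ess_inf_on_ae (ball y r) fg) => x hx bx.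
  have := le_trans h (lee_wpmul2l _ (hx bx)); rewrite lee_fin (ltW C0) => /(_ isT).
  rewrite inver gt_eqF// lee_pdivrMl// => {}h; apply: le_trans h _.
  by rewrite -!EFinM lee_fin exprMn; apply: le_of_eq; ring.
split; last by exists (C * 2 ^+ n); rewrite ?mulr_gt0 ?exprn_gt0.
split => // y r r0.
have b0 : (0 < mu (ball y r))%E by rewrite lebesgue_ball// lte_fin exprn_gt0// mulr_gt0.
by have [x _ hx] := ae_exists (mb y r) b0 (key y r r0); apply: le_lt_trans hx _; rewrite ltry.
Qed.

Lemma Ar_ball_of_Ainfty (f g U V : T -> R) : measurable_fun setT f -> measurable_fun setT g ->
  {ae mu, forall x, f x = U x} -> {ae mu, forall x, g x = V x} ->
  pos_weight mu (@ldist R n) U -> measurable_fun setT V -> (forall x, 0 < V x) ->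
  Ainfty_mu (f : 'rV[R]_n -> R) (g : 'rV[R]_n -> R) -> Ar_ball mu (@ldist R n) U V.
Proof.
move=> mf mg fU gV pU mV V0; have [mU U0 _] := pU.
have mb y r : measurable (ball y r) by apply: measurable_sball; exact: measurable_ldist.
have b0 y r : 0 < r -> (0 < mu (ball y r))%E.
  by move=> r0; rewrite lebesgue_ball// lte_fin exprn_gt0// mulr_gt0.
have Ub y r (r0 : 0 < r) := wint_ball_fin (@measurable_ldist R n) (@lebesgue_ball R n) y pU r0.
have mgf : measurable_fun setT (fun x => g x * f x) by exact: measurable_funM.
have mVU : measurable_fun setT (fun x => V x * U x) by exact: measurable_funM.
have gfVU : {ae mu, forall x, g x * f x = V x * U x}.
  by apply: filterS2 fU gV => x -> ->.
case=> [[C C0 hC]|[r r1 [C C0 hC]]].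
  exists C => //; exists 1 => // y r r0; have [u u0 hu] := Ub y r r0.
  rewrite hu /=; apply: (A1_ineq (mb y r) (b0 y r r0) mU mV U0 V0 C0 hu).
  have := hC _ (ball_cube y r0).
  rewrite (weighted_wint (mb y r) mf mU fU) (weighted_wint (mb y r) mgf mVU gfVU) hu => h.
  apply: filterS (ess_inf_on_ae (ball y r) gV) => x hx bx.
  by apply: le_trans h (lee_wpmul2l _ (hx bx)); rewrite lee_fin ltW.
have r10 : 0 < r - 1 by rewrite subr_gt0.
have s0 : 0 < (r - 1)^-1 by rewrite invr_gt0.
exists C => //; exists ((r - 1)^-1) => // y rho rho0; have [u u0 hu] := Ub y rho rho0.
have mgf' : measurable_fun setT (fun x => g x `^ (- (r - 1)^-1) * f x).
  by apply: measurable_funM; [exact: measurable_funpow|exact: mf].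
have mVU' : measurable_fun setT (fun x => V x `^ (- (r - 1)^-1) * U x).
  by apply: measurable_funM; [exact: measurable_funpow|exact: mU].
have gfVU' : {ae mu, forall x, g x `^ (- (r - 1)^-1) * f x = V x `^ (- (r - 1)^-1) * U x}.
  by apply: filterS2 fU gV => x -> ->.
have := hC _ (ball_cube y rho0).
rewrite (weighted_wint (mb _ _) mf mU fU) (weighted_wint (mb _ _) mgf mVU gfVU).
rewrite (weighted_wint (mb _ _) mgf' mVU' gfVU') hu /= => h.
apply: (Ar_ineq u0 s0 C0); last by rewrite invrK.
- by apply: (wint_gt0 (mb y rho) mVU _ (b0 y rho rho0)) => x; rewrite mulr_gt0.
- by apply: (wint_gt0 (mb y rho) mVU' _ (b0 y rho rho0)) => x; rewrite mulr_gt0// powR_gt0.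
Qed.

End weight_conversion.

(** * The Euclidean kernel and Hoelder continuous symbols *)

Section kernel_commutator_ae.
Context (R : realType) d (T : measurableType d).
Variable mu : {sigma_finite_measure set T -> \bar R}.
Variables (k : T -> T -> R) (b : T -> R).
Hypothesis mk : measurable_fun setT (fun z : T * T => k z.1 z.2).
Hypothesis mb : measurable_fun setT b.

Lemma kernel_commutator_ae m (f g : T -> R) : measurable_fun setT f ->
  measurable_fun setT g -> {ae mu, forall x, f x = g x} ->
  kernel_commutator mu k b m f = kernel_commutator mu k b m g.
Proof.
elim: m f g => [|m IH] f g mf mg fg.
  apply/funext => x; congr fine; apply: ae_eq_integral => //.
  - apply/measurable_EFinP; apply: measurable_funM => //.
    exact: (measurableT_comp mk (pair1_measurable x)).
  - apply/measurable_EFinP; apply: measurable_funM => //.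
    exact: (measurableT_comp mk (pair1_measurable x)).
  - by apply: filterS fg => y -> _.
rewrite /kernel_commutator !iterS -!/(kernel_commutator mu k b m).
have mbf : measurable_fun setT (fun y => b y * f y) by exact: measurable_funM.
have mbg : measurable_fun setT (fun y => b y * g y) by exact: measurable_funM.
have bfg : {ae mu, forall y, b y * f y = b y * g y} by apply: filterS fg => y ->.
by apply/funext => x; rewrite (IH f g mf mg fg) (IH _ _ mbf mbg bfg).
Qed.

End kernel_commutator_ae.

Section euclidean_kernel.
Context (R : realType) (n : nat).
Implicit Types (x y : 'rV[R]_n) (b : 'rV[R]_n -> R).

Lemma enorm_ge0 x : 0 <= enorm x. Proof. exact: sqrtr_ge0. Qed.

Lemma enorm0 : enorm (0 : 'rV[R]_n) = 0.
Proof.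
rewrite /enorm big1 ?sqrtr0// => i _; by rewrite mxE expr0n.
Qed.

Lemma enorm_gt0 x y : x != y -> 0 < enorm (x - y).
Proof.
move=> xy; rewrite lt0r enorm_ge0 andbT; apply: contra xy => /eqP e0.
apply/eqP/supdist_eq0/eqP; rewrite eq_le supdist_ge0 andbT -e0.
exact: supdist_le_enorm.
Qed.

Lemma measurable_enorm d (T : measurableType d) (f g : T -> 'rV[R]_n) :
  measurable_fun setT (f : T -> borel_rV R n) ->
  measurable_fun setT (g : T -> borel_rV R n) ->
  measurable_fun setT (fun t => enorm (f t - g t)).
Proof.
move=> mf mg.
have msq : measurable_fun setT (Num.sqrt : R -> R).
  exact: continuous_measurable_fun (@sqrt_continuous R).
apply: (measurableT_comp msq); apply: measurable_sum => i.
apply: measurable_funX; under eq_fun do rewrite !mxE.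
by apply: measurable_funB; apply: (measurableT_comp (measurable_coord i)).
Qed.

(** The sup distance is at most the Euclidean one.  For x = y the left side is 0,
    by the convention on inverses. *)
Lemma enorm_kernel_le (a : R) x y : 0 < a < n%:R ->
  (enorm (x - y) `^ (n%:R - a))^-1 <= (supdist y x ^+ n) `^ (- (1 - a / n%:R)).
Proof.
move=> /andP[a0 an]; have n0 : 0 < n%:R :> R by rewrite (lt_trans a0).
have na : n%:R - a != 0 by rewrite gt_eqF// subr_gt0.
have [->|xy] := eqVneq x y.
  by rewrite subrr enorm0 powR0// invr0 powR_ge0.
have d0 : 0 < supdist y x.
  rewrite lt0r supdist_ge0 andbT; apply: contra xy => /eqP/supdist_eq0 ->.
  by [].
rewrite -powR_mulrn ?supdist_ge0// -powRrM mulrN mulrBr mulr1 mulrCA mulfV ?gt_eqF//.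
rewrite mulr1 powRN lef_pV2 ?posrE ?powR_gt0 ?enorm_gt0//.
apply: ge0_ler_powR; rewrite ?nnegrE ?supdist_ge0 ?enorm_ge0 ?subr_ge0 ?(ltW an)//.
by rewrite supdistC supdist_le_enorm.
Qed.

Lemma Lambda_norm_ge0 (d : R) b : Lambda d b -> 0 <= Lambda_norm d b.
Proof.
by move=> [_ [C C0 hC]]; apply: lb_le_inf; [exists C|move=> z [/ltW]].
Qed.

(** The infimum is attained: the quotients of |b x - b y| by |x - y| ^ d are
    lower bounds of the admissible constants. *)
Lemma Lambda_normP (d : R) b : Lambda d b -> d != 0 -> holder_bound d b (Lambda_norm d b).
Proof.
move=> [_ [C C0 hC]] d0 x y.
have [->|xy] := eqVneq x y.
  by rewrite !subrr normr0 enorm0 powR0// mulr0.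
have e0 : 0 < enorm (x - y) `^ d by rewrite powR_gt0// enorm_gt0.
rewrite -ler_pdivrMr//; apply: lb_le_inf; first by exists C.
by move=> z [_ hz]; rewrite ler_pdivrMr.
Qed.

(** For x = y the left side vanishes because m > 0. *)
Lemma commutator_kernel_le (gamma delta : R) (m : nat) b x y : (0 < m)%N ->
  0 < gamma -> 0 < delta -> gamma + m%:R * delta < n%:R -> Lambda delta b ->
  `|(b x - b y) ^+ m * (enorm (x - y) `^ (n%:R - gamma))^-1| <=
  Lambda_norm delta b ^+ m *
    (supdist y x ^+ n) `^ (- (1 - (gamma + m%:R * delta) / n%:R)).
Proof.
move=> m0 g0 d0 an bL; have L0 := Lambda_norm_ge0 bL.
have md0 : 0 < m%:R * delta by rewrite mulr_gt0// ltr0n.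
have [->|xy] := eqVneq x y.
  by rewrite subrr expr0n gtn_eqF// mul0r normr0 mulr_ge0 ?powR_ge0 ?exprn_ge0.
have e0 := enorm_gt0 xy.
apply: (@le_trans _ _ (Lambda_norm delta b ^+ m *
    (enorm (x - y) `^ (n%:R - (gamma + m%:R * delta)))^-1)); last first.
  by rewrite ler_wpM2l ?exprn_ge0// enorm_kernel_le// an addr_gt0.
rewrite normrM normrX [X in _ * X]ger0_norm ?invr_ge0 ?powR_ge0//.
have -> : (enorm (x - y) `^ (n%:R - (gamma + m%:R * delta)))^-1 =
   (enorm (x - y) `^ delta) ^+ m * (enorm (x - y) `^ (n%:R - gamma))^-1.
  rewrite -powR_mulrn ?powR_ge0// -powRrM -!powRN mulrC.
  rewrite -(powR_pos_sum (delta * m%:R) (- (n%:R - gamma)) e0); congr (_ `^ _); ring.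
rewrite mulrA -exprMn ler_wpM2r ?invr_ge0 ?powR_ge0// lerXn2r ?nnegrE ?mulr_ge0 ?powR_ge0//.
by apply: Lambda_normP; rewrite ?gt_eqF.
Qed.

Lemma enorm_le (M : R) y : 0 <= M -> supdist y 0 <= M ->
  enorm y <= Num.sqrt (\sum_(i < n) M ^+ 2).
Proof.
move=> M0 /(supdist_leP _ _ M0) h; rewrite ler_wsqrtr//; apply: ler_sum => i _.
have := h i; rewrite mxE subr0 => hi; rewrite -[_ ^+ 2]ger0_norm ?sqr_ge0// normrX.
by rewrite lerXn2r ?nnegrE.
Qed.

Lemma compact_supdist (K : set 'rV[R]_n) : compact K ->
  exists2 M : R, 0 < M & forall y, K y -> supdist y 0 <= M.
Proof.
move=> cK; have [M0 [_ hM]] := compact_bounded cK.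
exists (`|M0| + 1); first by rewrite ltr_wpDl.
move=> y Ky; apply/supdist_leP; first by rewrite addr_ge0.
move=> i; rewrite mxE subr0; apply: le_trans (hM (`|M0| + 1) _ y Ky).
  rewrite [leRHS]/Num.Def.normr/= mx_normrE.
  exact: (le_bigmax _ (fun ij : 'I_1 * 'I_n => `|y ij.1 ij.2|) (ord0, i)).
by rewrite (le_lt_trans (ler_norm _))// ltrDl.
Qed.

Lemma compact_cube (a : 'rV[R]_n) (l : R) : compact (cube a l).
Proof.
rewrite cubeE.
exact: (@rV_compact R n (fun i => `[a ord0 i, a ord0 i + l]%classic) (fun i => @segment_compact R _ _)).
Qed.

End euclidean_kernel.

(** * Commutators on Euclidean space *)

Lemma pos_version (R : realType) d (T : measurableType d) (mu : {measure set T -> \bar R})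
    (w : T -> R) : measurable_fun setT w -> {ae mu, forall x, 0 < w x} ->
  exists2 w' : T -> R, measurable_fun setT w' /\ (forall x, 0 < w' x) &
    {ae mu, forall x, w x = w' x}.
Proof.
move=> mw w0; exists (fun x => if 0 < w x then w x else 1); last first.
  by apply: filterS w0 => x ->.
split; last by move=> x; case: ifPn.
by apply: measurable_fun_ifT => //; apply: measurable_fun_ltr.
Qed.

Section weak_type_of_testing.
Context (R : realType) (n m : nat) (gamma delta p q : R).
Local Notation T := (lebesgue_rV_type R n).
Local Notation mu := (@lebesgue_rV R n).
Local Notation alpha := (gamma + m%:R * delta).
Hypotheses (m0 : (0 < m)%N) (g0 : 0 < gamma) (d0 : 0 < delta) (an : alpha < n%:R)
  (p1 : 1 <= p) (pq : p < q) (pqE : q^-1 = p^-1 - alpha / n%:R).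
Variables (b u v : 'rV[R]_n -> R).
Hypotheses (bL : Lambda delta b) (wu : weight u) (wv : weight v).

Let n0 : (0 < n)%N.
Proof.
by rewrite -(ltr0n R) (lt_trans _ an)// addr_gt0// mulr_gt0// ltr0n.
Qed.

Let ldist_ge0 (x y : T) : 0 <= ldist x y. Proof. exact: supdist_ge0. Qed.
Let ldistC (x y : T) : ldist x y = ldist y x. Proof. exact: supdistC. Qed.

Lemma testing_A1_lebesgue (V U : T -> R) : pos_weight mu (@ldist R n) V ->
  pos_weight mu (@ldist R n) U -> A1_ball n mu (@ldist R n) V -> A1_ball n mu (@ldist R n) U ->
  testing n mu (@ldist R n) V U.
Proof.
move=> pV pU aV aU; have [mU U0 _] := pU.
apply: (testing_A1 (@measurable_ldist R n) ldist_ge0 n0 (@lebesgue_ball R n)) => //.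
- exact: A1_center_of_A1.
- exact: Ainfty_ball_of_A1.
Qed.

Let kern (x y : T) : R := (enorm ((x : 'rV[R]_n) - y) `^ (n%:R - gamma))^-1.

Let measurable_kern : measurable_fun setT (fun z : T * T => kern z.1 z.2).
Proof.
apply: measurable_funV; apply: measurable_funpow; apply: measurable_enorm.
  exact: (measurableT_comp (@measurable_idb R n) measurable_fst).
exact: (measurableT_comp (@measurable_idb R n) measurable_snd).
Qed.

Lemma integrable_against_kernel (h : T -> R) (M : R) : measurable_fun setT h ->
  (wint mu (fun y => `|h y|)%R setT < +oo)%E ->
  (forall y, h y != 0 -> supdist (y : 'rV[R]_n) 0 <= M) ->
  {ae mu, forall x, mu.-integrable setT (EFin \o (fun y => h y * kern x y))}.
Proof.
move=> mh hoo hM.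
have P11 : testing n mu (@ldist R n) (fun=> 1) (fun=> 1).
  have pw := pos_weight_cst1 (@measurable_ldist R n) (@lebesgue_ball R n).
  have aw := A1_ball_cst1 (@measurable_ldist R n) (@lebesgue_ball R n).
  exact: testing_A1_lebesgue.
have mah : measurable_fun setT (fun y => `|h y|).
  exact: (measurableT_comp (@normr_measurable R setT) mh).
have gn : gamma < n%:R.
  by apply: lt_trans an; rewrite ltrDl mulr_gt0// ltr0n.
have th01 : 0 < gamma / n%:R < 1.
  by rewrite divr_gt0 ?ltr0n//= ltr_pdivrMr ?ltr0n// mul1r.
have tri (x y z : T) : ldist x z <= ldist x y + ldist y z by exact: supdist_triangle.
have hM' (y : T) : `|h y| != 0 -> ldist y (0 : 'rV[R]_n) <= M.
  by rewrite normr_eq0; exact: hM.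
have := potential_ae_fin (@measurable_ldist R n) ldist_ge0 ldistC tri n0 P11 mah
  (fun y => normr_ge0 (h y)) hoo th01 hM'.
apply: filterS => x hx; apply/integrableP.
have mk : measurable_fun setT (fun y => h y * kern x y).
  apply: measurable_funM; first exact: mh.
  exact: (measurableT_comp measurable_kern (pair1_measurable x)).
split; first by apply/measurable_EFinP; exact: mk.
apply: le_lt_trans hx; apply: ge0_le_integral.
- exact: measurableT.
- by move=> y _; exact: abse_ge0.
- apply/measurable_EFinP; exact: (measurableT_comp (@normr_measurable R setT) mk).
- apply/measurable_EFinP; apply: measurable_funM; first exact: mah.
  by apply: measurable_funpow; apply: measurable_vdistl; exact: measurable_ldist.
move=> y _; rewrite /= lee_fin normrM ler_wpM2l// ger0_norm ?invr_ge0 ?powR_ge0//.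
by apply: enorm_kernel_le; rewrite g0.
Qed.

(** The three pointwise identities express how the weights of the statement are
    recovered from U, V and S.  They are about u' and v', which are positive
    everywhere and almost everywhere equal to u and v. *)
Theorem weak_type_of_testing (u' v' U V S : T -> R) :
  measurable_fun setT u' -> measurable_fun setT v' ->
  (forall x, 0 < v' x) ->
  {ae mu, forall x : T, u x = u' x} -> {ae mu, forall x : T, v x = v' x} ->
  measurable_fun setT U -> measurable_fun setT V -> measurable_fun setT S ->
  (forall x, 0 < U x) -> (forall x, 0 < V x) -> (forall x, 0 < S x) ->
  testing n mu (@ldist R n) U S -> testing n mu (@ldist R n) V U ->
  (forall x, v' x = V x `^ q^-1 * S x `^ (1 - p^-1)) ->
  (forall x, u' x * v' x `^ (q / p) = U x * V x) ->
  (forall x, u' x `^ (p / q) * v' x =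
     v' x `^ p * U x `^ (p / q) * S x `^ (1 - p)) ->
  exists C : R, forall (t : R) (f : 'rV[R]_n -> R),
    0 < t -> lebesgue_measurable_fun f -> bounded_fun (f : 'rV[R]_n -> R^o) ->
    compact (closure [set x | f x != 0]) ->
    ((weighted (fun x => u x * v x `^ (q / p))%R
        [set x | (t < `|fractional_commutator gamma b m
                          (fun y => f y * v y) x| / v x)%R]) `^ q^-1 <=
     (C / t * Lambda_norm delta b ^+ m)%:E *
     (\int[mu]_x (`|f x| `^ p * u x `^ (p / q) * v x)%:E) `^ p^-1)%E.
Proof.
move=> mu' mv' v'0 uu' vv' mU mV mS U0 V0 S0 PUS PVU vE uvE fE.
have mv : measurable_fun setT (v : T -> R) by case: wv => -[].
have mu0 : measurable_fun setT (u : T -> R) by case: wu => -[].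
have mb : measurable_fun setT (b : T -> R) by case: bL => -[].
have L0 := Lambda_norm_ge0 bL.
have eE : q^-1 + (1 - p^-1) = 1 - alpha / n%:R by rewrite pqE; ring.
have bk (x y : T) : `|(b x - b y) ^+ m * kern x y| <=
    Lambda_norm delta b ^+ m * vdist n (@ldist R n) y x `^ (- (q^-1 + (1 - p^-1))).
  by rewrite eE; exact: commutator_kernel_le.
have [C C0 hC] := commutator_weak_type (@measurable_ldist R n) ldist_ge0 ldistC
  mU mV mS U0 V0 S0 p1 pq (fun=> PUS) PVU measurable_kern mb (exprn_ge0 m L0) bk.
exists C => t f t0 mf bf cf.
have [F fF] : exists F, forall x, `|f x| <= F.
  have [F0 [_ hF]] := bf; exists (`|F0| + 1) => x; apply: hF => //.
  by rewrite (le_lt_trans (ler_norm _))// ltrDl.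
have [M M0 hM] := compact_supdist cf.
have {}hM (y : 'rV[R]_n) : f y != 0 -> supdist y 0 <= M.
  by move=> fy; apply: hM; exact: subset_closure.
have hb (y : T) : f y != 0 -> `|b y| <= `|b 0| + Lambda_norm delta b *
    (Num.sqrt (\sum_(i < n) M ^+ 2)) `^ delta.
  move=> fy; rewrite -[b y](subrKC (b 0)); apply: le_trans (ler_normD _ _) _.
  rewrite lerD2l; apply: le_trans (Lambda_normP bL _ _ _) _; first by rewrite gt_eqF.
  rewrite ler_wpM2l// subr0; apply: ge0_ler_powR; rewrite ?nnegrE ?enorm_ge0 ?sqrtr_ge0 ?(ltW d0)//.
  by apply: enorm_le; [exact: ltW|exact: hM].
have mfv : measurable_fun setT (fun y : T => f y * v y) by apply: measurable_funM; [exact: mf|exact: mv].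
have mfv' : measurable_fun setT (fun y : T => f y * v' y) by apply: measurable_funM; [exact: mf|exact: mv'].
have fvE : {ae mu, forall y : T, f y * v y = f y * v' y} by apply: filterS vv' => y ->.
have maf : measurable_fun setT (fun y : T => `|f y|).
  exact: (measurableT_comp (@normr_measurable R setT) mf).
have hoo : (wint mu (fun y => `|f y * v' y|)%R setT < +oo)%E.
  pose B := cube (0 - const_mx M : 'rV[R]_n) (2 * M).
  have mB : measurable (B : set T) by exact: measurable_cube.
  have mav' : measurable_fun setT (fun y : T => `|v' y|).
    exact: (measurableT_comp (@normr_measurable R setT) mv').
  have mav : measurable_fun setT (fun y : T => `|v y|).
    exact: (measurableT_comp (@normr_measurable R setT) mv).
  have F0 : 0 <= F by apply: le_trans (fF 0).
  have vB : (F%:E * wint mu (fun y : T => `|v' y|)%R B < +oo)%E.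
    have : (wint mu (fun y : T => `|v' y|)%R B < +oo)%E.
      rewrite -(weighted_wint mB mav mav'); first by case: wv => -[_ h] _; apply: h; exact: compact_cube.
      by apply: filterS vv' => y ->.
    by move=> h; rewrite lte_mul_pinfty.
  apply: le_lt_trans vB; rewrite -(wintZ mu mB mav' (fun x => normr_ge0 _) F0).
  have mafv' : measurable_fun setT (fun y : T => `|f y * v' y|).
    exact: (measurableT_comp (@normr_measurable R setT) mfv').
  rewrite (_ : wint mu _ setT = wint mu (fun y => `|f y * v' y|) B).
    apply: le_wint; [exact: mB|exact: mafv'| |].
      by apply: measurable_funM; [exact: measurable_cst|exact: mav'].
    by move=> x _; rewrite normr_ge0 normrM ler_wpM2r.
  rewrite /wint [RHS]integral_mkcond; apply: eq_integral => y _.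
  rewrite /patch; case: ifPn => // yB; have [->|fy] := eqVneq (f y) 0.
    by rewrite mul0r normr0.
  case/negP: yB; rewrite inE /B -cubeball ?(ltW M0)//=; exact: hM.
have hM' (y : 'rV[R]_n) : f y * v' y != 0 -> supdist y 0 <= M.
  by rewrite mulf_eq0 negb_or => /andP[fy _]; exact: hM.
have hint := integrable_against_kernel mfv' hoo hM'.
have := hC f v' _ t mf mv' v'0 vE t0 hb hint.
have KE : fractional_commutator gamma b m (fun y => f y * v y) =
    kernel_commutator mu kern b m (fun y => f y * v' y).
  rewrite -(kernel_commutator_ae measurable_kern mb m mfv mfv' fvE).
  by [].
rewrite KE; set K := kernel_commutator _ _ _ _ _.
have mK : measurable_fun setT (fun x => `|K x|).
  apply: (measurableT_comp (@normr_measurable R setT)).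
  exact: (measurable_kernel_commutator mu measurable_kern mb m mfv').
have mlev (w : T -> R) : measurable_fun setT w -> measurable [set x | t < `|K x| / w x].
  move=> mw; apply: measurable_lt_set; first exact: measurable_cst.
  by apply: measurable_funM; [exact: mK|exact: measurable_funV].
have mUV : measurable_fun setT (fun x => U x * V x).
  by apply: measurable_funM; [exact: mU|exact: mV].
have UV0 x : 0 <= U x * V x by rewrite mulr_ge0// ltW.
have muv : measurable_fun setT (fun x : T => u x * v x `^ (q / p)).
  by apply: measurable_funM; [exact: mu0|exact: measurable_funpow].
have uvae : {ae mu, forall x : T, u x * v x `^ (q / p) = U x * V x}.
  by apply: filterS2 uu' vv' => x -> ->; exact: uvE.
have mp (w : T -> R) (r : R) : measurable_fun setT w -> measurable_fun setT (fun x => w x `^ r).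
  by move=> mw; exact: measurable_funpow.
have q0 : 0 < q by rewrite (lt_trans _ pq)// (lt_le_trans _ p1).
set Rhs := wint mu _ setT => h; rewrite (_ : (\int[mu]_x _)%E = Rhs).
  rewrite (weighted_wint (mlev _ mv) muv mUV uvae).
  apply: le_trans h; apply: le_poweR; first by rewrite invr_ge0 ltW.
    by apply: wint_ge0 => x _; exact: UV0.
  apply: (wint_ae_subset (mlev _ mv) (mlev _ mv') mUV UV0).
  by apply: filterS vv' => x /= ->.
apply: weighted_wint.
- exact: measurableT.
- by apply: measurable_funM; [apply: measurable_funM; exact: mp|exact: mv].
- apply: measurable_funM; [apply: measurable_funM|exact: mp]; last exact: mp.
  by apply: mp; apply: measurable_funM; [exact: maf|exact: mv'].
- apply: filterS2 uu' vv' => x -> ->.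
  by rewrite powRM ?(ltW (v'0 _))// -!mulrA; congr (_ * _); rewrite fE mulrA.
Qed.

End weak_type_of_testing.

(** * The two weight conditions *)

(** For p = 1 the conjugate exponent is infinite and both sides are 0. *)
Lemma q_over_conjugate (R : realType) (p q : R) : 1 <= p ->
  fine (q%:E / hoelder_conjugate p%:E)%E = q * (1 - p^-1).
Proof.
move=> p1; have p0 : p != 0 by rewrite gt_eqF// (lt_le_trans _ p1).
have := @hoelder_conjugate_eq1 R p%:E (ltNyr p); rewrite eqe => /(_ p0).
rewrite inver (negbTE p0); move: (hoelder_conjugate _)^-1%E => [z| |]//= [].
by move=> <-; rewrite addrAC subrr add0r.
Qed.

Theorem theorem16 (R : realType) (n m : nat) (gamma delta p q : R)
    (b u v : 'rV[R]_n -> R) :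
  0 < gamma < n%:R ->
  (0 < m)%N ->
  0 < delta < Num.min ((n%:R - gamma) / m%:R) 1 ->
  Lambda delta b ->
  1 <= p < n%:R / (gamma + m%:R * delta) ->
  q^-1 = p^-1 - (gamma + m%:R * delta) / n%:R ->
  weight u -> weight v ->
  let q_p' : R := fine (q%:E / hoelder_conjugate p%:E)%E in
  let mu : 'rV[R]_n -> R := fun x => u x * v x `^ (- q_p') in
  (A1 u /\ A1 (fun x => v x `^ (q / p))) \/
  (A1 mu /\ Ainfty_mu mu (fun x => v x `^ q)) ->
  exists C : R, forall (t : R) (f : 'rV[R]_n -> R),
    0 < t ->
    lebesgue_measurable_fun f ->
    bounded_fun (f : 'rV[R]_n -> R^o) ->
    compact (closure [set x | f x != 0]) ->
    ((weighted (fun x => u x * v x `^ (q / p))%R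
        [set x | (t < `|fractional_commutator gamma b m
                          (fun y => f y * v y) x| / v x)%R]) `^ q^-1 <=
     (C / t * Lambda_norm delta b ^+ m)%:E *
     (\int[@lebesgue_rV R n]_x
        (`|f x| `^ p * u x `^ (p / q) * v x)%:E) `^ p^-1)%E.
Proof.
move=> /andP[g0 gn] m0 /andP[d0 dn] bL /andP[p1 pn] pqE wu wv q_p' mu' hyp.
have n0 : 0 < n%:R :> R by rewrite (lt_trans g0).
have mR : 0 < m%:R :> R by rewrite ltr0n.
have a0 : 0 < gamma + m%:R * delta by rewrite addr_gt0// mulr_gt0.
have an : gamma + m%:R * delta < n%:R.
  by move: dn; rewrite lt_min ltr_pdivlMr// => /andP[h _]; rewrite mulrC; lra.
have p0 : 0 < p by rewrite (lt_le_trans _ p1).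
have qi0 : 0 < q^-1.
  rewrite pqE subr_gt0 -[ltRHS]div1r ltr_pdivlMr// mulrC.
  by move: pn; rewrite ltr_pdivlMr// => h; rewrite mulrA ltr_pdivrMr// mul1r.
have q0 : 0 < q by rewrite -invr_gt0.
have pq : p < q.
  by rewrite -ltf_pV2 ?posrE// pqE gtrBl divr_gt0.
have [[mu0 _] u0] := wu; have [[mv0 _] v0] := wv.
have [u1 [mu1 u1p] uu1] := pos_version mu0 u0.
have [v1 [mv1 v1p] vv1] := pos_version mv0 v0.
have pw (w : lebesgue_rV_type R n -> R) (r : R) : measurable_fun setT w ->
    measurable_fun setT (fun x => w x `^ r).
  by move=> mw; exact: measurable_funpow.
have vv1p (r : R) : {ae @lebesgue_rV R n, forall x, v x `^ r = v1 x `^ r}.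
  by apply: filterS vv1 => x ->.
have v1V r x : v1 x `^ r != 0 by rewrite gt_eqF// powR_gt0.
have v1K (r : R) x : r != 0 -> (v1 x `^ r) `^ r^-1 = v1 x.
  by move=> r0; rewrite -powRrM mulfV// powRr1// ltW.
have split1 x : v1 x = v1 x `^ p^-1 * v1 x `^ (1 - p^-1).
  by rewrite -powR_pos_sum// addrC subrK powRr1// ltW.
case: hyp => [[A1u A1v]|[A1m Am]].
  have [pu au] := A1_ball_of_A1 mu0 mu1 u1p uu1 A1u.
  have [pV aV] := A1_ball_of_A1 (pw _ _ mv0) (pw _ _ mv1) (fun x => powR_gt0 _ (v1p x)) (vv1p _) A1v.
  have qp0 : q / p != 0 by rewrite gt_eqF// divr_gt0.
  have [ps asw] : pos_weight (@lebesgue_rV R n) (@ldist R n) v1 /\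
      A1_ball n (@lebesgue_rV R n) (@ldist R n) v1.
    (* v is the power p / q of the A_1 weight v ^ (q / p) *)
    have s1 : 0 < p / q <= 1 by rewrite divr_gt0//= ler_pdivrMr// mul1r ltW.
    have := A1_ball_powR (@measurable_ldist R n) (@lebesgue_ball R n) s1 pV aV.
    rewrite (_ : (fun x => (v1 x `^ (q / p)) `^ (p / q)) = v1)//.
    by apply/funext => x; rewrite -[p / q]invf_div v1K.
  have PUS := testing_A1_lebesgue m0 g0 d0 an pu ps au asw.
  have PVU := testing_A1_lebesgue m0 g0 d0 an pV pu aV au.
  apply: (weak_type_of_testing m0 g0 d0 an p1 pq pqE bL wu wv mu1 mv1 v1p uu1 vv1
    mu1 (pw _ (q / p) mv1) mv1 u1p (fun x => powR_gt0 _ (v1p x)) v1p PUS PVU).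
  - move=> x; rewrite -powRrM mulrAC mulfV ?gt_eqF// mul1r; exact: split1.
  - by [].
  - move=> x; rewrite mulrAC -powR_pos_sum// addrC subrK powRr1 ?(ltW (v1p x))//.
    exact: mulrC.
pose U x := u1 x * v1 x `^ (- (q * (1 - p^-1))).
pose V x := v1 x `^ q.
have q_pE : q_p' = q * (1 - p^-1) by exact: q_over_conjugate.
have mU : measurable_fun setT (U : lebesgue_rV_type R n -> R).
  by apply: measurable_funM; [exact: mu1|exact: pw].
have U0 x : 0 < U x by rewrite mulr_gt0 ?powR_gt0.
have mm : measurable_fun setT (mu' : lebesgue_rV_type R n -> R).
  by apply: measurable_funM; [exact: mu0|exact: pw].
have mU' : {ae @lebesgue_rV R n, forall x, mu' x = U x}.
  by apply: filterS2 uu1 vv1 => x; rewrite /mu' /U q_pE => -> ->.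
have [pU aU] := A1_ball_of_A1 mm mU U0 mU' A1m.
have mV := pw _ q mv1; have V0 x : 0 < V x by rewrite powR_gt0.
have aV : Ar_ball (@lebesgue_rV R n) (@ldist R n) U V.
  exact: (Ar_ball_of_Ainfty mm (pw _ q mv0) mU' (vv1p q) pU mV V0 Am).
have [ps asw] := (pos_weight_cst1 (@measurable_ldist R n) (@lebesgue_ball R n),
  A1_ball_cst1 (@measurable_ldist R n) (@lebesgue_ball R n)).
have m1 : measurable_fun setT (fun _ : lebesgue_rV_type R n => 1 : R) by exact: measurable_cst.
have PUS := testing_A1_lebesgue m0 g0 d0 an pU ps aU asw.
have nN : (0 < n)%N by rewrite -(ltr0n R).
have PVU : testing n (@lebesgue_rV R n) (@ldist R n) V U.
  exact: (testing_Ar (@measurable_ldist R n) (fun x y => supdist_ge0 x y) nN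
    (@lebesgue_ball R n) pU aU mV V0 (A1_center_of_A1 mU U0 aU) aV).
apply: (weak_type_of_testing m0 g0 d0 an p1 pq pqE bL wu wv mu1 mv1 v1p uu1 vv1
  mU mV m1 U0 V0 (fun=> ltr01) PUS PVU).
- by move=> x; rewrite powR1 mulr1 v1K// gt_eqF.
- move=> x; rewrite /U /V -mulrA -powR_pos_sum//; congr (_ * _ `^ _).
  by field; rewrite gt_eqF.
- move=> x; rewrite /U powR1 mulr1 powRM ?powR_ge0 ?(ltW (u1p x))// -powRrM.
  rewrite mulrCA -powR_pos_sum//; congr (_ * _).
  by rewrite -[LHS](powRr1 (ltW (v1p x))); congr (_ `^ _); field; rewrite !gt_eqF.
Qed.
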